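(* Let $K$ be a field (with involution) and let $(E,C)$ be a separated graph. Let $\mathcal Q$ be the two-sided ideal of $\mathcal C_K^{\mathrm{ab}}(E,C)$ generated by all $q_X=v-\sum_{e\in X}ee^*$ with $X\in C_v$ finite, $v\in E^0$. For each $T\in\mathcal X_{cb}$, the idempotent $\mathbf{ecb}(T)$ belongs to $\mathcal Q\cap\mathrm{soc}(\mathcal C_K^{\mathrm{ab}}(E,C))$. Moreover, $\mathcal Q\cap\mathrm{soc}(\mathcal C_K^{\mathrm{ab}}(E,C))$ is the ideal of $\mathcal C_K^{\mathrm{ab}}(E,C)$ generated by all the idempotents $\mathbf{ecb}(T)$, for $T\in\mathcal X_{cb}$.
   Context: Graphs and paths. A directed graph $E=(E^0,E^1,s,r)$ has arbitrary sets of vertices and edges and source/range maps $s,r$. A separated graph $(E,C)$ is a directed graph with $C=\bigsqcup_{v\in E^0}C_v$, where $C_v$ is a partition of $s^{-1}(v)$ into pairwise disjoint nonempty subsets ($C_v=\emptyset$ if $s^{-1}(v)=\emptyset$). For $e\in E^1$ let $e^{-1}$ be a formal inverse with $s(e^{-1})=r(e)$, $r(e^{-1})=s(e)$; $E^{-1}=\{e^{-1}\}$, $\hat E^1=E^1\cup E^{-1}$. A path is a vertex or a sequence $y_1\cdots y_n$ in $\hat E^1$ with $r(y_i)=s(y_{i+1})$; it is reduced if it has no subpath $xx^{-1}$, $x\in\hat E^1$. $\alpha\cdot\beta$ is the reduction of the concatenation $\alpha\beta$ when $r(\alpha)=s(\beta)$. $A^\downarrow$ is the set of prefixes of elements of $A$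 (the vertex $s(\nu)$ is a prefix of $\nu$); lower subsets are those closed under prefixes; $\max(T)$ is the set of prefix-maximal elements; $[g]_1$ is the first letter of a nontrivial reduced path $g$. $C$-compatible trees. A $C$-separated path is a reduced path with no subpath $x^{-1}y$ with $x,y\in X$, $X\in C$. $\mathbb F_C(v)$ is the set of $C$-separated paths with source $v$; $\mathbb F_C=\bigsqcup_v\mathbb F_C(v)$. $\gamma,\nu\in\mathbb F_C(v)$ are $C$-compatible if $\nu^{-1}\cdot\gamma\in\mathbb F_C$; a set is $C$-compatible if its elements are pairwise so. $\mathcal X_0(v)$ is the set of nonempty finite lower $C$-compatible subsets $T$ of $\mathbb F_C(v)$ none of whose maximal elements ends in an element of $E^{-1}$; $\mathcal X_0=\bigsqcup_v\mathcal X_0(v)$. Neighbors. $\mathcal N(v)=\{x_1^{-1}\cdots x_n^{-1}y\in\mathbb F_C(v):n\ge0,\ x_i,y\in E^1\}$. For $T\in\mathcal X_0$, $\mathcal N(T)=\{gg'\in\mathbb F_C: g\in T,\ g'\in\mathcal N(r(g)),\ g[g']_1\notin T,\ T\cup\{gg'\}^\downarrow\in\mathcal X_0\}$; each $\lambda\in\mathcal N(T)$ decomposes uniquely as $\lambda=\lambda_0\lambda_1$ with $\lambda_0\in T$, $\lambda_1=x_1^{-1}\cdots x_r^{-1}y$ and $\lambda_0[\lambda_1]_1\notin T$. Algebras. The Cohn path algebra $\mathcal C_K(E,C)$ is the universal $*$-algebra over $K$ generated by self-adjoint $v\in E^0$ and $e\in E^1$ subject to: $vw=\delta_{v,w}v$;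 $s(e)e=e=er(e)$; $e^*s(e)=e^*=r(e)e^*$; $e^*f=\delta_{e,f}r(e)$ for $e,f\in X$, $X\in C$. $\mathcal C_K^{\mathrm{ab}}(E,C)$ is its quotient by the two-sided ideal generated by all commutators $[xx^*,yy^*]$, $x,y$ in the multiplicative $*$-subsemigroup generated by $E^0\cup E^1$. Paths are viewed as elements via products, with $e^{-1}$ interpreted as $e^*$. $\mathbf e(T)=\prod_{\lambda\in\max(T)}\lambda\lambda^*$, and for finite $F\subseteq\mathcal N(T)$, $\mathbf e(T\setminus F)=\mathbf e(T)\prod_{\lambda\in F}(\lambda_0\lambda_0^*-\lambda\lambda^* )$. $\mathrm{soc}(A)$ is the sum of all minimal left ideals of $A$ (equal to the sum of all minimal right ideals here, because of the involution). $T\in\mathcal X_0$ can be completely blocked if $\mathcal N(T)$ is finite and non-empty; $\mathcal X_{cb}$ is the set of such $T$. For $T\in\mathcal X_{cb}$ there is a maximum blocking family for $T$ (a finite disjoint union of sets $\gamma X=\{\gamma x:x\in X\}\subseteq\mathcal N(T)$ with $X\in C$ finite), which contains all the elements of $\mathcal N(T)$, i.e. equals $\mathcal N(T)$, and $\mathbf{ecb}(T):=\mathbf e(T\setminus\mathcal N(T))$. *)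

(* Defs.v *)
From HB Require Import structures.
From mathcomp Require Import all_boot all_algebra.
From mathcomp Require Import finmap all_classical.

Set Implicit Arguments.
Unset Strict Implicit.
Unset Printing Implicit Defensive.

Import GRing.Theory.
Local Open Scope classical_set_scope.
Local Open Scope ring_scope.
Local Open Scope quotient_scope.

(* The algebras below have no unit when the graph has infinitely many vertices,
   so they are not instances of MathComp's [algType]. *)

HB.mixin Record isStarAlgebra (K : fieldType) (conj : K -> K) A
    of GRing.Lmodule K A := {
  nmul : A -> A -> A;
  star : A -> A;
  nmulA : associative nmul;
  nmulDl : left_distributive nmul +%R;
  nmulDr : right_distributive nmul +%R;
  nscalerAl : forall (a : K) x y, a *: nmul x y = nmul (a *: x) y;
  nscalerAr : forall (a : K) x y, a *: nmul x y = nmul x (a *: y);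
  starK : involutive star;
  starD : {morph star : x y / x + y};
  starZ : forall (a : K) x, star (a *: x) = conj a *: star x;
  starM : forall x y, star (nmul x y) = nmul (star y) (star x)
}.

#[short(type="starAlgType")]
HB.structure Definition StarAlgebra (K : fieldType) (conj : K -> K) :=
  { A of isStarAlgebra K conj A & GRing.Lmodule K A }.

Notation "x ** y" := (nmul x y) (at level 40, left associativity) : ring_scope.

(* Product of a nonempty sequence; the empty product is the junk value 0. *)
Definition nprod (K : fieldType) (conj : K -> K) (A : starAlgType conj)
    (s : seq A) : A :=
  if s is x :: s' then foldl nmul x s' else 0.

Section Ideals.
Variables (K : fieldType) (conj : K -> K) (A : starAlgType conj).
Implicit Types (I L S : set A) (x y : A).

Definition subspace S :=
  [/\ S 0, forall x y, S x -> S y -> S (x + y)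
    & forall (a : K) x, S x -> S (a *: x)].

Definition left_ideal L := subspace L /\ forall a x, L x -> L (a ** x).

Definition two_sided_ideal I :=
  left_ideal I /\ forall x a, I x -> I (x ** a).

Definition ideal_gen S : set A := smallest two_sided_ideal S.

Definition minimal_left_ideal L :=
  [/\ left_ideal L, L <> [set 0]
    & forall L', left_ideal L' -> L' `<=` L -> L' = [set 0] \/ L' = L].

Definition soc : set A :=
  [set x | exists2 s : seq A,
     (forall y, y \in s -> exists2 L, minimal_left_ideal L & L y)
     & x = \sum_(y <- s) y].

Definition star_closed S := forall x, S x -> S (star x).

Definition star_semigroup S :=
  (forall x y, S x -> S y -> S (x ** y)) /\ star_closed S.

Definition star_semigroup_gen S : set A := smallest star_semigroup S.

Definition commutator x y : A := x ** y - y ** x.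

End Ideals.

Section IdealTheory.
Variables (K : fieldType) (conj : K -> K) (A : starAlgType conj).
Implicit Types (I S : set A) (x y : A).

Lemma star0 : star 0 = 0 :> A.
Proof. by apply: (addIr (star 0)); rewrite -starD !add0r. Qed.

Lemma starN x : star (- x) = - star x.
Proof. by apply: (addIr (star x)); rewrite -starD !addNr star0. Qed.

Lemma starB x y : star (x - y) = star x - star y.
Proof. by rewrite starD starN. Qed.

Lemma nmulNl x y : (- x) ** y = - (x ** y).
Proof. by rewrite -scaleN1r -nscalerAl scaleN1r. Qed.

Lemma nmulNr x y : x ** (- y) = - (x ** y).
Proof. by rewrite -scaleN1r -nscalerAr scaleN1r. Qed.

Lemma star_commutator x y :
  star (commutator x y) = commutator (star y) (star x).
Proof. by rewrite /commutator starB !starM. Qed.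

Lemma ideal_gen_ideal S : two_sided_ideal (ideal_gen S).
Proof.
split; first split; first split.
- by move=> I [[[[]]]].
- by move=> x y Sx Sy I II; have [[[[_ + _] _] _] _] := II; apply; [exact: Sx|exact: Sy].
- by move=> a x Sx I II; have [[[[_ _ +] _] _] _] := II; apply; exact: Sx.
- by move=> a x Sx I II; have [[[_ +] _] _] := II; apply; exact: Sx.
- by move=> x a Sx I II; have [[_ +] _] := II; apply; exact: Sx.
Qed.

Lemma sub_ideal_gen S : S `<=` ideal_gen S.
Proof. by move=> x Sx I [_]; apply. Qed.

Lemma star_closed_ideal_gen S :
  (forall x, S x -> ideal_gen S (star x)) -> star_closed (ideal_gen S).
Proof.
move=> SS x Sx; apply: (Sx [set y | ideal_gen S (star y)]); split; last by [].
have [[[I0 ID IZ] IMl] IMr] := ideal_gen_ideal S.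
split; first split; first split => /=.
- by rewrite star0.
- by move=> y z; rewrite starD; exact: ID.
- by move=> a y; rewrite starZ; exact: IZ.
- by move=> a y /=; rewrite starM; exact: IMr.
- by move=> y a /=; rewrite starM; exact: IMl.
Qed.

End IdealTheory.

Section Terms.
Variables (K : fieldType) (X : Type).

Inductive term :=
  | TGen of X
  | TZero
  | TAdd of term & term
  | TOpp of term
  | TScale of K & term
  | TMul of term & term
  | TStar of term.

HB.instance Definition _ := gen_eqMixin term.
HB.instance Definition _ := gen_choiceMixin term.

End Terms.

Arguments TZero {K X}.

Section Presentation.
Variables (K : fieldType) (conj : K -> K) (X : Type).
Notation term := (term K X).
Variable R : term -> term -> Prop.
Implicit Types t u v w : term.

Inductive cong : term -> term -> Prop :=
  | cg_rel t u of R t u : cong t u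
  | cg_refl t : cong t t
  | cg_sym t u of cong t u : cong u t
  | cg_trans t u v of cong t u & cong u v : cong t v
  | cg_add t u v w of cong t u & cong v w : cong (TAdd t v) (TAdd u w)
  | cg_opp t u of cong t u : cong (TOpp t) (TOpp u)
  | cg_scale a t u of cong t u : cong (TScale a t) (TScale a u)
  | cg_mul t u v w of cong t u & cong v w : cong (TMul t v) (TMul u w)
  | cg_star t u of cong t u : cong (TStar t) (TStar u)
  | cg_addA t u v : cong (TAdd t (TAdd u v)) (TAdd (TAdd t u) v)
  | cg_addC t u : cong (TAdd t u) (TAdd u t)
  | cg_add0 t : cong (TAdd TZero t) t
  | cg_addN t : cong (TAdd (TOpp t) t) TZero
  | cg_scaleA a b t : cong (TScale a (TScale b t)) (TScale (a * b) t)
  | cg_scale1 t : cong (TScale 1 t) t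
  | cg_scaleDr a t u :
      cong (TScale a (TAdd t u)) (TAdd (TScale a t) (TScale a u))
  | cg_scaleDl a b t :
      cong (TScale (a + b) t) (TAdd (TScale a t) (TScale b t))
  | cg_mulA t u v : cong (TMul t (TMul u v)) (TMul (TMul t u) v)
  | cg_mulDl t u v : cong (TMul (TAdd t u) v) (TAdd (TMul t v) (TMul u v))
  | cg_mulDr t u v : cong (TMul t (TAdd u v)) (TAdd (TMul t u) (TMul t v))
  | cg_scaleAl a t u : cong (TScale a (TMul t u)) (TMul (TScale a t) u)
  | cg_scaleAr a t u : cong (TScale a (TMul t u)) (TMul t (TScale a u))
  | cg_starK t : cong (TStar (TStar t)) t
  | cg_starD t u : cong (TStar (TAdd t u)) (TAdd (TStar t) (TStar u))
  | cg_starZ a t : cong (TStar (TScale a t)) (TScale (conj a) (TStar t))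
  | cg_starM t u : cong (TStar (TMul t u)) (TMul (TStar u) (TStar t)).

Definition congb t u := `[< cong t u >].

Lemma congb_refl : reflexive congb.
Proof. by move=> t; apply/asboolP; exact: cg_refl. Qed.

Lemma congb_sym : symmetric congb.
Proof. by move=> t u; apply/asboolP/asboolP; exact: cg_sym. Qed.

Lemma congb_trans : transitive congb.
Proof.
by move=> u t v /asboolP tu /asboolP uv; apply/asboolP; exact: cg_trans uv.
Qed.

Canonical cong_equiv := EquivRel congb congb_refl congb_sym congb_trans.

Definition pres := {eq_quot cong_equiv}.

HB.instance Definition _ := Choice.on pres.

Definition pclass t : pres := \pi_pres t.

Lemma pclassP t u : pclass t = pclass u <-> cong t u.
Proof.
split; first by move=> /eqmodP/asboolP.
by move=> tu; apply/eqmodP/asboolP.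
Qed.

Lemma pclass_ind (P : pres -> Prop) : (forall t, P (pclass t)) -> forall x, P x.
Proof. by move=> Pt; elim/quotW => t; exact: Pt. Qed.

Lemma cong_repr t : cong (repr (pclass t)) t.
Proof. by apply/pclassP; rewrite /pclass reprK. Qed.

Definition pzero : pres := pclass TZero.
Definition padd (x y : pres) : pres := pclass (TAdd (repr x) (repr y)).
Definition popp (x : pres) : pres := pclass (TOpp (repr x)).
Definition pscale a (x : pres) : pres := pclass (TScale a (repr x)).
Definition pmul (x y : pres) : pres := pclass (TMul (repr x) (repr y)).
Definition pstar (x : pres) : pres := pclass (TStar (repr x)).

Lemma paddE t u : padd (pclass t) (pclass u) = pclass (TAdd t u).
Proof. by apply/pclassP; apply: cg_add; exact: cong_repr. Qed.
Lemma poppE t : popp (pclass t) = pclass (TOpp t).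
Proof. by apply/pclassP; apply: cg_opp; exact: cong_repr. Qed.
Lemma pscaleE a t : pscale a (pclass t) = pclass (TScale a t).
Proof. by apply/pclassP; apply: cg_scale; exact: cong_repr. Qed.
Lemma pmulE t u : pmul (pclass t) (pclass u) = pclass (TMul t u).
Proof. by apply/pclassP; apply: cg_mul; exact: cong_repr. Qed.
Lemma pstarE t : pstar (pclass t) = pclass (TStar t).
Proof. by apply/pclassP; apply: cg_star; exact: cong_repr. Qed.

Let pE := (paddE, poppE, pscaleE, pmulE, pstarE).

Lemma paddA : associative padd.
Proof.
do 3 elim/pclass_ind => ?; rewrite !pE; apply/pclassP; exact: cg_addA.
Qed.
Lemma paddC : commutative padd.
Proof. do 2 elim/pclass_ind => ?; rewrite !pE; apply/pclassP; exact: cg_addC. Qed.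
Lemma padd0 : left_id pzero padd.
Proof. elim/pclass_ind => ?; rewrite !pE; apply/pclassP; exact: cg_add0. Qed.
Lemma paddN : left_inverse pzero popp padd.
Proof. elim/pclass_ind => ?; rewrite !pE; apply/pclassP; exact: cg_addN. Qed.

HB.instance Definition _ := GRing.isZmodule.Build pres paddA paddC padd0 paddN.

Lemma pscaleA a b x : pscale a (pscale b x) = pscale (a * b) x.
Proof. elim/pclass_ind: x => ?; rewrite !pE; apply/pclassP; exact: cg_scaleA. Qed.
Lemma pscale1 : left_id 1 pscale.
Proof. elim/pclass_ind => ?; rewrite !pE; apply/pclassP; exact: cg_scale1. Qed.
Lemma pscaleDr : right_distributive pscale +%R.
Proof.
move=> a; do 2 elim/pclass_ind => ?.
rewrite -![_ + _]/(padd _ _) !pE; apply/pclassP; exact: cg_scaleDr.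
Qed.
Lemma pscaleDl x : {morph pscale^~ x : a b / a + b}.
Proof.
elim/pclass_ind: x => ? a b /=.
rewrite -![_ + _ in RHS]/(padd _ _) !pE; apply/pclassP; exact: cg_scaleDl.
Qed.

HB.instance Definition _ :=
  GRing.Zmodule_isLmodule.Build K pres pscaleA pscale1 pscaleDr pscaleDl.

Lemma pmulA : associative pmul.
Proof. do 3 elim/pclass_ind => ?; rewrite !pE; apply/pclassP; exact: cg_mulA. Qed.
Lemma pmulDl : left_distributive pmul +%R.
Proof.
do 3 elim/pclass_ind => ?.
rewrite -![_ + _]/(padd _ _) !pE; apply/pclassP; exact: cg_mulDl.
Qed.
Lemma pmulDr : right_distributive pmul +%R.
Proof.
do 3 elim/pclass_ind => ?.
rewrite -![_ + _]/(padd _ _) !pE; apply/pclassP; exact: cg_mulDr.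
Qed.
Lemma pscaleAl (a : K) (x y : pres) : a *: pmul x y = pmul (a *: x) y.
Proof.
elim/pclass_ind: x => ?; elim/pclass_ind: y => ?.
rewrite -![_ *: _]/(pscale _ _) !pE; apply/pclassP; exact: cg_scaleAl.
Qed.
Lemma pscaleAr (a : K) (x y : pres) : a *: pmul x y = pmul x (a *: y).
Proof.
elim/pclass_ind: x => ?; elim/pclass_ind: y => ?.
rewrite -![_ *: _]/(pscale _ _) !pE; apply/pclassP; exact: cg_scaleAr.
Qed.
Lemma pstarK : involutive pstar.
Proof. elim/pclass_ind => ?; rewrite !pE; apply/pclassP; exact: cg_starK. Qed.
Lemma pstarD : {morph pstar : x y / x + y}.
Proof.
do 2 elim/pclass_ind => ?.
rewrite -![_ + _]/(padd _ _) !pE; apply/pclassP; exact: cg_starD.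
Qed.
Lemma pstarZ (a : K) (x : pres) : pstar (a *: x) = conj a *: pstar x.
Proof.
elim/pclass_ind: x => ?.
rewrite -![_ *: _]/(pscale _ _) !pE; apply/pclassP; exact: cg_starZ.
Qed.
Lemma pstarM x y : pstar (pmul x y) = pmul (pstar y) (pstar x).
Proof.
elim/pclass_ind: x => ?; elim/pclass_ind: y => ?.
rewrite !pE; apply/pclassP; exact: cg_starM.
Qed.

HB.instance Definition _ := isStarAlgebra.Build K conj pres
  pmulA pmulDl pmulDr pscaleAl pscaleAr pstarK pstarD pstarZ pstarM.

Definition pgen (x : X) : pres := pclass (TGen K x).

Section Lift.
Variables (B : starAlgType conj) (f : X -> B).

Fixpoint teval (t : term) : B :=
  match t with
  | TGen x => f x
  | TZero => 0
  | TAdd t u => teval t + teval u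
  | TOpp t => - teval t
  | TScale a t => a *: teval t
  | TMul t u => teval t ** teval u
  | TStar t => star (teval t)
  end.

Definition star_morphism (phi : pres -> B) :=
  [/\ {morph phi : x y / x + y}, forall a, {morph phi : x / a *: x},
      {morph phi : x y / x ** y} & {morph phi : x / star x}].

Hypothesis fR : forall t u, R t u -> teval t = teval u.

Lemma teval_cong t u : cong t u -> teval t = teval u.
Proof.
elim=> //=.
- by move=> ? ? ? _ -> _ ->.
- by move=> ? ? ? ? _ -> _ ->.
- by move=> ? ? _ ->.
- by move=> ? ? ? _ ->.
- by move=> ? ? ? ? _ -> _ ->.
- by move=> ? ? _ ->.
- by move=> *; rewrite addrA.
- by move=> *; rewrite addrC.
- by move=> *; rewrite add0r.
- by move=> *; rewrite addNr.
- by move=> *; rewrite scalerA.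
- by move=> *; rewrite scale1r.
- by move=> *; rewrite scalerDr.
- by move=> *; rewrite scalerDl.
- by move=> *; rewrite nmulA.
- by move=> *; rewrite nmulDl.
- by move=> *; rewrite nmulDr.
- by move=> *; rewrite nscalerAl.
- by move=> *; rewrite nscalerAr.
- by move=> *; rewrite starK.
- by move=> *; rewrite starD.
- by move=> *; rewrite starZ.
- by move=> *; rewrite starM.
Qed.

Lemma pres_universal :
  exists2 phi : pres -> B, star_morphism phi /\ (forall x, phi (pgen x) = f x)
    & forall psi : pres -> B, star_morphism psi ->
        (forall x, psi (pgen x) = f x) -> psi = phi.
Proof.
pose phi (x : pres) := teval (repr x).
have phiE t : phi (pclass t) = teval t by exact/teval_cong/cong_repr.
exists phi.
  split; last by move=> x; rewrite phiE.
  split.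
  - by do 2 elim/pclass_ind => ?; rewrite [_ + _]paddE !phiE.
  - by move=> a; elim/pclass_ind => ?; rewrite [a *: _]pscaleE !phiE.
  - by do 2 elim/pclass_ind => ?; rewrite [_ ** _]pmulE !phiE.
  - by elim/pclass_ind => ?; rewrite [star _]pstarE !phiE.
move=> psi [psiD psiZ psiM psiS] psif; apply/funext; elim/pclass_ind => t.
rewrite phiE; elim: t => //=.
- have := psiD 0 0; rewrite addr0 => e.
  by apply: (addIr (psi 0)); rewrite add0r -e.
- by move=> t IHt u IHu; rewrite -paddE psiD IHt IHu.
- move=> t IHt.
  have -> : pclass (TOpp t) = -1 *: pclass t by rewrite scaleN1r -poppE.
  by rewrite psiZ IHt scaleN1r.
- by move=> a t IHt; rewrite -pscaleE psiZ IHt.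
- by move=> t IHt u IHu; rewrite -pmulE psiM IHt IHu.
- by move=> t IHt; rewrite -pstarE psiS IHt.
Qed.

End Lift.

End Presentation.

Record starIdeal (K : fieldType) (conj : K -> K) (A : starAlgType conj) :=
  StarIdeal {
    star_ideal_set :> A -> Prop;
    star_idealP : two_sided_ideal star_ideal_set;
    star_ideal_star : star_closed star_ideal_set
  }.

Section Quotient.
Variables (K : fieldType) (conj : K -> K) (A : starAlgType conj).
Variable I : starIdeal A.
Implicit Types x y z t : A.

Let I0 : I 0. Proof. by case: (star_idealP I) => [[[]]]. Qed.
Let ID x y : I x -> I y -> I (x + y).
Proof. by case: (star_idealP I) => [[[_ + _] _] _]; apply. Qed.
Let IZ (a : K) x : I x -> I (a *: x).
Proof. by case: (star_idealP I) => [[[_ _ +] _] _]; apply. Qed.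
Let IMl x y : I y -> I (x ** y).
Proof. by case: (star_idealP I) => [[_ +] _]; apply. Qed.
Let IMr x y : I x -> I (x ** y).
Proof. by case: (star_idealP I) => [_ +]; apply. Qed.
Let IN x : I x -> I (- x).
Proof. by rewrite -scaleN1r; exact: IZ. Qed.

Definition eqmodI x y := `[< I (x - y) >].

Lemma eqmodI_refl : reflexive eqmodI.
Proof. by move=> x; apply/asboolP; rewrite subrr. Qed.

Lemma eqmodI_sym : symmetric eqmodI.
Proof. by move=> x y; apply/asboolP/asboolP => /IN; rewrite opprB. Qed.

Lemma eqmodI_trans : transitive eqmodI.
Proof.
move=> y x z /asboolP xy /asboolP yz; apply/asboolP.
by have := ID xy yz; rewrite addrA subrK.
Qed.

Canonical eqmodI_equiv :=
  EquivRel eqmodI eqmodI_refl eqmodI_sym eqmodI_trans.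

Definition quo := {eq_quot eqmodI_equiv}.

HB.instance Definition _ := Choice.on quo.

Definition to_quo x : quo := \pi_quo x.

Lemma to_quoP x y : to_quo x = to_quo y <-> I (x - y).
Proof.
split; first by move=> /eqmodP/asboolP.
by move=> xy; apply/eqmodP/asboolP.
Qed.

Lemma to_quo_ind (P : quo -> Prop) :
  (forall x, P (to_quo x)) -> forall c, P c.
Proof. by move=> Px; elim/quotW => x; exact: Px. Qed.

Lemma eqmodI_repr x : I (repr (to_quo x) - x).
Proof. by apply/to_quoP; rewrite /to_quo reprK. Qed.

Definition qadd (x y : quo) : quo := to_quo (repr x + repr y).
Definition qopp (x : quo) : quo := to_quo (- repr x).
Definition qscale (a : K) (x : quo) : quo := to_quo (a *: repr x).
Definition qmul (x y : quo) : quo := to_quo (repr x ** repr y).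
Definition qstar (x : quo) : quo := to_quo (star (repr x)).

Lemma qaddE x y : qadd (to_quo x) (to_quo y) = to_quo (x + y).
Proof.
apply/to_quoP; rewrite opprD addrACA; apply: ID; exact: eqmodI_repr.
Qed.
Lemma qoppE x : qopp (to_quo x) = to_quo (- x).
Proof. by apply/to_quoP; rewrite -opprD; apply: IN; exact: eqmodI_repr. Qed.
Lemma qscaleE a x : qscale a (to_quo x) = to_quo (a *: x).
Proof. by apply/to_quoP; rewrite -scalerBr; apply: IZ; exact: eqmodI_repr. Qed.
Lemma qmulE x y : qmul (to_quo x) (to_quo y) = to_quo (x ** y).
Proof.
apply/to_quoP; set x' := repr _; set y' := repr _.
have -> : x' ** y' - x ** y = (x' - x) ** y' + x ** (y' - y).
  by rewrite nmulDl nmulDr nmulNl nmulNr addrA subrK.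
by apply: ID; [apply: IMr|apply: IMl]; exact: eqmodI_repr.
Qed.
Lemma qstarE x : qstar (to_quo x) = to_quo (star x).
Proof.
by apply/to_quoP; rewrite -starB; apply: star_ideal_star; exact: eqmodI_repr.
Qed.

Let qE := (qaddE, qoppE, qscaleE, qmulE, qstarE).

Lemma qaddA : associative qadd.
Proof. by do 3 elim/to_quo_ind => ?; rewrite !qE addrA. Qed.
Lemma qaddC : commutative qadd.
Proof. by do 2 elim/to_quo_ind => ?; rewrite !qE addrC. Qed.
Lemma qadd0 : left_id (to_quo 0) qadd.
Proof. by elim/to_quo_ind => ?; rewrite !qE add0r. Qed.
Lemma qaddN : left_inverse (to_quo 0) qopp qadd.
Proof. by elim/to_quo_ind => ?; rewrite !qE addNr. Qed.

HB.instance Definition _ := GRing.isZmodule.Build quo qaddA qaddC qadd0 qaddN.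

Lemma qscaleA a b (x : quo) : qscale a (qscale b x) = qscale (a * b) x.
Proof. by elim/to_quo_ind: x => ?; rewrite !qE scalerA. Qed.
Lemma qscale1 : left_id 1 qscale.
Proof. by elim/to_quo_ind => ?; rewrite !qE scale1r. Qed.
Lemma qscaleDr : right_distributive qscale +%R.
Proof.
by move=> a; do 2 elim/to_quo_ind => ?;
  rewrite -![_ + _]/(qadd _ _) !qE scalerDr.
Qed.
Lemma qscaleDl (x : quo) : {morph qscale^~ x : a b / a + b}.
Proof.
elim/to_quo_ind: x => ? a b /=.
by rewrite -![_ + _ in RHS]/(qadd _ _) !qE scalerDl.
Qed.

HB.instance Definition _ :=
  GRing.Zmodule_isLmodule.Build K quo qscaleA qscale1 qscaleDr qscaleDl.

Lemma qmulA : associative qmul.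
Proof. by do 3 elim/to_quo_ind => ?; rewrite !qE nmulA. Qed.
Lemma qmulDl : left_distributive qmul +%R.
Proof.
by do 3 elim/to_quo_ind => ?; rewrite -![_ + _]/(qadd _ _) !qE nmulDl.
Qed.
Lemma qmulDr : right_distributive qmul +%R.
Proof.
by do 3 elim/to_quo_ind => ?; rewrite -![_ + _]/(qadd _ _) !qE nmulDr.
Qed.
Lemma qscaleAl (a : K) (x y : quo) : a *: qmul x y = qmul (a *: x) y.
Proof.
elim/to_quo_ind: x => ?; elim/to_quo_ind: y => ?.
by rewrite -![_ *: _]/(qscale _ _) !qE nscalerAl.
Qed.
Lemma qscaleAr (a : K) (x y : quo) : a *: qmul x y = qmul x (a *: y).
Proof.
elim/to_quo_ind: x => ?; elim/to_quo_ind: y => ?.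
by rewrite -![_ *: _]/(qscale _ _) !qE nscalerAr.
Qed.
Lemma qstarK : involutive qstar.
Proof. by elim/to_quo_ind => ?; rewrite !qE starK. Qed.
Lemma qstarD : {morph qstar : x y / x + y}.
Proof.
by do 2 elim/to_quo_ind => ?; rewrite -![_ + _]/(qadd _ _) !qE starD.
Qed.
Lemma qstarZ (a : K) (x : quo) : qstar (a *: x) = conj a *: qstar x.
Proof.
by elim/to_quo_ind: x => ?; rewrite -![_ *: _]/(qscale _ _) !qE starZ.
Qed.
Lemma qstarM (x y : quo) : qstar (qmul x y) = qmul (qstar y) (qstar x).
Proof.
by elim/to_quo_ind: x => ?; elim/to_quo_ind: y => ?; rewrite !qE starM.
Qed.

HB.instance Definition _ := isStarAlgebra.Build K conj quo
  qmulA qmulDl qmulDr qscaleAl qscaleAr qstarK qstarD qstarZ qstarM.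

End Quotient.

(* [sep v] is the partition C_v of s^-1(v); by [partition] its members are
   nonempty and pairwise disjoint, with union s^-1(v). *)
Record sepGraph := SepGraph {
  vert : choiceType;
  edge : choiceType;
  src : edge -> vert;
  rng : edge -> vert;
  sep : vert -> set (set edge);
  sepP : forall v, partition (sep v) id (src @^-1` [set v])
}.

Section Paths.
Variable G : sepGraph.
Notation V := (vert G).
Notation E := (edge G).

Definition sepU : set (set E) := \bigcup_v sep v.

(* [inl e] is the edge e, [inr e] its formal inverse. *)
Definition letter := (E + E)%type.

Definition linv (x : letter) : letter :=
  match x with inl e => inr e | inr e => inl e end.

Definition lsrc (x : letter) : V :=
  match x with inl e => src e | inr e => rng e end.

Definition lrng (x : letter) : V := lsrc (linv x).

(* A path is encoded by its source together with its word; the vertex v is the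
   path (v, [::]). *)
Definition gpath := (V * seq letter)%type.

Implicit Types (p q g : gpath) (w : seq letter) (A T : set gpath) (v : V).

Definition is_path p :=
  if p.2 is x :: w then
    (lsrc x == p.1) && path (fun x y => lrng x == lsrc y) x w
  else true.

Definition prng p : V := last p.1 [seq lrng x | x <- p.2].

Definition pinv p : gpath := (prng p, rev [seq linv x | x <- p.2]).

Definition pcat p q : gpath := (p.1, p.2 ++ q.2).

Definition reduced w := forall x, ~~ infix [:: x; linv x] w.

Definition reduce w : seq letter :=
  foldr (fun x w' => if w' is y :: w'' then
                       if y == linv x then w'' else x :: w'
                     else [:: x]) [::] w.

Definition pdot p q : gpath := (p.1, reduce (p.2 ++ q.2)).

Definition pprefix p q := (p.1 == q.1) && prefix p.2 q.2.

Definition down A : set gpath := [set p | exists2 q, A q & pprefix p q].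

Definition lower A := down A `<=` A.

Definition maxp A : set gpath :=
  [set p | A p /\ forall q, A q -> pprefix p q -> q = p].

(* the C-separated paths *)
Definition FC : set gpath :=
  [set p | [/\ is_path p, reduced p.2
    & forall Z x y, sepU Z -> Z x -> Z y ->
        ~~ infix [:: inr x; inl y] p.2]].

Definition FCat v : set gpath := [set p | FC p /\ p.1 = v].

Definition compatible A :=
  forall p q, A p -> A q -> FC (pdot (pinv q) p).

Definition ends_inverse p := exists w (e : E), p.2 = rcons w (inr e).

Definition X0at v : set (set gpath) :=
  [set T | [/\ T !=set0 /\ finite_set T, T `<=` FCat v, lower T,
               compatible T & forall p, maxp T p -> ~ ends_inverse p]].

Definition X0 : set (set gpath) := \bigcup_v X0at v.

(* the local neighbors N(v) *)
Definition Nv v : set gpath :=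
  [set p | FCat v p /\
    exists (xs : seq E) (y : E), p.2 = rcons [seq inr x | x <- xs] (inl y)].

(* p = g g' with g in T, g' in N(r(g)) and g [g']_1 not in T *)
Definition nsplit T g g' p :=
  [/\ T g, Nv (prng g) g', ~ T (g.1, g.2 ++ take 1 g'.2) & p = pcat g g'].

Definition NT T : set gpath :=
  [set p | [/\ exists g g', nsplit T g g' p, FC p
             & X0 (T `|` down [set p])]].

(* the part lambda_0 of the unique decomposition of lambda in N(T) *)
Definition part0 T p : gpath :=
  xget p [set g | exists g', nsplit T g g' p].

Definition Xcb : set (set gpath) :=
  [set T | [/\ X0 T, finite_set (NT T) & NT T !=set0]].

End Paths.

Section Cohn.
Variables (K : fieldType) (conj : K -> K) (G : sepGraph).
Notation V := (vert G).
Notation E := (edge G).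

Notation tm := (term K (V + E)%type).
Notation tv v := (TGen K (inl v : (V + E)%type)).
Notation te e := (TGen K (inr e : (V + E)%type)).

Inductive cohn_rel : tm -> tm -> Prop :=
  | cr_vstar (v : V) : cohn_rel (TStar (tv v)) (tv v)
  | cr_vv (v w : V) :
      cohn_rel (TMul (tv v) (tv w)) (if v == w then tv v else TZero)
  | cr_se (e : E) : cohn_rel (TMul (tv (src e)) (te e)) (te e)
  | cr_er (e : E) : cohn_rel (TMul (te e) (tv (rng e))) (te e)
  | cr_es (e : E) :
      cohn_rel (TMul (TStar (te e)) (tv (src e))) (TStar (te e))
  | cr_re (e : E) :
      cohn_rel (TMul (tv (rng e)) (TStar (te e))) (TStar (te e))
  | cr_ef (Z : set E) (e f : E) of sepU Z & Z e & Z f :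
      cohn_rel (TMul (TStar (te e)) (te f))
               (if e == f then tv (rng e) else TZero).

Definition cohn : starAlgType conj := pres conj cohn_rel.

Definition cohn_vert (v : V) : cohn := pgen conj cohn_rel (inl v).
Definition cohn_edge (e : E) : cohn := pgen conj cohn_rel (inr e).

Definition cohn_semigroup : set cohn :=
  star_semigroup_gen (range cohn_vert `|` range cohn_edge).

Definition cohn_commutators : set cohn :=
  [set z | exists x y, [/\ cohn_semigroup x, cohn_semigroup y
                         & z = commutator (x ** star x) (y ** star y)]].

Lemma cohn_commutators_star (z : cohn) :
  cohn_commutators z -> ideal_gen cohn_commutators (star z).
Proof.
move=> [x [y [Sx Sy ->]]]; apply: sub_ideal_gen; exists y, x.
by rewrite star_commutator !starM !starK.
Qed.

Definition commutator_ideal : starIdeal cohn :=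
  StarIdeal (ideal_gen_ideal cohn_commutators)
            (star_closed_ideal_gen cohn_commutators_star).

Definition cohn_ab : starAlgType conj := quo commutator_ideal.

Definition ab_vert (v : V) : cohn_ab := to_quo commutator_ideal (cohn_vert v).
Definition ab_edge (e : E) : cohn_ab := to_quo commutator_ideal (cohn_edge e).

Definition qX (v : V) (Z : set E) : cohn_ab :=
  ab_vert v - \sum_(e <- fset_set Z) (ab_edge e ** star (ab_edge e)).

Definition idealQ : set cohn_ab :=
  ideal_gen [set q | exists v Z, [/\ sep v Z, finite_set Z & q = qX v Z]].

Definition letter_elt (x : letter G) : cohn_ab :=
  match x with inl e => ab_edge e | inr e => star (ab_edge e) end.

Definition path_elt (p : gpath G) : cohn_ab :=
  if p.2 is [::] then ab_vert p.1 else nprod [seq letter_elt x | x <- p.2].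

Definition path_proj (p : gpath G) : cohn_ab := path_elt p ** star (path_elt p).

(* The elements [path_proj p] commute pairwise, so the order of the factors
   does not matter in the following two products. *)
Definition eT (T : set (gpath G)) : cohn_ab :=
  nprod [seq path_proj p | p <- fset_set (maxp T)].

Definition eTF (T F : set (gpath G)) : cohn_ab :=
  nprod (eT T :: [seq path_proj (part0 T p) - path_proj p | p <- fset_set F]).

(* [NT T] is the maximum blocking family for T when T is in [Xcb G]. *)
Definition ecb (T : set (gpath G)) : cohn_ab := eTF T (NT T).

End Cohn.

Arguments cohn {K} conj G.
Arguments cohn_ab {K} conj G.
Arguments idealQ {K} conj G _.
Arguments path_elt {K} conj {G} p.
Arguments path_proj {K} conj {G} p.
Arguments eT {K} conj {G} T.
Arguments eTF {K} conj {G} T F.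
Arguments ecb {K} conj {G} T.
Arguments soc {K conj} A _.

(* Main.v *)
Require Import Defs.
From mathcomp Require Import all_boot all_algebra.
From mathcomp Require Import finmap all_classical.

(* Write E(w) = w w^*.  These projections commute, e(T) is the product of the
   E(w) for w in T, and every projection met below is of the form
   p = e(T) (1 - E(u_1)) ... (1 - E(u_n)), where no u_i belongs to the closure
   of T under appending inverse letters.  Such a p is nonzero, as it fixes a
   basis vector of a representation on the closure of T.

   Splitting p along finitely many paths brings any a != 0 to the form
   a p = sum_g c_g g p with g reduced and p <= g^* g; multiplying by some g_0^*
   leaves c p plus terms k p with k a nontrivial loop.  As T is finite and free
   groups are torsion free, a nontrivial loop moves the closure of T, so p can
   be shrunk further to get p k p = 0.  Hence every nonzero ideal contains a
   projection p as above.

   If a generates a minimal left ideal then so does this p, hence p is not split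
   by any neighbour of T: N(T) is finite and p = e(T \ N(T)).  So the socle is
   generated by the e(T \ N(T)) with N(T) finite.  Those with N(T) nonempty are
   in Q; those with N(T) empty are annihilated by Q, since every X in C at a
   vertex of the closure of T is realised there, and so they generate an ideal
   meeting Q in 0. *)

Set Implicit Arguments.
Unset Strict Implicit.
Unset Printing Implicit Defensive.

Import GRing.Theory.
Local Open Scope classical_set_scope.

(** The algebra is known only by generators and relations, and no linear basis of it is used.
    Identities and vanishing come from a calculus of partial isometries with commuting range and
    source projections; nonvanishing comes from one representation for each tree. The closure under
    inverse letters appears because e^* e = r(e) gives E(w e^{-1}) = E(w), so that E(w) forgets
    trailing inverse letters. The closure is usually infinite, and a stabiliser cannot be excluded
    by counting its points. Only the number of edges in each word is bounded; a word whose inverse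
    also lies in the closure therefore has bounded length. C-compatibility is replaced by the
    absence of conflicts, that is, of branchings through distinct edges of one X in C. A conflict
    makes the two range projections orthogonal. Without a unit, 1 - E(u) occurs only as a factor
    after e(T), and finite sums of vertices serve as local units. *)

(** Reducedness and C-separation both forbid certain subwords of length two, so each becomes
    sortedness for a binary relation. *)
Lemma infix2_sorted (T : eqType) (R : rel T) (w : seq T) :
  (forall x y, infix [:: x; y] w -> R x y) <-> sorted R w.
Proof.
split; elim: w => // x [|y w] IH.
- by [].
- move=> H; have xy : R x y by apply/H/prefixW; rewrite /= !eqxx prefix0s.
  rewrite /= xy; apply: IH => a b ab; apply: H; rewrite infix_consl ab.
  exact: orbT.
- by move=> _ a b; rewrite infix_consl /= andbF.
- move=> /andP[xy yw] a b; rewrite infix_consl => /orP[].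
    by rewrite !prefix_cons prefix0s andbT => /andP[/eqP-> /eqP->].
  exact: IH.
Qed.

(** * Reduced words *)

Section Words.
Variable G : sepGraph.
Notation V := (vert G).
Notation E := (edge G).
Notation L := (letter G).
Implicit Types (x y z : L) (w u p q : seq L) (v : V) (s : V + L).

Lemma linvK : involutive (@linv G). Proof. by case. Qed.

Lemma linv_neq x : linv x != x. Proof. by case: x. Qed.

Lemma lsrc_linv x : lsrc (linv x) = lrng x. Proof. by []. Qed.

Lemma lrng_linv x : lrng (linv x) = lsrc x. Proof. by case: x. Qed.

Definition winv w := rev (map (@linv G) w).

Lemma winv_cons x w : winv (x :: w) = rcons (winv w) (linv x).
Proof. by rewrite /winv /= rev_cons. Qed.

Lemma winv_cat u w : winv (u ++ w) = winv w ++ winv u.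
Proof. by rewrite /winv map_cat rev_cat. Qed.

Lemma winv_rcons w x : winv (rcons w x) = linv x :: winv w.
Proof. by rewrite -cats1 winv_cat. Qed.

Lemma winvK : involutive winv.
Proof.
by move=> w; rewrite /winv map_rev revK -map_comp map_id_in // => x _ /=; rewrite linvK.
Qed.

Lemma size_winv w : size (winv w) = size w.
Proof. by rewrite size_rev size_map. Qed.

Lemma winv_eq0 w : (winv w == [::]) = (w == [::]).
Proof. by rewrite -!size_eq0 size_winv. Qed.

Definition rcancel x w :=
  if w is y :: w' then if y == linv x then w' else x :: w else [:: x].

Lemma reduce_cons x w : reduce (x :: w) = rcancel x (reduce w). Proof. by []. Qed.

Definition nbt : rel L := fun x y => y != linv x.

Lemma nbt_linv x y : nbt (linv y) (linv x) = nbt x y.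
Proof. by rewrite /nbt linvK eq_sym. Qed.

Lemma sorted_nbt_winv w : sorted nbt (winv w) = sorted nbt w.
Proof.
rewrite /winv rev_sorted sorted_map; apply: eq_sorted => x y /=.
by rewrite nbt_linv.
Qed.

Lemma reducedE w : reduced w <-> sorted nbt w.
Proof.
rewrite -infix2_sorted; split=> [H x y xy|H x].
  by apply/negP => /eqP yx; move: (H x); rewrite -yx xy.
by apply/negP => /H; rewrite /nbt eqxx.
Qed.

Lemma sorted_rcancel x w : sorted nbt w -> sorted nbt (rcancel x w).
Proof.
case: w => // y w; rewrite /rcancel; case: eqVneq => [_|yx]; first exact: path_sorted.
by rewrite /= /nbt yx.
Qed.

Lemma sorted_reduce w : sorted nbt (reduce w).
Proof. by elim: w => // x w IH; rewrite reduce_cons; exact: sorted_rcancel. Qed.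

(** Letters act on reduced words as in a free group: x and its inverse act by mutually inverse
    bijections. *)
Lemma rcancelK x w : sorted nbt w -> rcancel x (rcancel (linv x) w) = w.
Proof.
case: w => [|y w]; first by rewrite /= eqxx.
rewrite {2}/rcancel linvK; case: eqVneq => [->|yx].
  by case: w => //= z w /andP[zx _]; rewrite (negPf zx).
by rewrite /= eqxx.
Qed.

Lemma reduce_id w : sorted nbt w -> reduce w = w.
Proof.
elim: w => // x w IH sw; rewrite reduce_cons IH ?(path_sorted sw) //.
by case: w sw {IH} => //= y w /andP[/negPf-> _].
Qed.

Lemma reduce_catr u w : reduce (u ++ reduce w) = reduce (u ++ w).
Proof.
elim: u => [|x u IH]; first by rewrite reduce_id // sorted_reduce.
by rewrite !cat_cons !reduce_cons IH.
Qed.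

Lemma reduce_rcancel x w u :
  sorted nbt w -> reduce (rcancel x w ++ u) = reduce (x :: w ++ u).
Proof.
case: w => // y w sw; rewrite {1}/rcancel; case: eqVneq => [yx|_] //.
by rewrite yx cat_cons !reduce_cons rcancelK ?sorted_reduce.
Qed.

Lemma reduce_catl u w : reduce (reduce u ++ w) = reduce (u ++ w).
Proof.
elim: u => // x u IH; rewrite reduce_cons reduce_rcancel ?sorted_reduce //.
by rewrite !reduce_cons IH.
Qed.

Lemma reduce_cancel u w : reduce (winv u ++ u ++ w) = reduce w.
Proof.
elim: u w => // x u IH w; rewrite winv_cons cat_rcons /=.
have := rcancelK (linv x) (sorted_reduce (u ++ w)); rewrite linvK => H.
by rewrite -reduce_catr !reduce_cons H reduce_catr.
Qed.

Lemma reduce_cancel' u w : reduce (u ++ winv u ++ w) = reduce w.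
Proof. by rewrite -{1}(winvK u) reduce_cancel. Qed.

(** * C-separated words and their inverses *)

Definition csep x y :=
  nbt x y && ~~ `[< exists Z e f, [/\ sepU Z, Z e, Z f, x = inr e & y = inl f] >].

Definition cstep x y := (lrng x == lsrc y) && csep x y.

Lemma csep_linv x y : csep (linv y) (linv x) = csep x y.
Proof.
rewrite /csep nbt_linv; congr (_ && ~~ _); apply/asbool_equiv_eq; split.
  by move=> [Z [e [f [ZC Ze Zf]]]]; case: y => // a [->]; case: x => // b [->]; exists Z, f, e.
by move=> [Z [e [f [ZC Ze Zf -> ->]]]]; exists Z, f, e.
Qed.

Lemma cstep_linv x y : cstep (linv y) (linv x) = cstep x y.
Proof. by rewrite /cstep csep_linv lrng_linv lsrc_linv eq_sym. Qed.

Lemma cstep_nbt x y : cstep x y -> nbt x y.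
Proof. by case/and3P. Qed.

(** Forbidden pairs end in an edge, so only backtracking can prevent an inverse letter from being
    appended. *)
Lemma cstep_inr x (e : E) : nbt x (inr e) -> lrng x = rng e -> cstep x (inr e).
Proof.
move=> xe re; rewrite /cstep /csep xe re eqxx /=; apply/negP => /asboolP.
by case=> Z [? [? []]].
Qed.

(* A word is read from a state: the vertex it starts at, or the last letter
   before it. *)
Definition follows s y := match s with inl v => lsrc y == v | inr x => cstep x y end.

Definition stvert s := match s with inl v => v | inr x => lrng x end.

Definition endst s w : V + L := foldl (fun _ y => inr y) s w.

Fixpoint cpath s w := if w is y :: w' then follows s y && cpath (inr y) w' else true.

Lemma cpath_cat s u w : cpath s (u ++ w) = cpath s u && cpath (endst s u) w.
Proof. by elim: u s => //= x u IH s; rewrite IH andbA. Qed.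

Lemma endst_rcons s u x : endst s (rcons u x) = inr x.
Proof. by rewrite /endst foldl_rcons. Qed.

Lemma cpath_rcons s w x : cpath s (rcons w x) = cpath s w && follows (endst s w) x.
Proof. by rewrite -cats1 cpath_cat /= andbT. Qed.

Lemma follows_weak s y : follows s y -> follows (inl (stvert s)) y.
Proof. by case: s => //= x /andP[/eqP->]. Qed.

Lemma cpath_weak s w : cpath s w -> cpath (inl (stvert s)) w.
Proof. by case: w => //= y w /andP[/follows_weak/= -> ->]. Qed.

Lemma follows_src s y : follows s y -> lsrc y = stvert s.
Proof. by move/follows_weak/eqP. Qed.

Lemma prngE v w : prng (v, w) = stvert (endst (inl v) w).
Proof.
rewrite /prng /=; case/lastP: w => // w x.
by rewrite map_rcons last_rcons endst_rcons.
Qed.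

Lemma endst_winv s y w : endst s (winv (y :: w)) = inr (linv y).
Proof. by rewrite winv_cons endst_rcons. Qed.

Lemma cpath_winv s w : cpath s w -> cpath (inl (stvert (endst s w))) (winv w).
Proof.
elim: w s => // y w IH s /= /andP[sy oyw].
rewrite winv_cons cpath_rcons (IH _ oyw) /=.
case: w oyw {IH} => [|z w] /=; first by rewrite lsrc_linv eqxx.
by case/andP => yz _; rewrite endst_winv /= cstep_linv.
Qed.

Lemma cpath_nbt s w : cpath s w -> sorted nbt w.
Proof.
case: w => //= y w /andP[_]; elim: w y => //= z w IH y /andP[/cstep_nbt-> /IH ->] //.
Qed.

Lemma FCE v w : FC (v, w) <-> cpath (inl v) w.
Proof.
have cpathE s : cpath s w =
   (if w is x :: w' then follows s x && path (fun x y => lrng x == lsrc y) x w' else true)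
   && sorted csep w.
  case: w => //= x w'; rewrite -andbA; congr (_ && _).
  elim: w' x => //= y w' IH x; rewrite IH /cstep -!andbA; congr (_ && _).
  by case: (path _ y w'); rewrite /= ?andbF.
rewrite cpathE /FC /is_path /=; split.
  case=> H1 /reducedE H2 H3; apply/andP; split.
    by case: (w) H1.
  apply/infix2_sorted => x y xy; apply/andP; split.
    by move/infix2_sorted: H2; apply.
  apply/negP => /asboolP[Z [e [f [ZC Ze Zf ex fy]]]].
  by move: (H3 _ _ _ ZC Ze Zf); rewrite -ex -fy xy.
move=> /andP[H1 /infix2_sorted H2]; split.
- by case: (w) H1.
- by apply/reducedE/infix2_sorted => x y /H2/andP[].
- move=> Z e f ZC Ze Zf; apply/negP => /H2/andP[_ /asboolP]; apply.
  by exists Z, e, f.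
Qed.

(* Since e^* e = r(e), dropping trailing inverse letters does not change the
   range projection of a path. *)
Fixpoint strip w :=
  if w is x :: w' then
    if strip w' is [::] then if x is inl _ then [:: x] else [::] else x :: strip w'
  else [::].

Lemma strip_rconsr w (e : E) : strip (rcons w (inr e)) = strip w.
Proof. by elim: w => //= x w ->. Qed.

Lemma strip_rconsl w (e : E) : strip (rcons w (inl e)) = rcons w (inl e).
Proof. by elim: w => //= x w ->; case: w. Qed.

Lemma strip_split w : exists2 xs : seq E, w = strip w ++ [seq inr e | e <- xs]
  & strip w = [::] \/ exists u (e : E), strip w = rcons u (inl e).
Proof.
elim/last_ind: w => [|w x [xs wE H]]; first by exists [::] => //; left.
case: x => e.
  rewrite strip_rconsl; exists [::]; first by rewrite cats0.
  by right; exists w, e.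
rewrite strip_rconsr; exists (rcons xs e) => //.
by rewrite map_rcons -rcons_cat -wE.
Qed.

Lemma strip_cat_inr w (xs : seq E) : strip (w ++ [seq inr e | e <- xs]) = strip w.
Proof.
elim/last_ind: xs => [|xs e IH]; first by rewrite cats0.
by rewrite map_rcons -rcons_cat strip_rconsr.
Qed.

Lemma prefix_strip w : prefix (strip w) w.
Proof. by have [xs E _] := strip_split w; rewrite {2}E prefix_prefix. Qed.

Lemma stripK w : strip (strip w) = strip w.
Proof. by have [xs E _] := strip_split w; rewrite {2}E strip_cat_inr. Qed.

Lemma strip_mono u w : prefix u w -> prefix (strip u) (strip w).
Proof.
elim/last_ind: w => [|w x IH]; first by rewrite prefixs0 => /eqP->.
case/prefixP=> t; case/lastP: t => [|t y].
  by rewrite cats0 => ->; exact: prefix_refl.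
rewrite -rcons_cat => /rcons_inj[wE _].
have uw : prefix u w by rewrite wE prefix_prefix.
case: x => e; last by rewrite strip_rconsr IH.
rewrite strip_rconsl (prefix_trans (prefix_strip _)) //.
by rewrite (prefix_trans uw) ?prefix_rcons.
Qed.

(** The two words leave a common prefix by distinct edges of one member of C. This is the only
    obstruction to C-compatibility. *)
Definition conflict p q := exists u (Z : set E) (e f : E),
  [/\ sepU Z, Z e, Z f & e <> f] /\ prefix (rcons u (inl e)) p /\ prefix (rcons u (inl f)) q.

Lemma conflict_sym p q : conflict p q -> conflict q p.
Proof.
by move=> [u [Z [e [f [[ZC Ze Zf ef] [pp qq]]]]]]; exists u, Z, f, e; split=> //; split=> // /esym.
Qed.

Lemma conflict_prefix p q p' q' : prefix p p' -> prefix q q' -> conflict p q -> conflict p' q'.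
Proof.
move=> pp' qq' [u [Z [e [f [? [ep fq]]]]]]; exists u, Z, e, f; split => //.
by split; [exact: prefix_trans pp'|exact: prefix_trans qq'].
Qed.

Lemma prefix_total p q r : prefix p r -> prefix q r -> prefix p q \/ prefix q p.
Proof.
elim: r p q => [|x r IH] [|y p] [|z q] //=; try by [left|right].
by move=> /andP[/eqP-> pr] /andP[/eqP-> qr]; rewrite eqxx /=; exact: IH.
Qed.

Lemma conflict_self p : ~ conflict p p.
Proof.
move=> [u [Z [e [f [[_ _ _ ef] [/prefixP[s pE] /prefixP[t pE']]]]]]].
move: pE'; rewrite pE !cat_rcons => /eqP; rewrite eqseq_cat // eqxx /= => /eqP[].
by move=> /ef.
Qed.

Lemma conflict_prefix_self p q r : prefix p r -> prefix q r -> ~ conflict p q.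
Proof. by move=> pr qr /(conflict_prefix pr qr)/conflict_self. Qed.

Lemma common_prefix p q : exists u p' q', [/\ p = u ++ p', q = u ++ q' &
  forall x y p'' q'', p' = x :: p'' -> q' = y :: q'' -> x <> y].
Proof.
elim: p q => [|x p IH] [|y q].
- by exists [::], [::], [::].
- by exists [::], [::], (y :: q).
- by exists [::], (x :: p), [::].
- have [->|xy] := eqVneq x y.
    have [u [p' [q' [-> -> H]]]] := IH q.
    by exists (y :: u), p', q'.
  exists [::], (x :: p), (y :: q); split => // ? ? ? ? [<- _] [<- _].
  exact/eqP.
Qed.

(** Once the longest common prefix is removed, the inverse of the rest of q followed by the rest of
    p is already reduced. Its only new pair of letters sits at the branching point, and it is
    forbidden exactly when the branching is a conflict. *)
Lemma compatE v p q : FC (v, p) -> FC (v, q) ->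
  FC (pdot (Defs.pinv (v, q)) (v, p)) <-> ~ conflict p q.
Proof.
move=> /FCE Fp /FCE Fq.
have [u [p' [q' [pE qE H]]]] := common_prefix p q.
have -> : pdot (Defs.pinv (v, q)) (v, p) = (prng (v, q), reduce (winv q ++ p)) by [].
have Fp' : cpath (endst (inl v) u) p' by move: Fp; rewrite pE cpath_cat => /andP[].
have Fq' : cpath (endst (inl v) u) q' by move: Fq; rewrite qE cpath_cat => /andP[].
set s := endst (inl v) u in Fp' Fq'.
have rE : reduce (winv q ++ p) = winv q' ++ p'.
  rewrite {1}pE {1}qE winv_cat -catA -reduce_catr reduce_cancel reduce_catr.
  apply: reduce_id.
  have := sorted_nbt_winv q'; rewrite (cpath_nbt Fq').
  case: q' {qE Fq'} H => [|y q''] H; first by rewrite (cpath_nbt Fp').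
  move=> sq'; case: p' {pE} H Fp' => [|x p''] H Fp'; first by rewrite cats0.
  have := cpath_nbt Fp'; rewrite winv_cons cat_rcons.
  rewrite winv_cons in sq'.
  case: (winv q'') sq' => [_|z t] /=.
    by move=> ->; rewrite /nbt linvK andbT; apply/eqP; exact: H.
  rewrite rcons_path cat_path => /andP[zt zy] px /=.
  by rewrite zt zy px /nbt linvK !andbT; apply/eqP; exact: H.
rewrite rE; split.
  move=> /FCE F [w [Z [e [f [[ZC Ze Zf ef] [/prefixP[p1 p1E] /prefixP[q1 q1E]]]]]]].
  have [uw|wu] : prefix u w \/ prefix w u.
    apply: (@prefix_total _ _ p); first by rewrite pE prefix_prefix.
    by rewrite p1E cat_rcons prefix_prefix.
  - move: uw => /prefixP[t wE].
    move: (pE); rewrite p1E wE cat_rcons -catA => /eqP; rewrite eqseq_cat // eqxx /= => /eqP p'E.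
    move: (qE); rewrite q1E wE cat_rcons -catA => /eqP; rewrite eqseq_cat // eqxx /= => /eqP q'E.
    case: t p'E q'E {wE} => [|z t] /= p'E q'E.
      move: F; rewrite -p'E -q'E winv_cons cat_rcons cpath_cat => /andP[_ /=].
      move=> /and3P[_ /and3P[_ _ /asboolP nex] _]; apply: nex.
      by exists Z, f, e.
    by have := H z z _ _ (esym p'E) (esym q'E).
  - move: wu => /prefixP[t uE].
    move: (pE); rewrite p1E uE cat_rcons -catA => /eqP; rewrite eqseq_cat // eqxx /= => /eqP p'E.
    move: (qE); rewrite q1E uE cat_rcons -catA => /eqP; rewrite eqseq_cat // eqxx /= => /eqP q'E.
    case: t p'E q'E {uE} => [|z t] /= p'E q'E.
      move: F; rewrite -p'E -q'E winv_cons cat_rcons cpath_cat => /andP[_ /=].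
      move=> /and3P[_ /and3P[_ _ /asboolP nex] _]; apply: nex.
      by exists Z, f, e.
    by case: p'E q'E => <- _ [] /esym /ef.
move=> nc; apply/FCE; rewrite prngE cpath_cat.
have := cpath_winv Fq; rewrite {2}qE winv_cat cpath_cat => /andP[-> _] /=.
case: q' {rE} H qE Fq' => [|y q''] H qE Fq'.
  by rewrite qE cats0; exact: cpath_weak.
case: p' H pE Fp' => [|x p''] // H pE Fp'.
rewrite endst_winv /=; move: Fp' Fq' => /= /andP[sx ->] /andP[sy _]; rewrite andbT.
rewrite /cstep lrng_linv (follows_src sx) (follows_src sy) eqxx /csep /nbt linvK /=.
apply/andP; split; first by apply/eqP; exact: H.
apply/negP => /asboolP[Z [e [f [ZC Ze Zf]]]]; case: y H qE sy => // e' H qE sy [ee'] xf.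
rewrite {}ee' {}xf in H pE qE *; apply: nc; exists u, Z, f, e; split.
  by split => //; move=> fe; have := H (inl f) (inl e) _ _ erefl erefl; rewrite fe.
by rewrite pE qE -!cat_rcons !prefix_prefix.
Qed.

End Words.

(** * Compatible trees and their neighbours *)

Section Trees.
Variable G : sepGraph.
Notation V := (vert G).
Notation E := (edge G).
Notation L := (letter G).
Implicit Types (x y z : L) (w u g h c : seq L) (v : V) (T : set (gpath G)).

Lemma sepU_eq (Z Z' : set E) (e : E) : sepU Z -> sepU Z' -> Z e -> Z' e -> Z = Z'.
Proof.
move=> [v _ vZ] [v' _ vZ'] Ze Z'e.
have [cov tr _] := sepP v; have [cov' tr' _] := sepP v'.
have ve : src e = v by have : (@src G @^-1` [set v]) e by rewrite -cov; exists Z.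
have ve' : src e = v' by have : (@src G @^-1` [set v']) e by rewrite -cov'; exists Z'.
move: vZ'; rewrite -ve' ve => vZ'.
by apply: tr => //; exists e.
Qed.

Lemma sepU_src (Z : set E) (e f : E) : sepU Z -> Z e -> Z f -> src e = src f.
Proof.
move=> [v _ vZ] Ze Zf; have [cov _ _] := sepP v.
have ve : src e = v by have : (@src G @^-1` [set v]) e by rewrite -cov; exists Z.
by have -> : src f = v by have : (@src G @^-1` [set v]) f by rewrite -cov; exists Z.
Qed.

Lemma sep_ex (e : E) : exists2 Z : set E, sep (src e) Z & Z e.
Proof.
have [cov _ _] := sepP (src e).
have : cover (sep (src e)) id e by rewrite cov.
by case=> Z sZ Ze; exists Z.
Qed.

(** Whether an edge may come next depends only on its block: backtracking included, it is excluded
    exactly after the inverse of an edge of the same block. *)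
Lemma follows_sep (Z : set E) (e f : E) (s : V + L) :
  sepU Z -> Z e -> Z f -> follows s (inl e) -> follows s (inl f).
Proof.
move=> ZC Ze Zf; case: s => [v|y] /=; first by rewrite (sepU_src ZC Ze Zf).
case/and3P => yr nb /asboolP ns; rewrite /cstep (eqP yr) /= -(sepU_src ZC Ze Zf) eqxx /=.
apply/andP; split.
  by apply/eqP => fy; apply: ns; exists Z, f, e; split => //; rewrite -[y]linvK -fy.
apply/negP => /asboolP[Z' [a [b [Z'C Z'a Z'b ya [fb]]]]]; apply: ns.
move: Z'b; rewrite -fb => Z'f; rewrite (sepU_eq Z'C ZC Z'f Zf) in Z'a.
by exists Z, a, e.
Qed.

(** Unfolded form of [X0at] with the base point explicit and compatibility expressed by
    conflicts. *)
Record tree v T : Prop := Tree {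
  tree_nil : T (v, [::]);
  tree_fin : finite_set T;
  tree_src : forall p, T p -> p.1 = v;
  tree_ok : forall w, T (v, w) -> cpath (inl v) w;
  tree_lower : forall u w, prefix u w -> T (v, w) -> T (v, u);
  tree_nc : forall p q, T (v, p) -> T (v, q) -> ~ conflict p q;
  tree_max : forall p, maxp T p -> ~ ends_inverse p
}.

Lemma X0_tree v T : X0at v T <-> tree v T.
Proof.
split.
  case=> [[[[v0 w0] T0] fT] FT lT cT mT].
  have v0E : v0 = v by have [] := FT _ T0.
  have okT w : T (v, w) -> FC (v, w) by move=> /FT[].
  split => //.
  - by apply: lT; exists (v0, w0) => //; rewrite /pprefix /= v0E eqxx prefix0s.
  - by move=> p /FT[].
  - by move=> w /okT/FCE.
  - by move=> u w uw Tw; apply: lT; exists (v, w) => //; rewrite /pprefix /= eqxx.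
  - by move=> p q Tp Tq; apply/(compatE (okT _ Tp) (okT _ Tq)); exact: cT.
case=> T0 fT sT oT lT nT mT.
have FT p : T p -> FC p by case: p => u w Tp; have /= e := sT _ Tp; subst u; exact/FCE/oT.
split => //.
- by split=> //; exists (v, [::]).
- by move=> p Tp; split; [exact: FT|exact: sT].
- move=> [u w] [[u' w'] Tq] /andP[/eqP /= -> pw].
  by have /= e := sT _ Tq; subst u'; exact: lT Tq.
- move=> [u w] [u' w'] Tp Tq; have /= e := sT _ Tp; subst u; have /= e := sT _ Tq; subst u'.
  by apply/(compatE (FT _ Tp) (FT _ Tq)); exact: nT.
Qed.

Lemma tree_X0 v T : tree v T -> X0 T.
Proof. by move=> /X0_tree; exists v. Qed.

Lemma tree1 v : tree v [set (v, [::])].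
Proof.
split => //.
- by move=> p ->.
- by move=> w [->].
- by move=> u w uw [wE]; move: uw; rewrite wE prefixs0 => /eqP->.
- by move=> p q [->] [->]; exact: conflict_self.
- by move=> p [-> _] [[|? ?] [e]].
Qed.

Lemma down1E v w p : Defs.down [set (v, w)] p <-> p.1 = v /\ prefix p.2 w.
Proof.
split; first by case=> _ -> /andP[/eqP].
by case=> pv pw; exists (v, w) => //; rewrite /pprefix /= pv eqxx.
Qed.

Lemma finite_down1 v w : finite_set (Defs.down [set (v, w)]).
Proof.
apply: (@sub_finite_set _ _ ((fun i => (v, take i w)) @` `I_(size w).+1)).
  move=> [u p] /down1E /= [-> pw]; exists (size p); first by rewrite ltnS size_prefix.
  by move: pw; rewrite prefixE => /eqP->.
exact/finite_image/finite_II.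
Qed.

(** The hypothesis [strip w = w] says that w is empty or ends in an edge, which keeps inverse
    letters away from the maximal ends. *)
Lemma tree_ext v T w : tree v T -> cpath (inl v) w -> strip w = w ->
  (forall t, T (v, t) -> ~ conflict t w) -> tree v (T `|` Defs.down [set (v, w)]).
Proof.
case=> T0 fT sT oT lT nT mT ow sw nw; split.
- by left.
- by rewrite finite_setU; split => //; exact: finite_down1.
- by move=> p [/sT//|/down1E[]].
- move=> u [/oT//|/down1E[_ /= /prefixP[r wE]]].
  by move: ow; rewrite wE cpath_cat => /andP[].
- move=> u r ur [/(lT _ _ ur)|/down1E[_ /= rw]]; first by left.
  by right; apply/down1E; split => //=; exact: prefix_trans rw.
- move=> p q [Tp|/down1E[_ /= pw]] [Tq|/down1E[_ /= qw]].
  + exact: nT.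
  + by move=> c; apply: (nw _ Tp); apply: conflict_prefix c; first exact: prefix_refl.
  + move=> /conflict_sym c; apply: (nw _ Tq).
    by apply: conflict_prefix c; first exact: prefix_refl.
  + exact: conflict_prefix_self pw qw.
- move=> p [[Tp|/down1E[p1 pw]] mp].
    by apply: mT; split => // q Tq; apply: mp; left.
  have pE : (v, w) = p.
    apply: mp; first by right; apply/down1E; rewrite prefix_refl.
    by rewrite /pprefix p1 eqxx.
  rewrite -pE => -[u [e /= wE]].
  move: sw; rewrite wE strip_rconsr => sw.
  by have := size_prefix (prefix_strip u); rewrite sw size_rcons ltnn.
Qed.

Lemma tree_first_exit v T t r : T (v, t) -> ~ T (v, t ++ r) ->
  exists t' y r', [/\ t ++ r = t' ++ y :: r', T (v, t') & ~ T (v, rcons t' y)].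
Proof.
elim: r t => [|y r IH] t Tt; first by rewrite cats0.
have [Ty|nTy] := pselect (T (v, rcons t y)).
  by rewrite -cat_rcons => /(IH _ Ty).
by exists t, y, r.
Qed.

Lemma first_positive r (f : E) : exists (xs : seq E) (y : E) r',
  rcons r (inl f) = rcons [seq inr e | e <- xs] (inl y) ++ r'.
Proof.
elim: r => [|[e|e] r [xs [y [r' IH]]]]; first by exists [::], f, [::].
  by exists [::], e, (rcons r (inl f)).
by exists (e :: xs), y, r'; rewrite /= -IH.
Qed.

(** From the point where w leaves T, read on through inverse letters up to the first edge, which
    exists as w ends in an edge. This prefix is a neighbour. *)
Lemma neighbor_prefix v T w : tree v T -> cpath (inl v) w -> strip w = w ->
  ~ T (v, w) -> (forall t, T (v, t) -> ~ conflict t w) ->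
  exists2 w', NT T (v, w') & prefix w' w.
Proof.
move=> tT ow sw nTw nw.
have [t [y [r [wE Tt nTy]]]] :=
  @tree_first_exit v T [::] w (tree_nil tT) nTw.
rewrite /= in wE.
have [r0 [f rE]] : exists r0 (f : E), y :: r = rcons r0 (inl f).
  have [xs _ [s0|[u [f]]]] := strip_split w.
    by move: sw; rewrite s0 wE; case: (t).
  rewrite sw wE; case/lastP: (r) => [|r' l].
    by rewrite cats1 => /rcons_inj[_ ->]; exists [::], f.
  by rewrite -rcons_cons -rcons_cat => /rcons_inj[_ ->]; exists (y :: r'), f.
have [xs [a [r' aE]]] := first_positive r0 f.
have wE' : w = (t ++ rcons [seq inr e | e <- xs] (inl a)) ++ r'.
  by rewrite wE rE aE catA.
set l := t ++ _ in wE'.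
have lw : prefix l w by rewrite wE' prefix_prefix.
have ol : cpath (inl v) l by move: ow; rewrite wE' cpath_cat => /andP[].
exists l => //; split.
- exists (v, t), (prng (v, t), rcons [seq inr e | e <- xs] (inl a)); split => //=.
    split; last by exists xs, a.
    split => //; apply/FCE; rewrite prngE; apply: cpath_weak.
    by move: ol; rewrite cpath_cat => /andP[].
  move: aE; rewrite -rE; case: (xs) => [|x xs'] /= [yE _]; rewrite ?take0 cats1 -yE //.
- exact/FCE.
- apply: (@tree_X0 v); apply: tree_ext => //.
    by rewrite /l -rcons_cat strip_rconsl.
  by move=> t' /nw nc /(conflict_prefix (prefix_refl _) lw).
Qed.

Lemma NT_tree v T p : tree v T -> NT T p ->
  exists t (xs : seq E) (y : E),
   [/\ p = (v, rcons (t ++ [seq inr e | e <- xs]) (inl y)), T (v, t),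
       cpath (inl v) p.2 & ~ T (v, p.2)] /\
   forall t', T (v, t') -> ~ conflict t' p.2.
Proof.
move=> tT [[[v' t] [[u w] [Tg [_ [xs [y /= wE]]] nT pE]]] FCp [v2 _ /X0_tree t2]].
have /= e := tree_src tT Tg; subst v'.
have e : v = v2 by have := tree_src t2 (or_introl (tree_nil tT)).
subst v2; exists t, xs, y.
have pE' : p = (v, rcons (t ++ [seq inr e | e <- xs]) (inl y)).
  by rewrite pE /pcat /= wE rcons_cat.
have op : cpath (inl v) p.2 by apply/FCE; move: FCp; rewrite pE'.
split; first split => //.
  move=> Tp; apply: nT; rewrite /= wE.
  apply: tree_lower tT _ _ _ Tp; rewrite pE' /= rcons_cat.
  by rewrite prefix_catr // eqxx prefix_take.
move=> t' Tt'; apply: (tree_nc t2); first by left.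
by right; rewrite pE'; apply/down1E; rewrite prefix_refl.
Qed.

(** Neighbours come in whole blocks wX. A conflict of wx with T would make wy conflict with T or
    belong to it; and a neighbour that is a proper prefix of wx would already lie in T, because
    [strip w] does. *)
Lemma NT_sibling v T w (y x : E) (Z : set E) : tree v T -> sepU Z -> Z y -> Z x ->
  NT T (v, rcons w (inl y)) -> NT T (v, rcons w (inl x)).
Proof.
move=> tT ZC Zy Zx /[dup] NTy /(NT_tree tT)[t [xs [y' [[[/rcons_inj[wE yE] Tt ow nTw] nw]]]]].
have {NTy} [<-//|/eqP xy] := eqVneq y x.
subst y'; rewrite /= in ow nTw nw.
have Tw : T (v, strip w).
  rewrite wE strip_cat_inr; exact: (tree_lower tT (prefix_strip t)).
have owx : cpath (inl v) (rcons w (inl x)).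
  by move: ow; rewrite !cpath_rcons => /andP[-> /(follows_sep ZC Zy Zx)].
have nwx t' : T (v, t') -> ~ conflict t' (rcons w (inl x)).
  move=> Tt' [u [Z' [a [b [[Z'C Z'a Z'b ab] [ua]]]]]].
  move=> /prefixP[r]; case/lastP: r => [|r z].
    rewrite cats0 => /rcons_inj[wu bE]; subst b u.
    have ZZ := sepU_eq ZC Z'C Zx Z'b; rewrite -ZZ in Z'a.
    have [ay|/eqP ay] := eqVneq a y.
      by apply: nTw; apply: tree_lower tT _ _ _ Tt'; rewrite -ay.
    apply: (nw _ Tt'); exists w, Z, a, y; split; first by split.
    by split => //; exact: prefix_refl.
  rewrite -rcons_cat => /rcons_inj[wu _]; apply: (nw _ Tt'); exists u, Z', a, b.
  split; first by split.
  by split => //; rewrite wu rcons_cat prefix_prefix.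
have nTwx : ~ T (v, rcons w (inl x)).
  move=> /nw; apply; exists w, Z, x, y; split; first by split => // /esym.
  by split; exact: prefix_refl.
have [w' NTw' /prefixP[r]] := neighbor_prefix tT owx (strip_rconsl _ _) nTwx nwx.
case/lastP: r => [|r z]; first by rewrite cats0 => ->.
rewrite -rcons_cat => /rcons_inj[wr _].
have [t1 [xs1 [y1 [[[w'E _ _]] nTw']]]] := NT_tree tT NTw'; case: nTw'.
have -> : w' = strip w' by rewrite w'E strip_rconsl.
by apply: tree_lower tT _ _ _ Tw; apply: strip_mono; rewrite wr prefix_prefix.
Qed.

Lemma part0_tree T p : NT T p -> T (part0 T p).
Proof.
case=> [[g [g' gg]] _ _].
have : exists x : gpath G, [set h | exists h' : gpath G, nsplit T h h' p] x.
  by exists g, g'.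
by move=> /(xgetPex p)[g2 []].
Qed.

(** The closure of T under appending inverse letters; its words satisfy e(T) <= E(w). *)
Definition tclos v T w := cpath (inl v) w /\ T (v, strip w).

Lemma tclos_lower v T u w : tree v T -> prefix u w -> tclos v T w -> tclos v T u.
Proof.
move=> tT /[dup] uw /prefixP[r wE] [ow Tw]; split.
  by move: ow; rewrite wE cpath_cat => /andP[].
by apply: tree_lower tT _ _ _ Tw; exact: strip_mono.
Qed.

Lemma tclos_tree v T w : tree v T -> T (v, w) -> tclos v T w.
Proof.
move=> tT Tw; split; first exact: tree_ok Tw.
exact: (tree_lower tT (prefix_strip w)).
Qed.

Lemma conflict_strip (p q : seq L) : conflict p q -> conflict (strip p) (strip q).
Proof.
move=> [u [Z [e [f [H [up uq]]]]]]; exists u, Z, e, f; split => //.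
by split; [have := strip_mono up|have := strip_mono uq]; rewrite strip_rconsl.
Qed.

Lemma tclos_nc v T (p q : seq L) : tree v T -> tclos v T p -> tclos v T q -> ~ conflict p q.
Proof. by move=> tT [_ Tp] [_ Tq] /conflict_strip; exact: (tree_nc tT). Qed.

(* not necessarily reduced *)
Fixpoint wpath v w := if w is y :: w' then (lsrc y == v) && wpath (lrng y) w' else true.

Definition wend v w : V := foldl (fun _ y => lrng y) v w.

Lemma wpath_cat v u w : wpath v (u ++ w) = wpath v u && wpath (wend v u) w.
Proof. by elim: u v => //= x u IH v; rewrite IH andbA. Qed.

Lemma wend_cat v u w : wend v (u ++ w) = wend (wend v u) w.
Proof. by rewrite /wend foldl_cat. Qed.

Lemma cpath_wpath s w : cpath s w -> wpath (stvert s) w.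
Proof. by elim: w s => //= y w IH s /andP[/follows_src-> /IH/= ->]; rewrite eqxx. Qed.

Lemma stvert_endst s w : stvert (endst s w) = wend (stvert s) w.
Proof. by elim: w s => //= y w IH s; rewrite -[endst _ _]/(endst (inr y) w) IH. Qed.

Lemma wpath_reduce v w : wpath v w -> wpath v (reduce w) /\ wend v (reduce w) = wend v w.
Proof.
elim: w v => // y w IH v; rewrite reduce_cons /= => /andP[/eqP yv /IH[]].
case: (reduce w) => [|z r] /=; first by rewrite yv eqxx => _ <-.
case/andP=> /eqP zy pr er; case: eqVneq => [zE|_] /=.
  by rewrite zE lrng_linv yv in pr er *; split.
by rewrite yv zy !eqxx pr; split.
Qed.

Lemma wpath_winv v w : wpath v w -> wpath (wend v w) (winv w) /\ wend (wend v w) (winv w) = v.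
Proof.
elim: w v => //= y w IH v /andP[/eqP yv /IH[pw ew]].
rewrite winv_cons -cats1 wpath_cat wend_cat ew pw /= lsrc_linv lrng_linv eqxx.
by rewrite -yv.
Qed.

(** Appending e^{-1} either cancels a final e, leaving a prefix, or adds a trailing inverse letter,
    which [strip] ignores. *)
Lemma tclos_rcons v T w (e : E) : tree v T -> tclos v T w ->
  wend v w = rng e -> tclos v T (reduce (rcons w (inr e))).
Proof.
move=> tT tw we; case/lastP: w tw we => [|w x] tw we.
  by split; [rewrite /= -[rng e]we eqxx|exact: tree_nil].
have [xE|xe] := eqVneq x (inl e).
  rewrite xE -cats1 cat_rcons -reduce_catr /= eqxx cats0.
  have /(tclos_lower tT (prefix_rcons _ _)) [ow Tw] := tw.
  by rewrite reduce_id //; exact: cpath_nbt ow.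
case: (tw) => ow Tw.
have owe : cpath (inl v) (rcons (rcons w x) (inr e)).
  rewrite cpath_rcons ow endst_rcons /=; apply: cstep_inr.
    apply/eqP => /(congr1 (@linv G)); rewrite linvK /= => xE.
    by rewrite -xE eqxx in xe.
  by rewrite -we -[wend _ _]/(wend (stvert (inl v)) _) -stvert_endst endst_rcons.
by rewrite reduce_id ?(cpath_nbt owe) //; split => //; rewrite strip_rconsr.
Qed.

(** The closure arises from T by right multiplication by inverse letters, which commutes with left
    translation by g. Hence only the finite set T has to be tested. *)
Lemma tclos_translate v T g : tree v T -> wpath v g -> wend v g = v ->
  (forall t, T (v, t) -> tclos v T (reduce (g ++ t))) ->
  forall w, tclos v T w -> tclos v T (reduce (g ++ w)).
Proof.
move=> tT pg eg H w [].
have [xs wE _] := strip_split w; move: (strip w) wE => t -> ow Tt.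
elim/last_ind: xs ow => [|xs e IH] ow; first by rewrite cats0; exact: H.
rewrite map_rcons -rcons_cat in ow *.
have := ow; rewrite cpath_rcons => /andP[ow' /follows_src /= ne].
rewrite -rcons_cat -cats1 -reduce_catl cats1; apply: tclos_rcons => //; first exact: IH.
have pw : wpath v (g ++ t ++ [seq inr e | e <- xs]).
  by rewrite wpath_cat pg eg -[v in wpath v]/(stvert (inl v)) cpath_wpath.
by rewrite (wpath_reduce pw).2 wend_cat eg ne stvert_endst.
Qed.

(** Cyclic reduction in a free group: all powers of the core c are reduced, whence
    torsion-freeness. *)
Lemma conjugate_decomp g : sorted (@nbt G) g -> g != [::] ->
  exists h c, [/\ g = h ++ c ++ winv h, c != [::] & sorted (@nbt G) (c ++ c)].
Proof.
have [n] := ubnP (size g); elim: n g => // n IH [|x r] // sz sg _.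
case/lastP: r sz sg => [|m l] sz sg.
  by exists [::], [:: x]; split => //=; rewrite /nbt eq_sym linv_neq.
have [xl|xl] := eqVneq x (linv l); last first.
  exists [::], (x :: rcons m l); split => //; first by rewrite cats0.
  by rewrite /= cat_path last_rcons /=; move: sg => /= ->; rewrite /nbt xl.
have m0 : m != [::].
  by apply/eqP => m0; move: sg; rewrite m0 xl /= /nbt linvK eqxx.
have sm : sorted (@nbt G) m.
  by move: sg => /= /path_sorted; rewrite -cats1 => /cat_sorted2[].
have [|h [c [mE c0 cc]]] := IH m _ sm m0.
  by move: sz; rewrite /= size_rcons !ltnS => /ltnW.
exists (x :: h), c; split => //.
by rewrite winv_cons xl linvK mE /= -!rcons_cat.
Qed.

Lemma sorted_glue (R : rel L) u c w : c != [::] ->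
  sorted R (u ++ c) -> sorted R (c ++ w) -> sorted R (u ++ c ++ w).
Proof.
case: c => // x c _; case: u => [|y u] //=.
by rewrite !cat_path /= !cat_path => /and3P[-> -> ->] /andP[_ ->].
Qed.

Lemma reduce_mid p h q : reduce (p ++ winv h ++ h ++ q) = reduce (p ++ q).
Proof. by rewrite -reduce_catr reduce_cancel reduce_catr. Qed.

Lemma count_tclos v T w N : (forall t, T (v, t) -> size t <= N) -> tclos v T w ->
  count (fun x : L => if x is inl _ then true else false) w <= N.
Proof.
move=> H [_ /H]; apply: leq_trans.
have [xs wE _] := strip_split w.
rewrite {1}wE count_cat (_ : count _ [seq _ | _ <- xs] = 0) ?addn0 ?count_size //.
by elim: xs {wE}.
Qed.

(** Inverse letters of w are edges of its inverse, so bounds on the edges of both words bound the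
    length. *)
Lemma size_pos_neg w : size w =
  count (fun x : L => if x is inl _ then true else false) w +
  count (fun x : L => if x is inl _ then true else false) (winv w).
Proof.
by rewrite /winv count_rev; elim: w => //= -[e|e] w ->; rewrite ?add0n ?addnS // addSn.
Qed.

Lemma tree_bound v T : tree v T -> exists N, forall w, T (v, w) -> (size w <= N)%N.
Proof.
move=> tT; have /finite_seqP[s sE] := tree_fin tT.
exists (\max_(p <- s) size p.2)%N => t; rewrite sE /= => ts.
by rewrite (big_rem _ ts) /= leq_maxl.
Qed.

(* A loop k with k T and k^-1 T inside the closure of T would stabilise that
   closure, and so would the powers of k; but their length is unbounded while
   the closure has boundedly many positive letters per word. *)
Lemma trivial_isotropy v T k : tree v T -> k != [::] -> cpath (inl v) k ->
  wend v k = v -> exists2 t, T (v, t) &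
    ~ tclos v T (reduce (k ++ t)) \/ ~ tclos v T (reduce (winv k ++ t)).
Proof.
move=> tT k0 ok ek; apply: contrapT => H.
have pk : wpath v k by exact: cpath_wpath ok.
have [pk' ek'] := wpath_winv pk; rewrite ek in pk' ek'.
pose stab g := forall w, tclos v T w -> tclos v T (reduce (g ++ w)).
have sk : stab k.
  apply: tclos_translate => // t Tt; apply: contrapT => nt; apply: H.
  by exists t => //; left.
have sk' : stab (winv k).
  apply: tclos_translate => // t Tt; apply: contrapT => nt; apply: H.
  by exists t => //; right.
have [h [c [kE c0 cc]]] := conjugate_decomp (cpath_nbt ok) k0.
(* Squaring the core d squares the conjugate of d by h; iterating gives arbitrarily long powers. *)
have sq d : stab (h ++ d ++ winv h) -> stab (h ++ (d ++ d) ++ winv h).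
  move=> sd w /sd/sd; rewrite reduce_catr; congr (tclos _ _ _).
  by rewrite -!catA (catA h d (winv h ++ _)) reduce_mid -!catA.
have winvE d : winv (h ++ d ++ winv h) = h ++ winv d ++ winv h.
  by rewrite !winv_cat winvK catA.
have big n : exists d, [/\ d != [::] /\ n <= size d, sorted (@nbt G) (d ++ d),
    sorted (@nbt G) (h ++ d ++ winv h), stab (h ++ d ++ winv h)
    & stab (winv (h ++ d ++ winv h))].
  elim: n => [|n [d [[d0 nd] dd hdh sd sd']]].
    by exists c; rewrite -kE; split => //; exact: cpath_nbt ok.
  have sdd : sorted (@nbt G) ((d ++ d) ++ d ++ d).
    by rewrite -catA; do 2 (apply: sorted_glue => //).
  exists (d ++ d); split => //.
  - split; first by rewrite -size_eq0 size_cat addn_eq0 size_eq0 (negPf d0).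
    rewrite size_cat; apply: (@leq_ltn_trans (size d)) => //.
    by rewrite -[X in (X < _)%N]addn0 ltn_add2l lt0n size_eq0.
  - have hd : sorted (@nbt G) (h ++ d) by move: hdh; rewrite catA => /cat_sorted2[].
    have dh : sorted (@nbt G) (d ++ winv h) by move: hdh => /cat_sorted2[].
    by rewrite -catA; apply: sorted_glue => //; exact: sorted_glue.
  - exact: sq.
  - by rewrite winvE winv_cat; apply: sq; rewrite -winvE.
have [N HN] := tree_bound tT.
have [d [[_ nd] _ hdh sd sd']] := big (N + N).+1.
(* Translating the empty word puts the long power and its inverse in the closure. Each has at most N
   edges, which contradicts a length above N + N. *)
have t0 : tclos v T [::] by split => //; exact: tree_nil.
have := sd _ t0; have := sd' _ t0; rewrite !cats0.
rewrite !reduce_id ?sorted_nbt_winv // => /(count_tclos HN) c2 /(count_tclos HN) c1.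
have := leq_add c1 c2; rewrite -size_pos_neg !size_cat => le.
have := leq_trans nd (leq_trans (leq_trans (leq_addr _ _) (leq_addl _ _)) le).
by rewrite ltnn.
Qed.

End Trees.

Local Open Scope ring_scope.

(** * The socle of a *-algebra *)

Section StarAlgebraTheory.
Variables (K : fieldType) (conj : K -> K) (A : starAlgType conj).
Implicit Types (a b c p : A).

Lemma nmul0r a : 0 ** a = 0.
Proof. by apply: (addIr (0 ** a)); rewrite -nmulDl !add0r. Qed.

Lemma nmulr0 a : a ** 0 = 0.
Proof. by apply: (addIr (a ** 0)); rewrite -nmulDr !add0r. Qed.

Lemma nmulBl a b c : (a - b) ** c = a ** c - b ** c.
Proof. by rewrite nmulDl nmulNl. Qed.

Lemma nmulBr a b c : c ** (a - b) = c ** a - c ** b.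
Proof. by rewrite nmulDr nmulNr. Qed.

Lemma nmul_suml I (r : seq I) (P : pred I) (F : I -> A) a :
  (\sum_(i <- r | P i) F i) ** a = \sum_(i <- r | P i) (F i ** a).
Proof. exact: (big_morph (fun x => x ** a) (fun x y => nmulDl x y a) (nmul0r a)). Qed.

Lemma nmul_sumr I (r : seq I) (P : pred I) (F : I -> A) a :
  a ** (\sum_(i <- r | P i) F i) = \sum_(i <- r | P i) (a ** F i).
Proof. exact: (big_morph (fun x => a ** x) (fun x y => nmulDr a x y) (nmulr0 a)). Qed.

Lemma ideal_gen_sub (S I : set A) :
  two_sided_ideal I -> S `<=` I -> ideal_gen S `<=` I.
Proof. by move=> II SI x; apply. Qed.

(** As the algebra has no unit, membership of x itself must be justified wherever this ideal is
    used, by an idempotent that fixes x on the left. *)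
Lemma left_ideal_principal x : left_ideal [set y | exists a, y = a ** x].
Proof.
split; first split.
- by exists 0; rewrite nmul0r.
- by move=> _ _ [a ->] [b ->]; exists (a + b); rewrite nmulDl.
- by move=> k _ [a ->]; exists (k *: a); rewrite nscalerAl.
- by move=> b _ [a ->]; exists (b ** a); rewrite nmulA.
Qed.

Lemma soc0 : soc A 0.
Proof. by exists [::] => //; rewrite big_nil. Qed.

Lemma soc_minimal (L : set A) x : minimal_left_ideal L -> L x -> soc A x.
Proof.
by move=> mL Lx; exists [:: x]; rewrite ?big_seq1 // => y; rewrite inE => /eqP->; exists L.
Qed.

(** Right multiplication by b is a homomorphism of left modules, and the image of a simple module is
    zero or simple. This makes the socle a right ideal. *)
Lemma minimal_translate (L : set A) b : minimal_left_ideal L ->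
  (forall x, L x -> x ** b = 0) \/ minimal_left_ideal [set y | exists2 x, L x & y = x ** b].
Proof.
move=> [LL L0 mL]; have [|nz] := pselect (forall x, L x -> x ** b = 0); first by left.
have [[LZ LD LS] LM] := LL.
right; split.
- split; first split.
  + by exists 0; rewrite ?nmul0r.
  + by move=> _ _ [x Lx ->] [y Ly ->]; exists (x + y); [exact: LD|rewrite nmulDl].
  + by move=> k _ [x Lx ->]; exists (k *: x); [exact: LS|rewrite nscalerAl].
  + by move=> a _ [x Lx ->]; exists (a ** x); [exact: LM|rewrite nmulA].
- move=> Lb0; apply: nz => x Lx.
  by have : [set y | exists2 x, L x & y = x ** b] (x ** b) by [exists x]; rewrite Lb0.
- move=> L' [[L'Z L'D L'S] L'M] L'L.
  have [||e|e] := mL [set x | L x /\ L' (x ** b)].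
  + split; first split.
    * by split => //; rewrite nmul0r.
    * by move=> x y [Lx L'x] [Ly L'y]; split; [exact: LD|rewrite nmulDl; exact: L'D].
    * by move=> k x [Lx L'x]; split; [exact: LS|rewrite -nscalerAl; exact: L'S].
    * by move=> a x [Lx L'x]; split; [exact: LM|rewrite -nmulA; exact: L'M].
  + by move=> x [].
  + left; apply/seteqP; split => [y L'y|_ ->//].
    have [x Lx yE] := L'L _ L'y.
    have : [set x | L x /\ L' (x ** b)] x by split => //; rewrite -yE.
    by rewrite e yE => ->; rewrite nmul0r.
  + right; apply/seteqP; split => // _ [x Lx ->].
    by have : L x by []; rewrite -e => -[].
Qed.

Lemma soc_ideal : two_sided_ideal (soc A).
Proof.
split; first split; first split.
- exact: soc0.
- move=> _ _ [s Hs ->] [t Ht ->]; exists (s ++ t); last by rewrite big_cat.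
  by move=> y; rewrite mem_cat => /orP[/Hs|/Ht].
- move=> k _ [s Hs ->]; exists [seq k *: y | y <- s].
    by move=> _ /mapP[y /Hs[L mL Ly] ->]; exists L => //; have [[[_ _ LS] _] _ _] := mL; exact: LS.
  by rewrite big_map scaler_sumr.
- move=> a _ [s Hs ->]; exists [seq a ** y | y <- s].
    by move=> _ /mapP[y /Hs[L mL Ly] ->]; exists L => //; have [[_ LM] _ _] := mL; exact: LM.
  by rewrite big_map nmul_sumr.
- move=> _ b [s Hs ->]; rewrite nmul_suml.
  elim: s Hs => [|y s IH] Hs; first by rewrite big_nil; exact: soc0.
  rewrite big_cons.
  have [t Ht ->] : soc A (\sum_(i <- s) i ** b).
    by apply: IH => z zs; apply: Hs; rewrite inE zs orbT.
  have [L mL Ly] := Hs y (mem_head _ _).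
  have [z0|mLb] := minimal_translate b mL; first by rewrite z0 // add0r; exists t.
  exists (y ** b :: t); last by rewrite big_cons.
  move=> z; rewrite inE => /orP[/eqP->|/Ht//].
  by exists [set y | exists2 x, L x & y = x ** b] => //; exists y.
Qed.

End StarAlgebraTheory.

(** * Range projections of paths *)

Section CohnAlgebra.
Variables (K : fieldType) (conj : K -> K) (G : sepGraph).
Notation V := (vert G).
Notation E := (edge G).
Notation L := (letter G).
Notation A := (cohn_ab conj G).
Implicit Types (x y z : L) (w u g : seq L) (v : V) (a b c p q : A).

Notation q_ := (to_quo (commutator_ideal conj G)).

(** * Generators and relations in the quotient algebra *)

Lemma to_quoM (x y : cohn conj G) : q_ (x ** y) = q_ x ** q_ y :> A.
Proof. by symmetry; exact: qmulE. Qed.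

Lemma to_quoD (x y : cohn conj G) : q_ (x + y) = q_ x + q_ y :> A.
Proof. by symmetry; exact: qaddE. Qed.

Lemma to_quoZ k (x : cohn conj G) : q_ (k *: x) = k *: q_ x :> A.
Proof. by symmetry; exact: qscaleE. Qed.

Lemma to_quoN (x : cohn conj G) : q_ (- x) = - q_ x :> A.
Proof. by symmetry; exact: qoppE. Qed.

Lemma to_quoS (x : cohn conj G) : q_ (star x) = star (q_ x) :> A.
Proof. by symmetry; exact: qstarE. Qed.

Notation vt := (ab_vert conj).
Notation lt := (letter_elt conj).

Lemma vtM v v' : vt v ** vt v' = if v == v' then vt v else 0.
Proof.
rewrite /ab_vert -to_quoM /cohn_vert /pgen [_ ** _]pmulE.
rewrite (proj2 (pclassP _ _ _ _) (cg_rel conj (cr_vv _ v v'))).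
by case: ifP.
Qed.

Lemma star_vt v : star (vt v) = vt v.
Proof.
rewrite /ab_vert -to_quoS /cohn_vert /pgen [star _]pstarE.
by rewrite (proj2 (pclassP _ _ _ _) (cg_rel conj (cr_vstar _ v))).
Qed.

Lemma vt_edge (e : E) : vt (src e) ** ab_edge conj e = ab_edge conj e.
Proof.
rewrite /ab_vert /ab_edge -to_quoM /cohn_vert /cohn_edge /pgen [_ ** _]pmulE.
by rewrite (proj2 (pclassP _ _ _ _) (cg_rel conj (cr_se _ e))).
Qed.

Lemma edge_vt (e : E) : ab_edge conj e ** vt (rng e) = ab_edge conj e.
Proof.
rewrite /ab_vert /ab_edge -to_quoM /cohn_vert /cohn_edge /pgen [_ ** _]pmulE.
by rewrite (proj2 (pclassP _ _ _ _) (cg_rel conj (cr_er _ e))).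
Qed.

Lemma edge_sep (Z : set E) (e f : E) : sepU Z -> Z e -> Z f ->
  star (ab_edge conj e) ** ab_edge conj f = if e == f then vt (rng e) else 0.
Proof.
move=> ZC Ze Zf.
rewrite /ab_edge -to_quoS -to_quoM /cohn_edge /pgen [star _]pstarE [_ ** _]pmulE.
rewrite (proj2 (pclassP _ _ _ _) (cg_rel conj (cr_ef _ ZC Ze Zf))).
by case: ifP.
Qed.

Lemma star_lt y : star (lt y) = lt (linv y).
Proof. by case: y => e //=; rewrite starK. Qed.

Lemma vt_lt y : vt (lsrc y) ** lt y = lt y.
Proof.
case: y => e /=; first exact: vt_edge.
by rewrite -[LHS]starK starM starK star_vt edge_vt.
Qed.

Lemma lt_vt y : lt y ** vt (lrng y) = lt y.
Proof. by rewrite -[LHS]starK starM star_vt star_lt -lsrc_linv vt_lt star_lt linvK. Qed.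

Lemma vtlt v y : vt v ** lt y = if v == lsrc y then lt y else 0.
Proof.
by rewrite -vt_lt nmulA vtM; case: eqVneq => [->|_]; rewrite ?vt_lt ?nmul0r.
Qed.

Lemma ltvt v y : lt y ** vt v = if lrng y == v then lt y else 0.
Proof.
by rewrite -lt_vt -nmulA vtM; case: eqVneq => [->|_]; rewrite ?lt_vt ?nmulr0.
Qed.

Lemma lt_lt0 x y : lrng x != lsrc y -> lt x ** lt y = 0.
Proof. by move=> xy; rewrite -(lt_vt x) -nmulA vtlt (negPf xy) nmulr0. Qed.

Lemma lt_inv_inl (e : E) : lt (inr e) ** lt (inl e) = vt (rng e).
Proof.
have [Z ZC Ze] := sep_ex e.
by rewrite /= (@edge_sep Z) ?eqxx //; exists (src e).
Qed.

Lemma lt_linvK y : lt y ** lt (linv y) ** lt y = lt y.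
Proof.
case: y => e; last by rewrite lt_inv_inl vtlt eqxx.
by rewrite -nmulA lt_inv_inl ltvt eqxx.
Qed.

(** * The commuting projections of the multiplicative semigroup *)

Definition sgelt a := exists2 x, @cohn_semigroup K conj G x & a = q_ x.

Lemma sgeltM a b : sgelt a -> sgelt b -> sgelt (a ** b).
Proof.
move=> [x Sx ->] [y Sy ->]; exists (x ** y); last by rewrite to_quoM.
by move=> I II; have [[IM _] _] := II; apply: IM; [exact: (Sx I II)|exact: (Sy I II)].
Qed.

Lemma sgelt_star a : sgelt a -> sgelt (star a).
Proof.
move=> [x Sx ->]; exists (star x); last by rewrite to_quoS.
by move=> I II; have [[_ IS] _] := II; apply: IS; exact: (Sx I II).
Qed.

Lemma sgelt_vt v : sgelt (vt v).
Proof.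
by exists (cohn_vert conj v) => // I [_ HI]; apply: HI; left; exists v.
Qed.

Lemma sgelt_lt y : sgelt (lt y).
Proof.
have H e : sgelt (ab_edge conj e).
  by exists (cohn_edge conj e) => // I [_ HI]; apply: HI; right; exists e.
by case: y => e /=; [|apply: sgelt_star].
Qed.

Lemma sgelt_comm a b : sgelt a -> sgelt b ->
  a ** star a ** (b ** star b) = b ** star b ** (a ** star a).
Proof.
move=> [x Sx ->] [y Sy ->].
have H (z : cohn conj G) : q_ z ** star (q_ z) = q_ (z ** star z).
  by rewrite -to_quoS -(to_quoM z).
rewrite !H -(to_quoM (x ** star x)) -(to_quoM (y ** star y)).
by apply/to_quoP; apply: sub_ideal_gen; exists x, y.
Qed.

(* A bicommutant: a commutative set closed under products and differences that
   contains all the projections [a ** star a]. *)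
Definition bicomm p := forall b, (forall a, sgelt a -> b ** (a ** star a) = a ** star a ** b) ->
  p ** b = b ** p.

Lemma bicomm_sgelt a : sgelt a -> bicomm (a ** star a).
Proof. by move=> Ma b H; rewrite H. Qed.

Lemma bicommB p q : bicomm p -> bicomm q -> bicomm (p - q).
Proof. by move=> Dp Dq b H; rewrite nmulBl nmulBr Dp // Dq. Qed.

Lemma bicommM p q : bicomm p -> bicomm q -> bicomm (p ** q).
Proof. by move=> Dp Dq b H; rewrite -nmulA (Dq _ H) nmulA (Dp _ H) nmulA. Qed.

Lemma bicomm_comm_sgelt p a : bicomm p -> sgelt a -> p ** (a ** star a) = a ** star a ** p.
Proof. by move=> Dp Ma; apply: Dp => b Mb; exact: sgelt_comm. Qed.

Lemma bicomm_comm p q : bicomm p -> bicomm q -> p ** q = q ** p.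
Proof. by move=> Dp Dq; apply: Dp => a; exact: bicomm_comm_sgelt. Qed.

(** A word acts by left multiplication rather than being an element, since the empty word would have
    to be a unit. *)
Definition lmul w a := foldr (fun y b => lt y ** b) a w.

Lemma lmul_cat u w a : lmul (u ++ w) a = lmul u (lmul w a).
Proof. by rewrite /lmul foldr_cat. Qed.

Lemma lmulM w a b : lmul w a ** b = lmul w (a ** b).
Proof. by elim: w => //= y w IH; rewrite -nmulA IH. Qed.

Lemma lmul0 w : lmul w 0 = 0 :> A.
Proof. by elim: w => //= y w ->; rewrite nmulr0. Qed.

Definition mon w v := lmul w (vt v).

(** The product of the letters of w preceded by the vertex v. Defined as an adjoint, it inherits the
    properties of [mon]. *)
Definition rmon v w := star (mon (winv w) v).

Lemma star_rmon v w : star (rmon v w) = mon (winv w) v.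
Proof. by rewrite starK. Qed.

Lemma rmon_nil v : rmon v [::] = vt v. Proof. exact: star_vt. Qed.

Lemma rmon_rcons v w y : rmon v (rcons w y) = rmon v w ** lt y.
Proof. by rewrite /rmon winv_rcons /= starM star_lt linvK. Qed.

Lemma mon_vt w v v' : mon w v ** vt v' = if v == v' then mon w v else 0.
Proof. by rewrite lmulM vtM; case: ifP => // _; rewrite lmul0. Qed.

Lemma sgelt_mon w v : sgelt (mon w v).
Proof. by elim: w => [|y w IH]; [exact: sgelt_vt|apply: sgeltM => //; exact: sgelt_lt]. Qed.

Lemma sgelt_rmon v w : sgelt (rmon v w). Proof. exact/sgelt_star/sgelt_mon. Qed.

(** Every monomial is a partial isometry: in y m m^* y^* y m the projections m m^* and y^* y
    commute, and both y and m are partial isometries. *)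
Lemma mon_star_mon w v : mon w v ** star (mon w v) ** mon w v = mon w v.
Proof.
elim: w => [|y w IH]; first by rewrite /mon /= star_vt !vtM eqxx vtM eqxx.
rewrite -[mon (y :: w) v]/(lt y ** mon w v) starM star_lt; set m := mon w v in IH *.
have H := sgelt_comm (sgelt_mon w v) (sgelt_lt (linv y)).
rewrite star_lt linvK -/m in H.
rewrite !nmulA -(nmulA _ m) -(nmulA _ _ (lt (linv y))) -nmulA.
rewrite -!nmulA (nmulA m) (nmulA (lt (linv y))) (nmulA (m ** _)) H -!nmulA.
by rewrite (nmulA m) IH !nmulA lt_linvK.
Qed.

Definition rproj v w := locked (rmon v w ** star (rmon v w)).

Lemma rprojE v w : rproj v w = rmon v w ** star (rmon v w).
Proof. by rewrite /rproj -lock. Qed.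

Lemma bicomm_rproj v w : bicomm (rproj v w).
Proof. by rewrite rprojE; exact/bicomm_sgelt/sgelt_rmon. Qed.

Lemma rproj_nil v : rproj v [::] = vt v.
Proof. by rewrite rprojE rmon_nil star_vt vtM eqxx. Qed.

Lemma rmonK v w : rmon v w ** star (rmon v w) ** rmon v w = rmon v w.
Proof.
by have /(congr1 star) := mon_star_mon (winv w) v; rewrite !starM nmulA.
Qed.

Lemma rproj_idem v w : rproj v w ** rproj v w = rproj v w.
Proof. by rewrite rprojE nmulA rmonK. Qed.

Lemma rmon_wend v w : wpath v w -> rmon v w ** vt (wend v w) = rmon v w.
Proof.
case/lastP: w => [|w y] _; first by rewrite rmon_nil vtM eqxx.
by rewrite rmon_rcons -cats1 wend_cat /= -nmulA lt_vt.
Qed.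

Lemma rproj_rcons v w y : rproj v (rcons w y) =
  rmon v w ** (lt y ** lt (linv y)) ** star (rmon v w).
Proof. by rewrite rprojE rmon_rcons starM star_lt !nmulA. Qed.

Lemma rproj_rcons_inr v w (e : E) : wpath v w -> wend v w = rng e ->
  rproj v (rcons w (inr e)) = rproj v w.
Proof. by move=> pw ew; rewrite rproj_rcons rprojE lt_inv_inl -ew rmon_wend. Qed.

Lemma rproj_strip v w : cpath (inl v) w -> rproj v (strip w) = rproj v w.
Proof.
have [xs wE _] := strip_split w; rewrite {1 3}wE.
elim/last_ind: xs {wE} => [|xs e IH]; first by rewrite cats0.
rewrite map_rcons -rcons_cat cpath_rcons => /andP[ow /follows_src /= ne].
rewrite rproj_rcons_inr //; first exact: IH.
- exact: (cpath_wpath ow).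
- by rewrite -[in LHS]/(stvert (inl v)) -stvert_endst -ne.
Qed.

Lemma sgelt_lt_comm y v w : lt y ** lt (linv y) ** (star (rmon v w) ** rmon v w) =
  star (rmon v w) ** rmon v w ** (lt y ** lt (linv y)).
Proof.
have := sgelt_comm (sgelt_lt y) (sgelt_star (sgelt_rmon v w)).
by rewrite star_lt starK.
Qed.

Lemma rmonKA v w a : rmon v w ** (star (rmon v w) ** (rmon v w ** a)) = rmon v w ** a.
Proof. by rewrite !nmulA rmonK. Qed.

Lemma lt_rmonA y v w a :
  lt y ** (lt (linv y) ** (star (rmon v w) ** (rmon v w ** a))) =
  star (rmon v w) ** (rmon v w ** (lt y ** (lt (linv y) ** a))).
Proof. by rewrite !nmulA -(nmulA _ _ (rmon v w)) sgelt_lt_comm !nmulA. Qed.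

Lemma rproj_rcons_le v w y : rproj v (rcons w y) ** rproj v w = rproj v (rcons w y).
Proof. by rewrite rproj_rcons rprojE -!nmulA lt_rmonA rmonKA. Qed.

Lemma rproj_prefix v u w : prefix u w -> rproj v w ** rproj v u = rproj v w.
Proof.
case/prefixP => r ->; elim/last_ind: r => [|r y IH]; first by rewrite cats0 rproj_idem.
by rewrite -rcons_cat -rproj_rcons_le -nmulA IH.
Qed.

Lemma rproj_comm v v' w w' : rproj v w ** rproj v' w' = rproj v' w' ** rproj v w.
Proof. exact: bicomm_comm (bicomm_rproj _ _) (bicomm_rproj _ _). Qed.

(** The projections lie below E(ue) and E(uf). Moving e e^* past u^* u in the product of these two
    exposes e^* f = 0. *)
Lemma rproj_conflict v w w' : conflict w w' -> rproj v w ** rproj v w' = 0.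
Proof.
move=> [u [Z [e [f [[ZC Ze Zf ef] [ew fw]]]]]].
rewrite -(rproj_prefix v ew) -(rproj_prefix v fw) (rproj_comm _ _ w') nmulA -(nmulA (rproj v w)).
suff -> : rproj v (rcons u (inl e)) ** rproj v (rcons u (inl f)) = 0.
  by rewrite nmulr0 nmul0r.
rewrite !rproj_rcons -!nmulA -lt_rmonA !nmulA.
rewrite -(nmulA _ (lt (inr e))).
have -> : lt (linv (inl e)) ** lt (inl f) = 0.
  by rewrite (edge_sep ZC) //; case: eqP.
by rewrite nmulr0 !nmul0r.
Qed.

Lemma rmon_cons v y w : lsrc y = v -> rmon v (y :: w) = lt y ** rmon (lrng y) w.
Proof.
move=> yv; elim/last_ind: w => [|w z IH].
  by rewrite -[[:: y]]/(rcons [::] y) rmon_rcons !rmon_nil -yv vt_lt lt_vt.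
by rewrite -rcons_cons rmon_rcons IH rmon_rcons nmulA.
Qed.

Lemma rproj_cons v y w : lsrc y = v ->
  rproj v (y :: w) = lt y ** rproj (lrng y) w ** lt (linv y).
Proof. by move=> yv; rewrite !rprojE rmon_cons // starM star_lt !nmulA. Qed.

Lemma lt_rproj_comm y v w : lt y ** lt (linv y) ** rproj v w = rproj v w ** (lt y ** lt (linv y)).
Proof. by rewrite -star_lt rprojE; exact: sgelt_comm (sgelt_lt y) (sgelt_rmon v w). Qed.

Lemma lt_rprojA y v w a :
  lt y ** (lt (linv y) ** (rproj v w ** a)) = rproj v w ** (lt y ** (lt (linv y) ** a)).
Proof. by rewrite !nmulA lt_rproj_comm -!nmulA. Qed.

Lemma lt_linvKA y a : lt y ** (lt (linv y) ** (lt y ** a)) = lt y ** a.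
Proof. by rewrite !nmulA lt_linvK. Qed.

(** Cancelling y y^{-1} removes a factor y y^* that only cuts the projection down, so E can only
    grow under reduction. *)
Lemma rproj_reduce v w : wpath v w -> rproj v w ** rproj v (reduce w) = rproj v w.
Proof.
elim: w v => [|y w IH] v; first by rewrite rproj_idem.
rewrite reduce_cons [wpath _ _]/= => /andP[/eqP yv pw].
have {IH} := IH _ pw; have [] := wpath_reduce pw.
rewrite (rproj_cons _ yv); set F := rproj (lrng y) w.
have two r : F ** rproj (lrng y) r = F ->
    lt y ** F ** lt (linv y) ** rproj v (y :: r) = lt y ** F ** lt (linv y).
  move=> Fr; have := lt_rprojA (linv y) (lrng y) r (lt (linv y)); rewrite linvK => H.
  have := lt_linvK (linv y); rewrite linvK -nmulA => H'.
  by rewrite (rproj_cons _ yv) -!nmulA H H' (nmulA F) Fr.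
case: (reduce w) => [_ _ /two//|z r]; rewrite [rcancel _ _]/=.
case: eqVneq => [->|_] pr _ => [Fr|/two//].
move: Fr pr; rewrite (@rproj_cons (lrng y) (linv y)) // linvK lrng_linv yv => Fr _.
rewrite -[in LHS]Fr -!nmulA (nmulA (lt y) (lt (linv y)) (rproj v r)) lt_rproj_comm.
by rewrite (nmulA (rproj v r) (rproj v r)) rproj_idem -[in RHS]Fr -!nmulA.
Qed.

Lemma lt_inv_inl0 (e f : E) (Z : set E) : sepU Z -> Z e -> Z f -> e <> f ->
  lt (inr e) ** lt (inl f) = 0.
Proof. by move=> ZC Ze Zf ef; rewrite /= (edge_sep ZC) //; case: eqP. Qed.

(** A reduced word that fails to be a C-separated path from v starts at the wrong vertex, or
    contains two letters that do not compose, or contains e^* f with e and f distinct in one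
    block. *)
Lemma rmon_eq0 v w : sorted (@nbt G) w -> ~~ cpath (inl v) w -> rmon v w = 0.
Proof.
elim/last_ind: w => // w y IH sw; rewrite rmon_rcons cpath_rcons.
have [ow /=|now _] := boolP (cpath _ _); last first.
  by rewrite IH ?nmul0r //; move: sw; rewrite -cats1 => /cat_sorted2[].
case/lastP: w ow sw {IH} => [|w x] ow sw.
  by rewrite /= rmon_nil vtlt eq_sym => /negPf->.
rewrite endst_rcons rmon_rcons -nmulA /= /cstep negb_and => /orP[xy|].
  by rewrite lt_lt0 ?nmulr0.
have nxy : nbt x y.
  by move: sw; rewrite -cats1 cat_rcons => /cat_sorted2[_ /= /andP[]].
rewrite /csep nxy /= negbK => /asboolP[Z [e [f [ZC Ze Zf xe yf]]]].
rewrite xe yf (lt_inv_inl0 ZC) ?nmulr0 // => ef.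
by move: nxy; rewrite /nbt xe yf ef eqxx.
Qed.

Lemma rproj_eq0 v w : sorted (@nbt G) w -> ~~ cpath (inl v) w -> rproj v w = 0.
Proof. by move=> sw nw; rewrite rprojE rmon_eq0 ?nmul0r. Qed.

Lemma rmonE v w : rmon v w = foldl nmul (vt v) [seq lt y | y <- w].
Proof.
elim/last_ind: w => [|w y IH]; first exact: rmon_nil.
by rewrite rmon_rcons IH map_rcons foldl_rcons.
Qed.

Lemma path_eltE v w : wpath v w -> path_elt conj (v, w) = rmon v w.
Proof.
rewrite rmonE /path_elt; case: w => //= y w /andP[/eqP yv _].
by rewrite -yv vt_lt.
Qed.

Lemma path_projE v w : wpath v w -> path_proj conj (v, w) = rproj v w.
Proof. by move=> pw; rewrite /path_proj path_eltE // rprojE. Qed.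

End CohnAlgebra.

(** * Projections attached to trees *)

Section TreeIdempotents.
Variables (K : fieldType) (conj : K -> K) (G : sepGraph).
Notation V := (vert G).
Notation E := (edge G).
Notation L := (letter G).
Notation A := (cohn_ab conj G).
Implicit Types (x y z : L) (w u g : seq L) (v : V) (a b c p q : A) (T : set (gpath G)).
Notation vt := (ab_vert conj).
Notation lt := (letter_elt conj).
Notation rproj := (rproj conj).

(** These idempotents commute, and their order p <= q is written [p ** q = p]. *)
Definition isproj p := bicomm p /\ p ** p = p.

Lemma projM p q : isproj p -> isproj q -> isproj (p ** q).
Proof.
move=> [Dp pp] [Dq qq]; split; first exact: bicommM.
by rewrite -nmulA (nmulA q) (bicomm_comm Dq Dp) -nmulA qq nmulA pp.
Qed.

Lemma projB p q : isproj p -> isproj q -> isproj (p - p ** q).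
Proof.
move=> Pp Pq; have [Dpq ppq] := projM Pp Pq; have [[Dp pp] [Dq qq]] := (Pp, Pq).
split; first exact: bicommB.
have qpq : p ** q ** p = p ** q by rewrite -(bicomm_comm Dp Dpq) nmulA pp.
by rewrite nmulBr !nmulBl pp ppq qpq nmulA pp subrr subr0.
Qed.

Lemma proj_rproj v w : isproj (rproj v w).
Proof. by split; [exact: bicomm_rproj|exact: rproj_idem]. Qed.

Lemma proj_comm p q : isproj p -> isproj q -> p ** q = q ** p.
Proof. by move=> [Dp _] [Dq _]; exact: bicomm_comm. Qed.

Lemma proj_anti p q : isproj p -> isproj q -> p ** q = p -> q ** p = q -> p = q.
Proof. by move=> Pp Pq pq qp; rewrite -{1}pq proj_comm. Qed.

(** The product is the greatest lower bound of its factors, so products can be compared whatever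
    their order and repetitions. *)
Lemma foldl_nmul_glb a (s : seq A) : isproj a -> (forall b, b \in s -> isproj b) ->
  let r := foldl nmul a s in
  [/\ isproj r, r ** a = r, forall b, b \in s -> r ** b = r
    & forall c, c ** a = c -> (forall b, b \in s -> c ** b = c) -> c ** r = c].
Proof.
elim: s a => [|x s IH] a Pa Ps /=; first by split => //; case: Pa.
have Px : isproj x by apply: Ps; exact: mem_head.
have Pax := projM Pa Px.
have [|Pr rax rs glb] := IH _ Pax.
  by move=> b bs; apply: Ps; rewrite inE bs orbT.
split => //.
- by rewrite -[in LHS]rax -!nmulA (proj_comm Px Pa) (nmulA a) Pa.2.
- move=> b; rewrite inE => /orP[/eqP->|/rs//].
  by rewrite -[in LHS]rax -!nmulA Px.2.
- move=> c ca cs; apply: glb.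
    by rewrite nmulA ca cs // mem_head.
  by move=> b bs; apply: cs; rewrite inE bs orbT.
Qed.

Lemma tree_maxp v T w : tree v T -> T (v, w) ->
  exists2 m, maxp T (v, m) & prefix w m.
Proof.
move=> tT; have [N HN] := tree_bound tT.
have [n] := ubnP (N - size w)%N; elim: n w => // n IH w sz Tw.
have [mw|nm] := pselect (maxp T (v, w)).
  by exists w => //; exact: prefix_refl.
have [q [Tq wq qw]] : exists q : gpath G, [/\ T q, pprefix (v, w) q & q <> (v, w)].
  apply: contrapT => H; apply: nm; split => // q Tq wq; apply: contrapT => qw.
  by apply: H; exists q.
case: q Tq wq qw => v' q Tq /andP[/eqP /= e wq] qw; subst v'.
case/prefixP: wq => r qE; subst q.
have r0 : (0 < size r)%N by case: r qw {Tq} => //; rewrite cats0.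
have [|m mm pm] := IH (w ++ r) _ Tq.
  move: (HN _ Tq) sz; rewrite size_cat => le sz.
  by apply: leq_trans (_ : N - size w <= n)%N; rewrite ?ltn_sub2l ?(leq_trans _ le) // -addn1 leq_add2l.
by exists m => //; apply: prefix_trans pm; rewrite prefix_prefix.
Qed.

(** T has a maximal element, so the product over them is not the default value 0 of an empty one. *)
Lemma eT_factors v T : tree v T -> exists a (t : seq A), eT conj T = foldl nmul a t /\
  forall b, b \in a :: t <-> exists2 w, maxp T (v, w) & b = rproj v w.
Proof.
move=> tT; rewrite /eT.
have fm : finite_set (maxp T) by apply: sub_finite_set (tree_fin tT) => p [].
set s := [seq path_proj conj p | p : gpath G <- fset_set (maxp T)].
have sP b : b \in s <-> exists2 w, maxp T (v, w) & b = rproj v w.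
  split.
    move=> /mapP[[v' w] + ->]; rewrite in_fset_set // inE => mw.
    have /= e := tree_src tT (proj1 mw); subst v'; exists w => //.
    by apply/path_projE/(cpath_wpath (tree_ok tT (proj1 mw))).
  move=> [w mw ->]; apply/mapP; exists (v, w); first by rewrite in_fset_set // inE.
  by apply/esym/path_projE/(cpath_wpath (tree_ok tT (proj1 mw))).
have [m0 mm0 _] := tree_maxp tT (tree_nil tT).
have m0s : rproj v m0 \in s by apply/sP; exists m0.
by case: (s) m0s sP => // a t _ sP; exists a, t.
Qed.

(** E decreases along prefixes, so the meet over the maximal elements is the meet over all of T. *)
Lemma eT_glb v T : tree v T -> [/\ isproj (eT conj T),
  forall w, T (v, w) -> eT conj T ** rproj v w = eT conj T
  & forall c, (forall w, T (v, w) -> c ** rproj v w = c) -> c ** eT conj T = c].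
Proof.
move=> tT; have [a [t [-> sP]]] := eT_factors tT.
have Ps b : b \in a :: t -> isproj b by move=> /sP[w _ ->]; exact: proj_rproj.
have [||Pr ra rt glb] := @foldl_nmul_glb a t.
- by apply: Ps; rewrite mem_head.
- by move=> b bt; apply: Ps; rewrite inE bt orbT.
split => //.
- move=> w /(tree_maxp tT)[m mm wm].
  have rm : foldl nmul a t ** rproj v m = foldl nmul a t.
    have : rproj v m \in a :: t by apply/sP; exists m.
    by rewrite inE => /orP[/eqP->|/rt].
  by rewrite -rm -nmulA (rproj_prefix _ _ wm).
- move=> c H; have Hs b : b \in a :: t -> c ** b = c by move=> /sP[w [Tw _] ->]; exact: H.
  by apply: glb => [|b bt]; apply: Hs; rewrite inE ?eqxx // bt orbT.
Qed.

Lemma eT1 v : eT conj [set (v, [::])] = vt v.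
Proof.
have [Pe le glb] := eT_glb (tree1 v); rewrite -(rproj_nil conj v).
apply: proj_anti (proj_rproj _ _) _ _ => //; first exact: le.
by apply: glb => w [->]; exact: rproj_idem.
Qed.

Lemma eT_ext v T w : tree v T -> cpath (inl v) w -> strip w = w ->
  (forall t, T (v, t) -> ~ conflict t w) ->
  eT conj T ** rproj v w = eT conj (T `|` Defs.down [set (v, w)]).
Proof.
move=> tT ow sw nw; have tT' := tree_ext tT ow sw nw.
have [Pe le glb] := eT_glb tT; have [Pe' le' glb'] := eT_glb tT'.
have PX := projM Pe (proj_rproj v w).
apply: proj_anti => //.
- apply: glb' => t [Tt|/down1E[_ /= tw]].
    by rewrite -nmulA rproj_comm nmulA le.
  by rewrite -nmulA (rproj_prefix _ _ tw).
- rewrite nmulA glb; last by move=> t Tt; apply: le'; left.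
  by apply: le'; right; apply/down1E; rewrite prefix_refl.
Qed.

Lemma eT_conflict v T t w : tree v T -> T (v, t) -> conflict t w -> eT conj T ** rproj v w = 0.
Proof.
move=> tT Tt tw; have [_ le _] := eT_glb tT.
by rewrite -(le _ Tt) -nmulA rproj_conflict // nmulr0.
Qed.

(** The projection e(T) (1 - E(u_1)) ... (1 - E(u_n)) of the overview, in a form that avoids the
    unit. *)
Definition tproj v T (F : seq (seq L)) := foldl (fun a u => a - a ** rproj v u) (eT conj T) F.

Lemma foldl_diffM v a b F : bicomm b ->
  foldl (fun a u => a - a ** rproj v u) a F ** b = foldl (fun a u => a - a ** rproj v u) (a ** b) F.
Proof.
move=> Db; elim: F a => //= u F IH a; rewrite IH nmulBl; congr (foldl _ (_ - _) _).
by rewrite -!nmulA (bicomm_comm Db (@bicomm_rproj K conj G v u)).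
Qed.

Lemma foldl_diff_glb v a (F : seq (seq L)) : isproj a ->
  let r := foldl (fun a u => a - a ** rproj v u) a F in
  [/\ isproj r, r ** a = r, forall u, u \in F -> r ** rproj v u = 0
    & forall c, c ** a = c -> (forall u, u \in F -> c ** rproj v u = 0) -> c ** r = c].
Proof.
elim: F a => [|u F IH] a Pa /=; first by split => //; case: Pa.
have Pu := proj_rproj v u.
have [Pr ra rs glb] := IH _ (projB Pa Pu).
split => //.
- by rewrite -[in LHS]ra -nmulA nmulBl -nmulA (proj_comm Pu Pa) nmulA Pa.2 ra.
- move=> b; rewrite inE => /orP[/eqP->|/rs//].
  by rewrite -[in LHS]ra -nmulA nmulBl -nmulA Pu.2 subrr nmulr0.
- move=> c ca cs; apply: glb.
    by rewrite nmulBr nmulA ca cs ?mem_head // subr0.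
  by move=> b bs; apply: cs; rewrite inE bs orbT.
Qed.

Record admissible v T (F : seq (seq L)) : Prop := Admissible {
  admissible_tree : tree v T;
  admissible_neg : forall u, u \in F -> cpath (inl v) u /\ ~ T (v, strip u)
}.

Section PTF.
Variables (v : V) (T : set (gpath G)) (F : seq (seq L)).
Hypothesis tT : tree v T.

Lemma tproj_proj : isproj (tproj v T F).
Proof. by have [Pe _ _] := eT_glb tT; have [] := @foldl_diff_glb v _ F Pe. Qed.

Lemma tproj_eT : tproj v T F ** eT conj T = tproj v T F.
Proof. by have [Pe _ _] := eT_glb tT; have [] := @foldl_diff_glb v _ F Pe. Qed.

Lemma tproj_pos w : T (v, w) -> tproj v T F ** rproj v w = tproj v T F.
Proof. by have [_ le _] := eT_glb tT => Tw; rewrite -tproj_eT -nmulA le. Qed.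

Lemma tproj_neg u : u \in F -> tproj v T F ** rproj v u = 0.
Proof. by have [Pe _ _] := eT_glb tT; have [_ _ + _] := @foldl_diff_glb v _ F Pe; apply. Qed.

Lemma tproj_glb c : (forall w, T (v, w) -> c ** rproj v w = c) ->
  (forall u, u \in F -> c ** rproj v u = 0) -> c ** tproj v T F = c.
Proof.
have [Pe _ glb] := eT_glb tT => H1 H2.
by have [_ _ _] := @foldl_diff_glb v _ F Pe; apply => //; exact: glb.
Qed.

Lemma tproj_vtr : tproj v T F ** vt v = tproj v T F.
Proof. by rewrite -(rproj_nil conj v) tproj_pos //; exact: tree_nil. Qed.

Lemma tproj_vt : vt v ** tproj v T F = tproj v T F.
Proof. by rewrite -(rproj_nil conj v) -(proj_comm tproj_proj (proj_rproj _ _)) rproj_nil tproj_vtr. Qed.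

Lemma tproj_tclos w : cpath (inl v) w -> T (v, strip w) -> tproj v T F ** rproj v w = tproj v T F.
Proof. by move=> ow Tw; rewrite -rproj_strip // tproj_pos. Qed.

Lemma tproj_rcons u : tproj v T (rcons F u) = tproj v T F - tproj v T F ** rproj v u.
Proof. by rewrite /tproj foldl_rcons. Qed.

Lemma tproj_rconsl u : tproj v T F ** tproj v T (rcons F u) = tproj v T (rcons F u).
Proof. by rewrite tproj_rcons nmulBr nmulA tproj_proj.2. Qed.

Lemma tproj_rconsr u : tproj v T (rcons F u) ** tproj v T F = tproj v T (rcons F u).
Proof.
rewrite tproj_rcons nmulBl -nmulA (proj_comm (proj_rproj v u) tproj_proj) nmulA.
by rewrite tproj_proj.2.
Qed.

Lemma admissible_rcons u : admissible v T F -> cpath (inl v) u -> ~ T (v, strip u) ->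
  admissible v T (rcons F u).
Proof.
by move=> [_ H] ou nu; split => // w; rewrite mem_rcons inE => /orP[/eqP->|/H].
Qed.

Lemma tproj_ext w : cpath (inl v) w -> strip w = w -> (forall t, T (v, t) -> ~ conflict t w) ->
  tproj v T F ** rproj v w = tproj v (T `|` Defs.down [set (v, w)]) F.
Proof.
move=> ow sw nw; rewrite /tproj foldl_diffM; last exact: bicomm_rproj.
by rewrite (eT_ext tT ow sw nw).
Qed.

Lemma tproj_conflict t w : T (v, t) -> conflict t w -> tproj v T F ** rproj v w = 0.
Proof. by move=> Tt tw; rewrite -tproj_eT -nmulA (eT_conflict tT Tt tw) nmulr0. Qed.

(** As the product is nonzero, w does not conflict with T and can be added to it. No u in F enters
    the new closure: [strip u] would then be a prefix of [strip w], so E(w) <= E(u), while the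
    projection is orthogonal to E(u). *)
Lemma tproj_split w : cpath (inl v) w -> ~ T (v, strip w) ->
  tproj v T F ** rproj v w <> 0 -> admissible v T F ->
  exists T', admissible v T' F /\ tproj v T F ** rproj v w = tproj v T' F.
Proof.
move=> ow nw n0 [_ sF].
have nc t : T (v, t) -> ~ conflict t (strip w).
  by move=> Tt tw; apply: n0; rewrite -rproj_strip //; exact: tproj_conflict tw.
have osw : cpath (inl v) (strip w).
  by have /prefixP[r wE] := prefix_strip w; move: ow; rewrite {1}wE cpath_cat => /andP[].
have pE := tproj_ext osw (stripK w) nc.
have tT' := tree_ext tT osw (stripK w) nc.
exists (T `|` Defs.down [set (v, strip w)]); rewrite -pE rproj_strip //; split => //.
split => // u uF; have [ou nu] := sF _ uF; split => //.
case=> [//|/down1E[_ /= uw]]; apply: n0.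
have := rproj_prefix conj v uw; rewrite !rproj_strip // => <-.
by rewrite rproj_comm nmulA tproj_neg // nmul0r.
Qed.

End PTF.

Definition decides v p w := p ** rproj v w = p \/ p ** rproj v w = 0.

Lemma decides_le v p q w : isproj p -> isproj q -> q ** p = q -> decides v p w -> decides v q w.
Proof.
move=> Pp Pq qp [H|H]; [left|right]; rewrite -qp -nmulA H //.
exact: nmulr0.
Qed.

(** If a does not vanish on p (1 - E(w)), that part is kept. Otherwise a p = a p E(w), and p E(w) is
    kept. *)
Lemma decide_step v T F (a : A) w : admissible v T F -> a ** tproj v T F <> 0 -> cpath (inl v) w ->
  exists T' F', [/\ admissible v T' F', a ** tproj v T' F' <> 0,
    tproj v T' F' ** tproj v T F = tproj v T' F' & decides v (tproj v T' F') w].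
Proof.
move=> aTF ap ow; have tT := admissible_tree aTF; have Pp := tproj_proj F tT.
have [Tw|nTw] := pselect (T (v, strip w)).
  by exists T, F; split => //; [case: Pp|left; exact: tproj_tclos].
have [a0|] := pselect (a ** tproj v T (rcons F w) = 0); last first.
  exists T, (rcons F w); split => //; first exact: admissible_rcons.
    exact: tproj_rconsr.
  by right; apply: tproj_neg => //; rewrite mem_rcons mem_head.
have aE : a ** tproj v T F = a ** (tproj v T F ** rproj v w).
  by apply/eqP; rewrite -subr_eq0 -nmulBr -tproj_rcons a0.
have n0 : tproj v T F ** rproj v w <> 0 by move=> e0; apply: ap; rewrite aE e0 nmulr0.
have [T' [sT' pE]] := tproj_split tT ow nTw n0 aTF.
exists T', F; rewrite -pE; split => //; first by rewrite -aE.
- by rewrite -nmulA (proj_comm (proj_rproj v w) Pp) nmulA Pp.2.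
- by left; rewrite -nmulA rproj_idem.
Qed.

Lemma decide_all v T F (a : A) (l : seq (seq L)) : admissible v T F -> a ** tproj v T F <> 0 ->
  exists T' F', [/\ admissible v T' F', a ** tproj v T' F' <> 0 &
    forall w, w \in l -> cpath (inl v) w -> decides v (tproj v T' F') w].
Proof.
(* The induction also records that the new projection lies below the old one, so that earlier
   decisions persist. *)
move=> aTF ap; suff [T' [F' [s' a' _ d']]] :
  exists T' F', [/\ admissible v T' F', a ** tproj v T' F' <> 0,
    tproj v T' F' ** tproj v T F = tproj v T' F' &
    forall w, w \in l -> cpath (inl v) w -> decides v (tproj v T' F') w] by exists T', F'.
elim: l T F aTF ap => [|w l IH] T F aTF ap.
  by exists T, F; split => //; exact: (tproj_proj F (admissible_tree aTF)).2.
have [ow|now] := boolP (cpath (inl v) w); last first.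
  have [T' [F' [s' a' le' d']]] := IH _ _ aTF ap.
  exists T', F'; split => // u; rewrite inE => /orP[/eqP->|/d'//].
  by rewrite (negPf now).
have [T1 [F1 [s1 a1 le1 d1]]] := decide_step aTF ap ow.
have [T' [F' [s' a' le' d']]] := IH _ _ s1 a1.
exists T', F'; split => //; first by rewrite -le' -nmulA le1.
move=> u; rewrite inE => /orP[/eqP-> _|/d'//].
by apply: decides_le d1 => //; apply: tproj_proj; apply: admissible_tree; [exact: s1|exact: s'].
Qed.

End TreeIdempotents.

(** * Projections in nonzero ideals *)

Section Uniqueness.
Variables (K : fieldType) (conj : K -> K) (G : sepGraph).
Notation V := (vert G).
Notation E := (edge G).
Notation L := (letter G).
Notation A := (cohn_ab conj G).
Implicit Types (x y z : L) (w u g : seq L) (v : V) (a b c p q : A) (T : set (gpath G)).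
Notation vt := (ab_vert conj).
Notation lt := (letter_elt conj).
Notation rproj := (rproj conj).
Notation mon := (mon conj).
Notation rmon := (rmon conj).
Notation tproj := (tproj conj).
Notation q_ := (to_quo (commutator_ideal conj G)).

Lemma cohn_ab_ind (P : A -> Prop) : (forall v, P (vt v)) -> (forall e, P (ab_edge conj e)) ->
  P 0 -> (forall a b, P a -> P b -> P (a + b)) -> (forall k a, P a -> P (k *: a)) ->
  (forall a b, P a -> P b -> P (a ** b)) -> (forall a, P a -> P (star a)) ->
  forall a, P a.
Proof.
move=> Pv Pe P0 PD PZ PM PS; elim/to_quo_ind; elim/pclass_ind; elim.
- by case=> [v|e]; [exact: Pv|exact: Pe].
- exact: P0.
- by move=> t Pt u Pu; rewrite -paddE to_quoD; exact: PD.
- by move=> t Pt; rewrite -poppE to_quoN -scaleN1r; exact: PZ.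
- by move=> k t Pt; rewrite -pscaleE to_quoZ; exact: PZ.
- by move=> t Pt u Pu; rewrite -pmulE to_quoM; exact: PM.
- by move=> t Pt; rewrite -pstarE to_quoS; exact: PS.
Qed.

(** * Linear combinations of monomials *)

Definition mspan a := exists s : seq (K * (seq L * V)),
  a = \sum_(i <- s) i.1 *: mon i.2.1 i.2.2.

Lemma mspan0 : mspan 0. Proof. by exists [::]; rewrite big_nil. Qed.

Lemma mspanD a b : mspan a -> mspan b -> mspan (a + b).
Proof. by move=> [s ->] [t ->]; exists (s ++ t); rewrite big_cat. Qed.

Lemma mspanZ k a : mspan a -> mspan (k *: a).
Proof.
move=> [s ->]; exists [seq (k * i.1, i.2) | i <- s].
by rewrite big_map scaler_sumr; apply: eq_bigr => i _; rewrite scalerA.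
Qed.

Lemma mspan_mon w v : mspan (mon w v).
Proof. by exists [:: (1, (w, v))]; rewrite big_seq1 scale1r. Qed.

Lemma mspan_lmul a : (forall w v, mspan (a ** mon w v)) -> forall b, mspan b -> mspan (a ** b).
Proof.
move=> H b [s ->]; rewrite nmul_sumr; elim/big_ind: _ => [|? ?|i _].
- exact: mspan0.
- exact: mspanD.
- by rewrite -nscalerAr; apply: mspanZ.
Qed.

(** Induction on the generation of a has to pass through products and adjoints, so stability of the
    span under left multiplication by a and by its adjoint is carried along. *)
Lemma mspan_all a : mspan a.
Proof.
suff [] : [/\ mspan a, mspan (star a), forall b, mspan b -> mspan (a ** b)
  & forall b, mspan b -> mspan (star a ** b)] by [].
have vl v : forall b, mspan b -> mspan (vt v ** b).
  apply: mspan_lmul => w v'; case: w => [|y w].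
    rewrite [mon _ _]/(vt v') vtM; case: ifP => _; last exact: mspan0.
    exact: (mspan_mon [::]).
  rewrite [mon _ _]/(lt y ** mon w v') nmulA vtlt; case: ifP => _.
    exact: (mspan_mon (y :: w)).
  by rewrite nmul0r; exact: mspan0.
have ll y : forall b, mspan b -> mspan (lt y ** b).
  by apply: mspan_lmul => w v; exact: (mspan_mon (y :: w)).
have sl y : mspan (lt y).
  by rewrite -(lt_vt conj y); exact: (mspan_mon [:: y]).
elim/cohn_ab_ind: a.
- move=> v; rewrite star_vt; split => //; try exact: vl.
    exact: (mspan_mon [::]).
  exact: (mspan_mon [::]).
- move=> e; have := ll (inl e); have := ll (inr e); have := sl (inl e); have := sl (inr e).
  by split.
- by rewrite star0; split; try exact: mspan0; move=> b _; rewrite nmul0r; exact: mspan0.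
- move=> a b [H1 H2 H3 H4] [I1 I2 I3 I4]; rewrite starD; split; try exact: mspanD.
    by move=> c Sc; rewrite nmulDl; apply: mspanD; auto.
  by move=> c Sc; rewrite nmulDl; apply: mspanD; auto.
- move=> k a [H1 H2 H3 H4]; rewrite starZ; split; try exact: mspanZ.
    by move=> c Sc; rewrite -nscalerAl; apply: mspanZ; auto.
  by move=> c Sc; rewrite -nscalerAl; apply: mspanZ; auto.
- move=> a b [H1 H2 H3 H4] [I1 I2 I3 I4]; rewrite starM; split; auto.
    by move=> c Sc; rewrite -nmulA; auto.
  by move=> c Sc; rewrite -nmulA; auto.
- by move=> a [H1 H2 H3 H4]; rewrite starK; split.
Qed.

Lemma mon_mul w v p : vt v ** p = p -> mon w v ** p = lmul w p.
Proof. by move=> vp; rewrite lmulM vp. Qed.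

Lemma rmon_mul v w a : rmon v w ** a = vt v ** lmul w a.
Proof.
elim/last_ind: w a => [|w y IH] a; first by rewrite rmon_nil.
by rewrite rmon_rcons -nmulA IH -cats1 lmul_cat.
Qed.

Lemma rproj_winv v g p : vt v ** p = p -> rproj v (winv g) ** p = star (mon g v) ** lmul g p.
Proof. by move=> vp; rewrite rprojE /rmon starK winvK -nmulA mon_mul. Qed.

(** E(g^{-1}) is the source projection g^* g, and g = g g^* g. *)
Lemma lmul_kill v g p : vt v ** p = p -> rproj v (winv g) ** p = 0 -> lmul g p = 0.
Proof.
move=> vp Ep0; rewrite -(mon_mul _ vp) -mon_star_mon -nmulA (mon_mul _ vp) -nmulA.
by rewrite -rproj_winv // Ep0 nmulr0.
Qed.

(** The hypothesis is p <= g^* y y^* g. Inserting this in g p and commuting y y^* with g g^* gives y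
    y^* g p. *)
Lemma lmul_cancel v y g p : vt v ** p = p -> rproj v (winv (linv y :: g)) ** p = p ->
  lmul (y :: linv y :: g) p = lmul g p.
Proof.
move=> vp Epp.
have H := sgelt_comm (sgelt_lt conj y) (sgelt_mon conj g v); rewrite star_lt in H.
have -> : lmul (y :: linv y :: g) p = lt y ** lt (linv y) ** (mon g v ** p).
  by rewrite (mon_mul _ vp) /= nmulA.
rewrite -(mon_mul g vp) -[in RHS]Epp rproj_winv //= -(mon_mul g vp) starM star_lt linvK.
rewrite -{1}(mon_star_mon conj g v) -(nmulA _ (mon g v) p).
by rewrite (nmulA (lt y ** _)) H -!nmulA.
Qed.

Lemma lmul_reduce v p w : isproj p -> vt v ** p = p ->
  (forall r, suffix r w -> let u := winv (reduce r) in cpath (inl v) u -> decides v p u) ->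
  lmul w p = 0 \/ [/\ lmul w p = lmul (reduce w) p,
     cpath (inl v) (winv (reduce w)) & p ** rproj v (winv (reduce w)) = p].
Proof.
move=> Pp vp.
elim: w => [|y w IH] H.
  by right; split => //; rewrite rproj_nil -(rproj_nil conj v) (proj_comm Pp (proj_rproj _ _ _)) rproj_nil.
have [|l0|[lE ow pw]] := IH.
- by move=> r rw; apply: H; apply: suffix_trans rw _; exact: suffix_cons.
- by left; rewrite /= l0 nmulr0.
have dw := H _ (suffix_refl _); rewrite reduce_cons /= in dw.
have lyE : lmul (y :: w) p = lmul (y :: reduce w) p by rewrite /= lE.
rewrite lyE reduce_cons; have sw := sorted_reduce w.
have main g : reduce w = g -> sorted (@nbt G) (y :: g) ->
    (cpath (inl v) (winv (y :: g)) -> decides v p (winv (y :: g))) ->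
    lmul (y :: g) p = 0 \/ [/\ lmul (y :: g) p = lmul (y :: g) p,
      cpath (inl v) (winv (y :: g)) & p ** rproj v (winv (y :: g)) = p].
  move=> gE sg dg.
  have [og|nog] := boolP (cpath (inl v) (winv (y :: g))); last first.
    left; apply: (lmul_kill vp); rewrite rproj_eq0 ?nmul0r //.
    by rewrite sorted_nbt_winv.
  case: (dg og) => [pe|p0]; [by right|left].
  by apply: (lmul_kill vp); rewrite -(proj_comm Pp (proj_rproj _ _ _)).
case wE : (reduce w) sw dw pw ow => [|z r] sw dw pw ow; first exact: main.
move: dw; rewrite /rcancel; case: eqVneq => [zy dw|zy dw].
  right; have Epp : rproj v (winv (z :: r)) ** p = p.
    by rewrite -(proj_comm Pp (proj_rproj _ _ _)).
  have pr : prefix (winv r) (winv (z :: r)) by rewrite winv_cons prefix_rcons.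
  split.
  - by rewrite zy in Epp *; exact: lmul_cancel vp Epp.
  - by case/prefixP: pr ow => t ->; rewrite cpath_cat => /andP[].
  - by rewrite -{1}pw -nmulA (rproj_prefix _ _ pr).
by apply: main => //; move: sw => /= ->; rewrite /nbt zy.
Qed.

(** Equal words are merged so that those left are distinct: only then is g_0^{-1} g a nontrivial
    word for every remaining g. *)
Lemma collect_words v p (Q : seq L -> Prop) (s : seq (K * (seq L * V))) : 
  (forall i, i \in s -> mon i.2.1 i.2.2 ** p = 0 \/
    exists2 g, Q g & mon i.2.1 i.2.2 ** p = lmul g p) ->
  exists (Gs : seq (seq L)) (d : seq L -> K), [/\ uniq Gs, forall g, g \in Gs -> Q g &
    (\sum_(i <- s) i.1 *: mon i.2.1 i.2.2) ** p = \sum_(g <- Gs) d g *: lmul g p].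
Proof.
elim: s => [|i s IH] H; first by exists [::], (fun=> 0); split => //; rewrite !big_nil nmul0r.
have [|Gs [d [uG QG sE]]] := IH; first by move=> j js; apply: H; rewrite inE js orbT.
have [m0|[g Qg mE]] := H _ (mem_head _ _).
  by exists Gs, d; split => //; rewrite big_cons nmulDl sE -nscalerAl m0 scaler0 add0r.
have [gG|ngG] := boolP (g \in Gs).
  exists Gs, (fun h => if h == g then d h + i.1 else d h); split => //.
  rewrite big_cons nmulDl sE -nscalerAl mE !(bigD1_seq g) //= eqxx scalerDl.
  rewrite [in RHS](eq_bigr (fun h => d h *: lmul h p)); last by move=> h /negPf->.
  by rewrite addrCA addrA.
exists (g :: Gs), (fun h => if h == g then i.1 else d h); split => //.
- by rewrite /= ngG.
- by move=> h; rewrite inE => /orP[/eqP->|/QG].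
rewrite !big_cons nmulDl sE -nscalerAl mE eqxx; congr (_ + _).
apply: eq_big_seq => h hG; case: eqP => // hg; by rewrite -hg hG in ngG.
Qed.

(* Writing [a ** p] as a combination of reduced words g with p below g^* g and
   dividing by one of them turns it into p plus nontrivial loops. *)
Lemma divide_leading_word v (a : A) : exists l : seq (seq L), forall p, isproj p -> vt v ** p = p ->
  (forall u, u \in l -> cpath (inl v) u -> decides v p u) ->
  a ** p = 0 \/ exists b (d : K) (Ks : seq (K * seq L)),
    [/\ d != 0, forall i, i \in Ks -> i.2 != [::] /\ cpath (inl v) (winv i.2) &
     forall q, isproj q -> p ** q = q ->
       q ** (b ** a) ** q = d *: q + \sum_(i <- Ks) i.1 *: (q ** lmul i.2 q)].
Proof.
have [s aE] := mspan_all a.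
pose Z := [seq i.2.1 | i <- s].
(* Besides the monomials of a, the quotients g_0^{-1} g formed below must be reducible on p; the
   list l collects the words that p has to decide for this. *)
pose Z2 := Z ++ [seq winv (reduce w) ++ reduce u | w <- Z, u <- Z].
pose l := flatten [seq [seq winv (reduce (drop i z)) | i <- iota 0 (size z).+1] | z : seq L <- Z2].
have lP (z r : seq L) : z \in Z2 -> suffix r z -> winv (reduce r) \in l.
  move=> zZ /suffixP[t zE]; apply/flattenP.
  exists [seq winv (reduce (drop i z)) | i <- iota 0 (size z).+1].
    by apply/mapP; exists z.
  apply/mapP; exists (size t); last by rewrite zE drop_size_cat.
  rewrite mem_iota zE size_cat /= add0n ltnS.
  exact: leq_addr.
exists l => p Pp vp dl.
have pv : p ** vt v = p by rewrite -(rproj_nil conj v) (proj_comm Pp (proj_rproj _ _ _)) rproj_nil.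
have red (z : seq L) : z \in Z2 -> lmul z p = 0 \/ [/\ lmul z p = lmul (reduce z) p,
     cpath (inl v) (winv (reduce z)) & p ** rproj v (winv (reduce z)) = p].
  by move=> zZ; apply: lmul_reduce => // r rz u; apply: dl; exact: lP rz.
pose Q g := exists2 z, z \in Z & [/\ g = reduce z, cpath (inl v) (winv g) & p ** rproj v (winv g) = p].
have [|Gs [d [uG QG sE]]] := @collect_words v p Q s.
  move=> i si; have iZ : i.2.1 \in Z by apply/mapP; exists i.
  have iZ2 : i.2.1 \in Z2 by rewrite mem_cat iZ.
  have [->|iv] := eqVneq i.2.2 v; last first.
    by left; rewrite -vp nmulA mon_vt (negPf iv) nmul0r.
  rewrite mon_mul //; have [z0|[zE oz pz]] := red _ iZ2; [by left|right].
  by exists (reduce i.2.1) => //; exists i.2.1.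
have [ap0|ap0] := eqVneq (a ** p) 0; [by left|right].
have [g0 g0G dg0] : exists2 g, g \in Gs & d g != 0.
  apply/hasP; rewrite -[has _ _]negbK -all_predC; apply/negP => /allP H.
  move: ap0; rewrite aE sE big1_seq ?eqxx // => g gG.
  by have := H g gG; rewrite /= negbK => /eqP->; rewrite scale0r.
have [z0 z0Z [g0E og0 pg0]] := QG _ g0G.
(* Division by g_0 is multiplication by its adjoint. The identities hold for all q below p, because
   p is shrunk later to remove the loops. *)
pose b := star (mon g0 v).
have qv q : isproj q -> p ** q = q -> q ** vt v = q /\ vt v ** q = q.
  move=> Pq pq; have vq : vt v ** q = q by rewrite -pq nmulA vp.
  by split => //; rewrite -(rproj_nil conj v) (proj_comm Pq (proj_rproj _ _ _)) rproj_nil.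
have term g : g \in Gs -> g != g0 ->
    (forall q, isproj q -> p ** q = q -> q ** (b ** lmul g q) = 0) \/
    exists k, [/\ k != [::], cpath (inl v) (winv k) &
      forall q, isproj q -> p ** q = q -> q ** (b ** lmul g q) = q ** lmul k q].
  move=> gG gg0; have [z zZ [gE og pg]] := QG _ gG.
  have H q : isproj q -> p ** q = q ->
      q ** (b ** lmul g q) = q ** (lmul (winv g0 ++ g) p ** q).
    move=> Pq pq; have -> : b = rmon v (winv g0) by rewrite /rmon winvK.
    by rewrite rmon_mul nmulA (qv q Pq pq).1 lmulM pq lmul_cat.
  have [|l0|[lE ok pk]] := red (winv g0 ++ g).
  - by rewrite mem_cat; apply/orP; right; rewrite g0E gE; apply/allpairsP; exists (z0, z).
  - by left => q Pq pq; rewrite H // l0 nmul0r nmulr0.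
  - right; exists (reduce (winv g0 ++ g)); split => //.
      apply: contraNneq gg0 => k0.
      have := reduce_cancel' g0 g; rewrite -reduce_catr k0 cats0.
      by rewrite g0E gE !(reduce_id (sorted_reduce _)) => ->.
    by move=> q Pq pq; rewrite H // lE lmulM pq.
have [Ks [KP KE]] : exists Ks : seq (K * seq L),
    (forall i, i \in Ks -> i.2 != [::] /\ cpath (inl v) (winv i.2)) /\
    forall q, isproj q -> p ** q = q ->
      \sum_(g <- [seq g <- Gs | g != g0]) d g *: (q ** (b ** lmul g q)) =
      \sum_(i <- Ks) i.1 *: (q ** lmul i.2 q).
  have : forall g, g \in [seq g <- Gs | g != g0] -> g \in Gs /\ g != g0.
    by move=> g; rewrite mem_filter => /andP[].
  elim: [seq _ <- Gs | _] => [|g Hs IH] HG.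
    by exists [::]; split => // q _ _; rewrite !big_nil.
  have [|Ks [KP KE]] := IH; first by move=> h hH; apply: HG; rewrite inE hH orbT.
  have [gG gg0] := HG _ (mem_head _ _).
  have [t0|[k [k0 ok tE]]] := term _ gG gg0.
    by exists Ks; split => // q Pq pq; rewrite big_cons t0 // scaler0 add0r KE.
  exists ((d g, k) :: Ks); split.
    by move=> i; rewrite inE => /orP[/eqP->|/KP].
  by move=> q Pq pq; rewrite !big_cons tE // KE.
exists b, (d g0), Ks; split => // q Pq pq.
have aq : a ** q = \sum_(g <- Gs) d g *: lmul g q.
  rewrite -[in LHS]pq nmulA aE sE nmul_suml; apply: eq_bigr => g _.
  by rewrite -nscalerAl lmulM pq.
rewrite -!nmulA aq !nmul_sumr (bigD1_seq g0) //= -KE // big_filter; congr (_ + _).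
  rewrite -!nscalerAr; congr (_ *: _); rewrite /b -rproj_winv; last exact: (qv q Pq pq).2.
  rewrite -[X in _ ** (_ ** X)]pq (nmulA (rproj _ _)) -(proj_comm Pp (proj_rproj _ _ _)) pg0 pq.
  exact: Pq.2.
by apply: eq_bigr => g _; rewrite -!nscalerAr.
Qed.

Lemma rmon_cat v u w : wpath v u -> rmon v (u ++ w) = rmon v u ** rmon (wend v u) w.
Proof.
move=> pu; elim/last_ind: w => [|w y IH]; first by rewrite cats0 rmon_nil rmon_wend.
by rewrite -rcons_cat !rmon_rcons IH nmulA.
Qed.

Lemma rproj_cat v u w : wpath v u ->
  rproj v (u ++ w) = rmon v u ** rproj (wend v u) w ** star (rmon v u).
Proof. by move=> pu; rewrite !rprojE rmon_cat // starM !nmulA. Qed.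

Lemma isproj_vt v p : isproj p -> p ** rproj v [::] = p -> p ** vt v = p /\ vt v ** p = p.
Proof.
move=> Pp; rewrite rproj_nil => pv; split => //.
by rewrite -(rproj_nil conj v) -(proj_comm Pp (proj_rproj _ _ _)) rproj_nil.
Qed.

(** A path k that is not a loop at v gives p k p = 0 by its end vertices. For a loop, some t in T is
    moved out of the closure by k or its inverse; orthogonality to E of the moved word z forces q k
    q = 0. The reduction of z serves as u unless it is not C-separated, and then E(z) is already
    0. *)
Lemma isotropy_kill v T p k : tree v T -> isproj p ->
  (forall w, T (v, w) -> p ** rproj v w = p) -> k != [::] -> cpath (inl v) (winv k) ->
  p ** lmul k p = 0 \/ exists u, [/\ cpath (inl v) u, ~ T (v, strip u) &
    forall q, isproj q -> q ** p = q -> q ** rproj v u = 0 -> q ** lmul k q = 0].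
Proof.
move=> tT Pp pT k0 ok; have pk := cpath_wpath ok; rewrite /= in pk.
have [pv vp] := isproj_vt Pp (pT _ (tree_nil tT)).
set m := mon k v.
have mE : m = star (rmon v (winv k)) by rewrite /rmon winvK starK.
have [ek|ek] := eqVneq (wend v (winv k)) v; last first.
  left; rewrite -(mon_mul k vp) -/m mE -(rmon_wend conj pk) starM star_vt.
  rewrite -{1}pv -!nmulA (nmulA (vt v)) vtM eq_sym (negPf ek).
  by rewrite nmul0r nmulr0.
have [pk' ek'] := wpath_winv pk; rewrite winvK ek in pk' ek'.
suff [t [z [Tt pz nz H]]] : exists t (z : seq L), [/\ T (v, t), wpath v z, ~ tclos v T (reduce z) &
    forall q, isproj q -> q ** p = q -> q ** rproj v z = 0 -> q ** lmul k q = 0].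
  have [oz|noz] := boolP (cpath (inl v) (reduce z)).
    right; exists (reduce z); split => // [Tz|q Pq qp qz]; first exact: nz.
    by apply: H => //; rewrite -(rproj_reduce conj pz) rproj_comm nmulA qz nmul0r.
  left; apply: H => //; first exact: Pp.2.
  by rewrite -(rproj_reduce conj pz) (rproj_eq0 conj (sorted_reduce _) noz) !nmulr0.
have wk0 : winv k != [::] by rewrite winv_eq0.
have [t Tt nz] := trivial_isotropy tT wk0 ok ek.
have pt : wpath v t by exact: (cpath_wpath (tree_ok tT Tt)).
have qt q : q ** p = q -> q ** rproj v t = q by move=> qp; rewrite -qp -nmulA pT.
have mq q : isproj q -> q ** p = q -> lmul k q = m ** q.
  move=> Pq qp; rewrite mon_mul //.
  by apply: (isproj_vt Pq _).2; rewrite -qp -nmulA pT //; exact: tree_nil.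
case: nz => nz; rewrite ?winvK in nz.
  exists t, (winv k ++ t); split => //; first by rewrite wpath_cat pk ek.
  (* Intertwining: since q <= E(t), one gets q m q = q E(t) m q = q m E(z) q = 0. *)
  have mz : m ** rproj v (winv k ++ t) = rproj v t ** m.
    rewrite rproj_cat // ek -mE (_ : rmon v _ = star m); last by rewrite mE starK.
    rewrite !nmulA -(bicomm_comm_sgelt (@bicomm_rproj K conj G v t) (sgelt_mon conj k v)).
    by rewrite -nmulA mon_star_mon.
  move=> q Pq qp qz; rewrite (mq _ Pq qp) -{1}(qt _ qp) -!nmulA (nmulA (rproj v t)) -mz.
  by rewrite -!nmulA -(proj_comm Pq (proj_rproj _ _ _)) qz !nmulr0.
exists t, (k ++ t); split => //; first by rewrite wpath_cat pk' ek'.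
set r := rmon v k.
(* The mirror case: q r q = q r E(t) q = q E(z) r q = 0. *)
have zr : rproj v (k ++ t) ** r = r ** rproj v t.
  have := bicomm_comm_sgelt (@bicomm_rproj K conj G v t) (sgelt_star (sgelt_rmon conj v k)).
  rewrite starK -/r => H.
  by rewrite rproj_cat // ek' -/r -!nmulA H !nmulA rmonK.
have mr : vt v ** m = r.
  by rewrite -[r](rmon_wend conj pk') ek' rmon_mul.
move=> q Pq qp qz; rewrite (mq _ Pq qp).
have [qv vq] : q ** vt v = q /\ vt v ** q = q.
  by apply: isproj_vt Pq _; rewrite -qp -nmulA pT //; exact: tree_nil tT.
rewrite -{1}qv -nmulA (nmulA (vt v)) mr -[X in r ** X](qt _ qp).
rewrite (proj_comm Pq (proj_rproj _ _ _)) (nmulA r) -zr -nmulA nmulA qz nmul0r //.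
Qed.

(** The sum of the vertices at which the monomials of a end is a right unit for a. *)
Lemma local_unit a : a <> 0 -> exists v, a ** vt v <> 0.
Proof.
move=> a0; apply: contrapT => H; apply: a0; have [s aE] := mspan_all a.
have av v : a ** vt v = 0 by apply: contrapT => n0; apply: H; exists v.
pose vs := undup [seq i.2.2 | i <- s].
have -> : a = a ** (\sum_(v <- vs) vt v).
  rewrite {1}aE [in RHS]aE nmul_suml; apply: eq_big_seq => i si.
  rewrite -nscalerAl nmul_sumr (bigD1_seq i.2.2) ?undup_uniq //=; last first.
    by rewrite mem_undup; apply/mapP; exists i.
  rewrite mon_vt eqxx big1 ?addr0 // => v iv.
  by rewrite mon_vt eq_sym (negPf iv).
by rewrite nmul_sumr big1.
Qed.

Lemma admissible1 v : admissible v [set (v, [::])] [::].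
Proof. by split => //; exact: tree1. Qed.

Lemma tproj1 v : tproj v [set (v, [::])] [::] = vt v.
Proof. exact: eT1. Qed.

(** Loops are removed one at a time with T fixed: p k p = 0 persists for every smaller
    projection. *)
Lemma kill_all v T F (Ks : seq (K * seq L)) : admissible v T F ->
  (forall i, i \in Ks -> i.2 != [::] /\ cpath (inl v) (winv i.2)) ->
  exists F', [/\ admissible v T F', tproj v T F ** tproj v T F' = tproj v T F' &
    forall i, i \in Ks -> tproj v T F' ** lmul i.2 (tproj v T F') = 0].
Proof.
move=> aTF; have tT := admissible_tree aTF; elim: Ks => [|i Ks IH] HK.
  by exists F; split => //; exact: (tproj_proj conj F tT).2.
have [|F1 [s1 le1 k1]] := IH; first by move=> j jK; apply: HK; rewrite inE jK orbT.
have [i0 oi] := HK _ (mem_head _ _).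
have P1 := tproj_proj conj F1 tT.
have [] := isotropy_kill tT P1 (fun w => @tproj_pos _ conj _ _ _ F1 tT w) i0 oi.
  move=> ki; exists F1; split => //.
  by move=> j; rewrite inE => /orP[/eqP->|/k1].
move=> [u [ou nu H]]; exists (rcons F1 u).
have P2 := tproj_proj conj (rcons F1 u) tT.
have le2 := tproj_rconsr conj F1 tT u; have le2' := tproj_rconsl conj F1 tT u.
split.
- exact: admissible_rcons.
- by rewrite -le2' nmulA le1.
- move=> j; rewrite inE => /orP[/eqP->|/k1 k1j].
    by apply: H => //; apply: tproj_neg => //; rewrite mem_rcons mem_head.
  rewrite -{1}le2 -[X in lmul _ X]le2' -lmulM -!nmulA (nmulA (tproj v T F1)) k1j.
  by rewrite nmul0r nmulr0.
Qed.

Lemma ideal_tproj a : a <> 0 -> exists v T F b c, admissible v T F /\ b ** a ** c = tproj v T F.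
Proof.
move=> /local_unit[v av]; have [l H] := divide_leading_word v a.
rewrite -tproj1 in av.
have [T [F [aTF aF dF]]] := decide_all l (admissible1 v) av.
have tT := admissible_tree aTF; have P := tproj_proj conj F tT.
have [//|[b [d [Ks [d0 HK E]]]]] := H _ P (tproj_vt conj F tT) dF.
have [F' [s' le' k']] := kill_all aTF HK.
have P' := tproj_proj conj F' tT.
exists v, T, F', (d^-1 *: (tproj v T F' ** b)), (tproj v T F'); split => //.
rewrite -!nscalerAl -(nmulA (tproj v T F')) E // big1_seq ?addr0 ?scalerA ?mulVf ?scale1r //.
by move=> i /andP[_ iK]; rewrite k' // scaler0.
Qed.

End Uniqueness.

(** * A representation on the closure of a tree *)

Section Model.
Variables (K : fieldType) (conj : {rmorphism K -> K}).
Hypothesis conjK : involutive conj.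
Variable G : sepGraph.
Notation V := (vert G).
Notation E := (edge G).
Notation L := (letter G).
Variables (v : V) (T : set (gpath G)).
Hypothesis tT : tree v T.
Notation A := (cohn_ab conj G).
Notation C := (cohn conj G).
Notation tm := (term K (V + E)%type).
Notation fn := (seq L -> K).
Implicit Types (x y z : L) (w k h : seq L) (f g : fn).

(* [k] indexes the basis vector at the point whose inverse is a word of the
   closure of T; a letter y maps the vector at k to the one at the reduced
   form of yk, provided that this is still an index. *)
Definition idx k := `[< tclos v T (winv k) >].

Definition isrc k := if k is y :: _ then lsrc y else v.

Definition act_ok y k := [&& idx k, isrc k == lsrc y & idx (rcancel (linv y) k)].

(** Operators act on arbitrary functions of words by (y f)(k) = f(y^{-1} k), which moves the vector
    at h to the one at yh. *)
Definition act y f : fn := fun k => if act_ok y k then f (rcancel (linv y) k) else 0.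

Definition actv (u : V) f : fn := fun k => if idx k && (isrc k == u) then f k else 0.

Lemma idx_sorted k : idx k -> sorted (@nbt G) k.
Proof. by move=> /asboolP[/cpath_nbt]; rewrite sorted_nbt_winv. Qed.

Lemma idx_cons y k : idx (y :: k) -> idx k /\ isrc k = lrng y.
Proof.
move=> /asboolP H; split.
  by apply/asboolP; apply: tclos_lower tT _ H; rewrite winv_cons prefix_rcons.
case: H => + _; rewrite winv_cons cpath_rcons => /andP[_ /follows_src].
by case: k => [|z k] //; rewrite endst_winv /= lrng_linv.
Qed.

Lemma idx_nil : idx [::].
Proof. by apply/asboolP; split => //; exact: tree_nil tT. Qed.

Lemma idx_sep (e f : E) (Z : set E) k : sepU Z -> Z e -> Z f ->
  idx [:: inr e, inl f & k] -> False.
Proof.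
move=> ZC Ze Zf /asboolP[+ _]; rewrite !winv_cons !cpath_rcons endst_rcons.
move=> /andP[_ /and3P[_ _ /asboolP]]; apply.
by exists Z, f, e.
Qed.

Lemma idx_conflict (e f : E) (Z : set E) k : sepU Z -> Z e -> Z f ->
  idx (inr e :: k) -> idx (inr f :: k) -> e = f.
Proof.
move=> ZC Ze Zf /asboolP He /asboolP Hf; apply: contrapT => ef.
apply: (tclos_nc tT He Hf); rewrite !winv_cons; exists (winv k), Z, e, f.
by split=> //; split; exact: prefix_refl.
Qed.

Lemma isrc_wend k : idx k -> wend v (winv k) = isrc k.
Proof.
move=> _; case: k => // y k; rewrite winv_cons -cats1 wend_cat /=.
exact: lrng_linv.
Qed.

(** The inverse of ek is k^{-1} e^{-1}, and the closure is stable under appending inverse letters.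
    Hence e acts on every index with source r(e), which is the relation e^* e = r(e). *)
Lemma idx_inl (e : E) k : idx k -> isrc k = rng e -> idx (rcancel (inl e) k).
Proof.
move=> ik sk; case: k ik sk => [|y k] ik sk.
  apply/asboolP; have := tclos_rcons (e := e) tT (asboolW ik) (etrans (isrc_wend ik) sk).
  by rewrite reduce_id.
rewrite /rcancel; case: eqVneq => [_|ye]; first by have [] := idx_cons ik.
apply/asboolP; have := tclos_rcons (e := e) tT (asboolW ik) (etrans (isrc_wend ik) sk).
rewrite reduce_id; first by rewrite [in X in _ -> X]winv_cons.
have -> : rcons (winv (y :: k)) (inr e) = winv (inl e :: y :: k) by rewrite [RHS]winv_cons.
by rewrite sorted_nbt_winv /=; have /= -> := idx_sorted ik; rewrite /nbt ye.
Qed.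

Lemma isrc_rcancel y k : idx k -> isrc k = lrng y -> isrc (rcancel y k) = lsrc y.
Proof.
case: k => // z k ik sk; rewrite /rcancel; case: eqVneq => [zy|//].
by have [_ ->] := idx_cons ik; rewrite zy lrng_linv.
Qed.

Lemma act_okV y k : act_ok y k -> act_ok (linv y) (rcancel (linv y) k) /\
  rcancel y (rcancel (linv y) k) = k.
Proof.
case/and3P => ik /eqP sk ik'; have rk := rcancelK y (idx_sorted ik).
split => //; rewrite /act_ok ik' linvK rk ik andbT /=.
by rewrite isrc_rcancel ?eqxx // lrng_linv.
Qed.

Lemma actv_act y f : actv (lsrc y) (act y f) = act y f.
Proof.
apply/funext => k; rewrite /actv /act; case: ifPn => //; rewrite /act_ok.
by case: (idx k) => //= /negPf->.
Qed.

Lemma act_actv y f : act y (actv (lrng y) f) = act y f.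
Proof.
apply/funext => k; rewrite /actv /act; case: ifP => // H.
have [/and3P[-> /eqP -> _] _] := act_okV H.
by rewrite lsrc_linv eqxx.
Qed.

Lemma actv_actv (u u' : V) f : actv u (actv u' f) = if u == u' then actv u f else fun=> 0.
Proof.
apply/funext => k; rewrite /actv; case: (eqVneq u u') => [->|uu'] /=.
  by case: (_ && _).
by case: ifP => // /andP[_ /eqP->]; rewrite (negPf uu') andbF.
Qed.

(** For distinct edges a nonzero value would need an index beginning with e^{-1} e' or e'^{-1} e,
    against C-separation, or two indices e^{-1} h and e'^{-1} h, whose inverses conflict. *)
Lemma act_sep (e e' : E) (Z : set E) f : sepU Z -> Z e -> Z e' ->
  act (inr e) (act (inl e') f) = if e == e' then actv (rng e) f else fun=> 0.
Proof.
move=> ZC Ze Ze'; apply/funext => k; case: eqVneq => [<-|ee'].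
  rewrite /act /actv.
  have [/andP[ik /eqP sk]|H] := boolP (idx k && (isrc k == rng e)).
    have ok : act_ok (inr e) k by rewrite /act_ok ik sk eqxx idx_inl.
    by have [ok' rk] := act_okV ok; rewrite ok ok' /= rk.
  rewrite /act_ok; case: (idx k) H => //=; case: (_ == _) => //.
rewrite /act; case: ifP => // /and3P[ik _ ik1]; case: ifP => // /and3P[_ _ ik2].
exfalso; rewrite /= in ik1 ik2.
case: k ik ik1 ik2 => [|y k] ik ik1 ik2.
  rewrite /= in ik2; move: ik2; case: eqP => [[/eqP]|_]; first by rewrite (negPf ee').
  by move/(idx_sep ZC Ze' Ze).
move: ik1 ik2; rewrite {1 3}/rcancel; case: eqVneq => [yE ik1|ye ik1].
  case: k ik ik1 => [|z k] ik ik1.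
    by rewrite yE in ik; move/(idx_conflict ZC Ze Ze' ik)/eqP; rewrite (negPf ee').
  rewrite /rcancel; case: eqVneq => [zE _|_].
    by move: ik; rewrite yE zE; exact: idx_sep Ze Ze'.
  by rewrite yE in ik; move/(idx_conflict ZC Ze Ze' ik)/eqP; rewrite (negPf ee').
rewrite /rcancel; case: eqP => [[/eqP]|_]; first by rewrite (negPf ee').
exact: idx_sep Ze' Ze.
Qed.

(** No adjoint is available for operators on all functions, so a term and its adjoint are evaluated
    together. The flag selects the adjoint, which reverses products and conjugates scalars, and
    [TStar] flips it. *)
Fixpoint ev (b : bool) (t : tm) (f : fn) : fn :=
  match t with
  | TGen (inl u) => actv u f
  | TGen (inr e) => act (if b then inr e else inl e) f
  | TZero => fun=> 0
  | TAdd t1 t2 => fun k => ev b t1 f k + ev b t2 f k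
  | TOpp t1 => fun k => - ev b t1 f k
  | TScale a t1 => fun k => (if b then conj a else a) * ev b t1 f k
  | TMul t1 t2 => if b then ev b t2 (ev b t1 f) else ev b t1 (ev b t2 f)
  | TStar t1 => ev (~~ b) t1 f
  end.

Lemma act_lin y (a : K) f g : act y (fun k => a * f k + g k) = fun k => a * act y f k + act y g k.
Proof. by apply/funext => k; rewrite /act; case: ifP => // _; rewrite mulr0 addr0. Qed.

Lemma actv_lin u (a : K) f g :
  actv u (fun k => a * f k + g k) = fun k => a * actv u f k + actv u g k.
Proof. by apply/funext => k; rewrite /actv; case: ifP => // _; rewrite mulr0 addr0. Qed.

Lemma ev_lin b t (a : K) f g :
  ev b t (fun k => a * f k + g k) = fun k => a * ev b t f k + ev b t g k.
Proof.
elim: t b f g => [[u|e]||t IHt u IHu|t IH|c t IH|t IHt u IHu|t IH] b f g /=.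
- exact: actv_lin.
- exact: act_lin.
- by apply/funext => k; rewrite mulr0 addr0.
- by apply/funext => k; rewrite IHt IHu mulrDr addrACA.
- by apply/funext => k; rewrite IH opprD mulrN.
- by apply/funext => k; rewrite IH mulrDr !mulrA (mulrC _ a).
- by case: b; rewrite ?IHt ?IHu ?IHt.
- exact: IH.
Qed.

Lemma evD b t f g : ev b t (fun k => f k + g k) = fun k => ev b t f k + ev b t g k.
Proof.
rewrite (_ : (fun k => f k + g k) = (fun k => 1 * f k + g k)).
  by rewrite ev_lin; apply/funext => k; rewrite mul1r.
by apply/funext => k; rewrite mul1r.
Qed.

Lemma ev0 b t : ev b t (fun=> 0) = fun=> 0.
Proof.
have := ev_lin b t (-1) (fun=> 0) (fun=> 0).
rewrite (_ : (fun k : seq L => _) = (fun=> 0)); last by apply/funext => k; rewrite mulr0 addr0.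
by move=> {1}->; apply/funext => k; rewrite mulN1r addNr.
Qed.

Lemma evZ b t (a : K) f : ev b t (fun k => a * f k) = fun k => a * ev b t f k.
Proof.
rewrite (_ : (fun k => a * f k) = (fun k => a * f k + (fun=> 0) k)).
  by rewrite ev_lin ev0; apply/funext => k; rewrite addr0.
by apply/funext => k; rewrite addr0.
Qed.

(** Each relation is checked together with its adjoint; the scalar axioms use that [conj] is an
    involutive ring morphism. *)
Lemma ev_cong t u : cong conj (@cohn_rel K G) t u -> forall b f, ev b t f = ev b u f.
Proof.
elim=> {t u}.
- move=> t u []; rewrite /=.
  + by [].
  + move=> u' w; case=> f.
      by rewrite actv_actv eq_sym; case: eqVneq => [->|].
    by rewrite actv_actv; case: eqVneq.
  + move=> e [] f; first exact: (act_actv (inr e)).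
    exact: (actv_act (inl e)).
  + move=> e [] f; first exact: (actv_act (inr e)).
    exact: (act_actv (inl e)).
  + move=> e [] f; first exact: (actv_act (inl e)).
    exact: (act_actv (inr e)).
  + move=> e [] f; first exact: (act_actv (inl e)).
    exact: (actv_act (inr e)).
  + move=> Z e f ZC Ze Zf [] g /=.
      by rewrite (act_sep _ ZC Zf Ze) eq_sym; case: eqVneq => [->|].
    by rewrite (act_sep _ ZC Ze Zf); case: eqVneq.
- by [].
- by move=> t u _ IH b f; rewrite IH.
- by move=> t u w _ IH1 _ IH2 b f; rewrite IH1 IH2.
- by move=> t u t' u' _ IH1 _ IH2 b f /=; rewrite IH1 IH2.
- by move=> t u _ IH b f /=; rewrite IH.
- by move=> a t u _ IH b f /=; rewrite IH.
- by move=> t u t' u' _ IH1 _ IH2 [] f /=; rewrite IH1 IH2.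
- by move=> t u _ IH b f /=; rewrite IH.
- by move=> t u w b f; apply/funext => k /=; rewrite addrA.
- by move=> t u b f; apply/funext => k /=; rewrite addrC.
- by move=> t b f; apply/funext => k /=; rewrite add0r.
- by move=> t b f; apply/funext => k /=; rewrite addNr.
- by move=> a c t [] f; apply/funext => k /=; rewrite mulrA ?rmorphM.
- by move=> t [] f; apply/funext => k /=; rewrite ?rmorph1 mul1r.
- by move=> a t u [] f; apply/funext => k /=; rewrite mulrDr.
- by move=> a c t [] f; apply/funext => k /=; rewrite ?rmorphD mulrDl.
- by move=> t u w [] f.
- by move=> t u w [] f //=; rewrite evD.
- by move=> t u w [] f //=; rewrite evD.
- by move=> a t u [] f //=; rewrite evZ.
- by move=> a t u [] f //=; rewrite evZ.
- by move=> t [] f.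
- by [].
- by move=> a t [] f; apply/funext => k /=; rewrite ?conjK.
- by move=> t u [] f.
Qed.

(** * Descent of the representation to the quotient by commutators *)

Definition rep (c : C) := ev false (repr c).

Lemma repE t f : rep (pclass conj (@cohn_rel K G) t) f = ev false t f.
Proof. exact: ev_cong (cong_repr _ _ _) _ _. Qed.

Lemma repM (a b : C) f : rep (a ** b) f = rep a (rep b f).
Proof. by elim/pclass_ind: a => t; elim/pclass_ind: b => u; rewrite [_ ** _]pmulE !repE. Qed.

Lemma repD (a b : C) f k : rep (a + b) f k = rep a f k + rep b f k.
Proof. by elim/pclass_ind: a => t; elim/pclass_ind: b => u; rewrite [_ + _ in LHS]paddE !repE. Qed.

Lemma repZ (c : K) (a : C) f k : rep (c *: a) f k = c * rep a f k.
Proof. by elim/pclass_ind: a => t; rewrite [_ *: _]pscaleE !repE. Qed.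

Lemma repB (a b : C) f k : rep (a - b) f k = rep a f k - rep b f k.
Proof. by rewrite repD -scaleN1r repZ mulN1r. Qed.

Lemma rep0 f k : rep 0 f k = 0.
Proof. by rewrite [0 in LHS]/(pclass _ _ _) repE. Qed.

(* If a acts by a partial bijection of the basis then [a ** star a] is diagonal,
   and diagonal operators commute. *)
Definition pbij (a : C) := exists phi psi : seq L -> option (seq L),
  [/\ forall k h, phi k = Some h <-> psi h = Some k,
      forall f k, rep a f k = oapp f 0 (phi k) &
      forall f k, rep (star a) f k = oapp f 0 (psi k)].

Lemma pbij_semigroup (a : C) : @cohn_semigroup K conj G a -> pbij a.
Proof.
apply; split; first split.
- move=> x y [p1 [q1 [H1 p1E q1E]]] [p2 [q2 [H2 p2E q2E]]].
  exists (fun k => obind p2 (p1 k)), (fun k => obind q1 (q2 k)); split.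
  + move=> k h; split.
      case p1k : (p1 k) => [m|//] /= p2m.
      by move/H2: p2m => -> /=; apply/H1.
    case q2h : (q2 h) => [m|//] /= q1m.
    by move/H1: q1m => -> /=; apply/H2.
  + by move=> f k; rewrite repM p1E; case: (p1 k) => //= m; rewrite p2E.
  + by move=> f k; rewrite starM repM q2E; case: (q2 k) => //= m; rewrite q1E.
- by move=> x [p [q [H pE qE]]]; exists q, p; rewrite starK; split => // k h; rewrite H.
- move=> _ [[u _ <-]|[e _ <-]].
    exists (fun k => if idx k && (isrc k == u) then Some k else None).
    exists (fun k => if idx k && (isrc k == u) then Some k else None); split.
    + by move=> k h; split; case: ifP => // H [<-]; rewrite H.
    + by move=> f k; rewrite repE /= /actv; case: ifP.
    + by move=> f k; rewrite [star _]pstarE repE /= /actv; case: ifP.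
  exists (fun k => if act_ok (inl e) k then Some (rcancel (inr e) k) else None).
  exists (fun k => if act_ok (inr e) k then Some (rcancel (inl e) k) else None); split.
  + move=> k h; split; case: ifP => // H [<-].
      by have [/= -> ->] := act_okV H.
    by have [/= -> ->] := act_okV H.
  + by move=> f k; rewrite repE /= /act; case: ifP.
  + by move=> f k; rewrite [star _]pstarE repE /= /act; case: ifP.
Qed.

Lemma rep_diag (a : C) : @cohn_semigroup K conj G a ->
  exists P : seq L -> bool, forall f k, rep (a ** star a) f k = if P k then f k else 0.
Proof.
move=> /pbij_semigroup[p [q [H pE qE]]]; exists (fun k => isSome (p k)) => f k.
by rewrite repM pE; case pk : (p k) => [m|] //=; rewrite qE (proj1 (H _ _) pk).
Qed.

Lemma rep_commutator_ideal (a : C) : commutator_ideal conj G a -> forall f k, rep a f k = 0.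
Proof.
have rz b g : (forall f k, rep b f k = 0) -> rep b g = fun=> 0.
  by move=> H; apply/funext => k.
have r0 b : rep b (fun=> 0) = fun=> 0 by exact: ev0.
move=> H; pose I := [set b : C | forall f k, rep b f k = 0].
suff : I a by [].
apply: H; split; first split; first split; first split.
- by move=> f k; exact: rep0.
- by move=> x y Ix Iy f k; rewrite repD Ix Iy addr0.
- by move=> c x Ix f k; rewrite repZ Ix mulr0.
- by move=> x y Iy f k; rewrite repM (rz y) // r0.
- by move=> x y Ix f k; rewrite repM Ix.
- move=> _ [x [y [/rep_diag[P HP] /rep_diag[Q HQ] ->]]] f k.
  rewrite /commutator repB (repM (x ** _)) (repM (y ** _)) HP !HQ HP.
  by case: (P k); case: (Q k); rewrite subrr.
Qed.

Definition repq (a : A) := rep (repr a).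

Notation q_ := (to_quo (commutator_ideal conj G)).

Lemma repqE (a : C) f : repq (q_ a) f = rep a f.
Proof.
apply/funext => k; apply/eqP; rewrite -subr_eq0 -repB; apply/eqP.
exact/rep_commutator_ideal/eqmodI_repr.
Qed.

Lemma repqM (a b : A) f : repq (a ** b) f = repq a (repq b f).
Proof. by elim/to_quo_ind: a => a; elim/to_quo_ind: b => b; rewrite -to_quoM !repqE repM. Qed.

Lemma repqB (a b : A) f k : repq (a - b) f k = repq a f k - repq b f k.
Proof.
elim/to_quo_ind: a => a; elim/to_quo_ind: b => b.
by rewrite -to_quoN -to_quoD !repqE repB.
Qed.

Lemma repq0 (a : A) : repq a (fun=> 0) = fun=> 0. Proof. exact: ev0. Qed.

Lemma repq_vt u f : repq (ab_vert conj u) f = actv u f.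
Proof. by rewrite repqE repE. Qed.

Lemma repq_lt y f : repq (letter_elt conj y) f = act y f.
Proof.
case: y => e; first by rewrite repqE repE.
by rewrite /= /ab_edge -to_quoS repqE [star _]pstarE repE.
Qed.

(** * Action on basis vectors *)

Definition delta h : fn := fun k => (k == h)%:R.

Lemma act_delta y h : idx h -> isrc h = lrng y ->
  act y (delta h) = if idx (rcancel y h) then delta (rcancel y h) else fun=> 0.
Proof.
move=> ih sh; apply/funext => k; rewrite /act /delta.
case: ifP => [/act_okV[/and3P[_ _]]|].
  rewrite linvK => + rk; rewrite rk => ik.
  have [<-|kh] := eqVneq (rcancel (linv y) k) h; first by rewrite rk ik eqxx.
  case: ifP => // _; case: eqVneq => // kE; case/eqP: kh.
  by have := rcancelK (linv y) (idx_sorted ih); rewrite linvK kE.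
move=> nok; case: ifP => // ir; case: eqVneq => // kE; move: nok.
have := rcancelK (linv y) (idx_sorted ih); rewrite linvK => rh.
by rewrite /act_ok kE ir rh ih isrc_rcancel // eqxx.
Qed.

Lemma repq_mon w : cpath (inl v) (winv w) ->
  repq (mon conj w v) (delta [::]) = if idx w then delta w else fun=> 0.
Proof.
elim: w => [_|y w IH].
  rewrite repq_vt idx_nil; apply/funext => k; rewrite /actv /delta.
  by have [->|_] := eqVneq k [::]; [rewrite idx_nil /= eqxx|rewrite if_same].
rewrite winv_cons cpath_rcons => /andP[ow nw].
rewrite [mon _ _ _]/(letter_elt conj y ** mon conj w v) repqM repq_lt IH //.
case: ifPn => [iw|niw]; last first.
  case: ifP => [/idx_cons[iw _]|_]; first by rewrite iw in niw.
  by apply/funext => k; rewrite /act; case: ifP.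
have sw : isrc w = lrng y.
  by move/follows_src: nw; case: (w) => [|z r] //; rewrite endst_winv /= lrng_linv.
rewrite act_delta //.
have -> // : rcancel y w = y :: w.
case: w nw {IH ow iw sw} => // z w; rewrite endst_winv /= /rcancel cstep_linv.
by move=> /cstep_nbt; rewrite /nbt eq_sym -(inj_eq (inv_inj (@linvK G))) linvK eq_sym; case: eqP.
Qed.

Lemma repq_rmon w : tclos v T w -> repq (rmon conj v w) (delta (winv w)) = delta [::].
Proof.
elim/last_ind: w => [_|w y IH].
  rewrite rmon_nil repq_vt; apply/funext => k; rewrite /actv /delta.
  by have [->|_] := eqVneq k [::]; [rewrite idx_nil /= eqxx|rewrite if_same].
move=> tw; have tw' : tclos v T w by apply: tclos_lower tT _ tw; exact: prefix_rcons.
rewrite rmon_rcons repqM repq_lt winv_rcons act_delta //; last 1 first.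
  by apply/asboolP; rewrite winv_cons linvK winvK.
have -> : rcancel y (linv y :: winv w) = winv w by rewrite /= eqxx.
have -> : idx (winv w) by apply/asboolP; rewrite winvK.
exact: IH.
Qed.

(** The adjoint of w moves the vector at the empty word to the one at w^{-1}, if that is an index,
    and w moves it back; otherwise the result is 0. *)
Lemma repq_rproj w : cpath (inl v) w -> repq (rproj conj v w) (delta [::]) =
  if `[< tclos v T w >] then delta [::] else fun=> 0.
Proof.
move=> ow; rewrite rprojE star_rmon repqM repq_mon ?winvK // /idx winvK.
by case: ifP => [/asboolP/repq_rmon//|_]; exact: repq0.
Qed.

Lemma repq_eT : repq (eT conj T) (delta [::]) = delta [::].
Proof.
have [a [t [-> sP]]] := eT_factors conj tT.
have H b : b \in a :: t -> repq b (delta [::]) = delta [::].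
  move=> /sP[w [Tw _] ->]; rewrite repq_rproj; last exact: tree_ok Tw.
  by case: asboolP => // -[]; exact: tclos_tree.
have : repq a (delta [::]) = delta [::] by apply: H; exact: mem_head.
have {H} : forall b, b \in t -> repq b (delta [::]) = delta [::].
  by move=> b bt; apply: H; rewrite inE bt orbT.
elim: t a {sP} => //= b t IH a H ra; apply: IH => [c ct|].
  by apply: H; rewrite inE ct orbT.
by rewrite repqM H ?mem_head.
Qed.

Lemma tproj_neq0 F : admissible v T F -> tproj conj v T F <> 0.
Proof.
move=> [_ sF]; suff H : repq (tproj conj v T F) (delta [::]) = delta [::].
  move=> p0; have := congr1 (fun f : fn => f [::]) H; rewrite p0.
  have -> : 0 = q_ 0 by [].
  by rewrite repqE rep0 /delta eqxx => /esym/eqP; rewrite oner_eq0.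
rewrite /tproj; have := repq_eT; elim: F (eT conj T) sF => //= u F IH a sF ra.
apply: IH => [w wF|]; first by apply: sF; rewrite inE wF orbT.
have [ou nu] := sF _ (mem_head _ _).
apply/funext => k; rewrite repqB ra repqM repq_rproj //.
by case: asboolP => [[_ /nu]//|_]; rewrite repq0 subr0.
Qed.

End Model.

(** * The idempotents ecb(T) *)

Section Ecb.
Variables (K : fieldType) (conj : K -> K) (G : sepGraph).
Notation V := (vert G).
Notation E := (edge G).
Notation L := (letter G).
Notation A := (cohn_ab conj G).
Implicit Types (x y z : L) (w u g : seq L) (a b c p q : A).
Notation vt := (ab_vert conj).
Notation lt := (letter_elt conj).
Notation rproj := (rproj conj).
Notation mon := (mon conj).
Notation rmon := (rmon conj).
Notation tproj := (tproj conj).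

Lemma NT_strip v (T : set (gpath G)) w : tree v T -> NT T (v, w) ->
  [/\ cpath (inl v) w, strip w = w & ~ T (v, strip w)].
Proof.
move=> tT /(NT_tree tT)[t [xs [y [[[wE] _ ow nTw] _]]]].
have sw : strip w = w by rewrite wE strip_rconsl.
by rewrite sw.
Qed.

Section FixedTree.
Variables (v : V) (T : set (gpath G)).
Hypotheses (tT : tree v T) (fN : finite_set (NT T)).

Definition NTseq : seq (seq L) := [seq p.2 | p : gpath G <- fset_set (NT T)].

Lemma NTseqP w : w \in NTseq <-> NT T (v, w).
Proof.
split; last by move=> Nw; apply/mapP; exists (v, w); rewrite // in_fset_set // inE.
move=> /mapP[p + ->]; rewrite in_fset_set // inE => Np.
by have [t [xs [y [[pE _ _ _] _]]]] := NT_tree tT Np; rewrite pE in Np *.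
Qed.

(** In a factor E(lambda_0) - E(lambda) the first term is absorbed by e(T), since lambda_0 lies in
    T. *)
Lemma ecbE : ecb conj T = tproj v T NTseq.
Proof.
rewrite /ecb /eTF [nprod _]/= /tproj /NTseq.
have [[De ee] le _] := eT_glb conj tT.
suff H (s : seq (gpath G)) a : a ** eT conj T = a -> (forall p : gpath G, p \in s -> NT T p) ->
    foldl nmul a [seq path_proj conj (part0 T p) - path_proj conj p | p : gpath G <- s] =
    foldl (fun a u => a - a ** rproj v u) a [seq p.2 | p : gpath G <- s].
  by apply: H => // p; rewrite in_fset_set // inE.
elim: s a => //= p s IH a ae HN.
have Np := HN _ (mem_head _ _).
have [t [xs [y [[pE _ op _] _]]]] := NT_tree tT Np.
have p0 := part0_tree Np.
have [w0 p0E] : exists w0, part0 T p = (v, w0).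
  by have := tree_src tT p0; case: (part0 T p) => v0 w0 /= ->; exists w0.
rewrite p0E in p0 *.
have -> : path_proj conj p = rproj v p.2.
  by rewrite {1}pE path_projE ?pE //; move: (cpath_wpath op); rewrite pE.
rewrite path_projE; last exact: (cpath_wpath (tree_ok tT p0)).
rewrite nmulBr (_ : a ** rproj v w0 = a); last by rewrite -ae -nmulA le.
apply: IH; last by move=> p' p's; apply: HN; rewrite inE p's orbT.
by rewrite nmulBl ae -nmulA -(bicomm_comm De (@bicomm_rproj K conj G v p.2)) nmulA ae.
Qed.

Lemma ecb_proj : isproj (ecb conj T).
Proof. by rewrite ecbE; exact: tproj_proj. Qed.

Lemma ecb_pos w : cpath (inl v) w -> T (v, strip w) -> ecb conj T ** rproj v w = ecb conj T.
Proof. by rewrite ecbE; exact: tproj_tclos. Qed.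

Lemma ecb_NT w : NT T (v, w) -> ecb conj T ** rproj v w = 0.
Proof. by rewrite ecbE => Nw; apply: tproj_neg => //; exact/NTseqP. Qed.

(** After stripping, a word outside the closure conflicts with T or extends a neighbour. So this
    projection decides every path and cannot be split further. *)
Lemma ecb_neg w : cpath (inl v) w -> ~ T (v, strip w) -> ecb conj T ** rproj v w = 0.
Proof.
move=> ow nw; rewrite -rproj_strip //.
have os : cpath (inl v) (strip w).
  by have /prefixP[r wE] := prefix_strip w; move: ow; rewrite {1}wE cpath_cat => /andP[].
have [[t [Tt tw]]|nc] := pselect (exists t, T (v, t) /\ conflict t (strip w)).
  by rewrite ecbE (tproj_conflict _ _ tT Tt tw).
have [t Tt|w' Nw' w'w] := neighbor_prefix tT os (stripK w) nw _.
  by move=> tw; apply: nc; exists t.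
by rewrite -(rproj_prefix _ _ w'w) rproj_comm nmulA ecb_NT // nmul0r.
Qed.

Lemma ecb_decides w : cpath (inl v) w -> decides v (ecb conj T) w.
Proof.
by move=> ow; have [Tw|nTw] := pselect (T (v, strip w)); [left; exact: ecb_pos|right; exact: ecb_neg].
Qed.

Lemma ecb_vt : vt v ** ecb conj T = ecb conj T.
Proof. by rewrite ecbE; exact: tproj_vt. Qed.

Lemma ecb_isotropy (k : seq L) : k != [::] -> cpath (inl v) (winv k) ->
  ecb conj T ** lmul k (ecb conj T) = 0.
Proof.
move=> k0 ok; have P := ecb_proj.
have [|//|[u [ou nu H]]] := isotropy_kill tT P _ k0 ok.
  by move=> w Tw; apply: ecb_pos; [exact: (tree_ok tT Tw)|exact: (tree_lower tT (prefix_strip w) Tw)].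
by apply: H => //; [exact: P.2|exact: ecb_neg].
Qed.

(** With e the projection of T, division by a word applies without shrinking e, and every loop k
    already satisfies e k e = 0. Thus e b a e is a nonzero multiple of e, which makes A e
    minimal. *)
Lemma ecb_recover a : a ** ecb conj T <> 0 -> exists b, b ** (a ** ecb conj T) = ecb conj T.
Proof.
move=> ae; have [l H] := divide_leading_word v a.
have P := ecb_proj; have [/ae[]|[b [d [Ks [d0 HK E]]]]] := H _ P ecb_vt (fun u _ => @ecb_decides u).
exists (d^-1 *: (ecb conj T ** b)).
rewrite -nscalerAl -(nmulA (ecb conj T)) (nmulA b) nmulA E //; last exact: P.2.
rewrite big1_seq ?addr0 ?scalerA ?mulVf ?scale1r // => i /andP[_ /HK[i0 oi]].
by rewrite ecb_isotropy // scaler0.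
Qed.

Lemma ecb_soc : soc A (ecb conj T).
Proof.
have ee := ecb_proj.2.
have [->|/eqP e0] := eqVneq (ecb conj T) 0; first exact: soc0.
apply: (@soc_minimal _ _ _ [set y | exists a, y = a ** ecb conj T]); last by exists (ecb conj T).
split; first exact: left_ideal_principal.
  move=> L0; apply: e0.
  by have : [set y | exists a, y = a ** ecb conj T] (ecb conj T) by [exists (ecb conj T)]; rewrite L0.
move=> I' II' I'L; have [|nz] := pselect (forall y : A, I' y -> y = 0).
  move=> I0; left; apply/seteqP; split => // _ ->.
  by have [[+ _ _] _] := II'.
right; apply/seteqP; split => // _ [a ->].
have [z [I'z z0]] : exists z : A, I' z /\ z <> 0.
  by apply: contrapT => H; apply: nz => y I'y; apply: contrapT => y0; apply: H; exists y.
have [c zE] := I'L _ I'z; rewrite zE in z0 I'z.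
have [b be] := ecb_recover z0.
have [_ IM] := II'.
by apply: (IM); rewrite -be; exact: IM.
Qed.

(** Let wy be a neighbour and X the block of y. All wx with x in X are neighbours, so X is finite,
    and e = e w q_X w^* because e <= E(w) and e E(wx) = 0. *)
Lemma ecb_idealQ : NT T !=set0 -> idealQ conj G (ecb conj T).
Proof.
case=> p Np; have [t [xs [y [[pE Tt op _] _]]]] := NT_tree tT Np.
set w := t ++ _ in pE; rewrite pE in Np op.
have [Z ZC Zy] := sep_ex y; have ZU : sepU Z by exists (src y).
have NZ (x : E) : Z x -> NT T (v, rcons w (inl x)) by move=> Zx; exact: (NT_sibling tT ZU Zy Zx Np).
have fZ : finite_set Z.
  apply: (@sub_finite_set _ _ ((fun x : E => (v, rcons w (inl x)) : gpath G) @^-1` NT T)).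
    by move=> x /NZ.
  by apply: finite_preimage fN => x x' _ _ [/rcons_inj[]].
move: op; rewrite /= cpath_rcons => /andP[ow /follows_src /= sy].
have Tw : T (v, strip w).
  by rewrite strip_cat_inr; exact: (tree_lower tT (prefix_strip t) Tt).
have [[_ QMl] QMr] := ideal_gen_ideal
  [set q : A | exists v Z, [/\ sep v Z, finite_set Z & q = qX conj v Z]].
have -> : ecb conj T = ecb conj T ** (rmon v w ** qX conj (src y) Z ** star (rmon v w)).
  rewrite /qX nmulBr nmulBl nmulBr.
  have -> : vt (src y) = vt (wend v w) by rewrite sy stvert_endst.
  rewrite rmon_wend; last exact: (cpath_wpath ow).
  rewrite -rprojE ecb_pos // nmul_sumr nmul_suml nmul_sumr big1_seq ?subr0 // => x /andP[_].
  rewrite in_fset_set // inE => Zx.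
  by have := ecb_NT (NZ _ Zx); rewrite rproj_rcons.
apply: (QMl); apply: (QMr); apply: (QMl); apply: sub_ideal_gen.
by exists (src y), Z.
Qed.

(* So [qX conj u Z] annihilates [ecb conj T] when T has no neighbours. *)
Lemma ecb_maximal_realises g (Z : set E) (u : V) : NT T = set0 -> sep u Z ->
  cpath (inl v) (winv g) -> T (v, strip (winv g)) -> wend v (winv g) = u ->
  exists2 x : E, Z x & lt (inl x) ** (lt (inr x) ** lmul g (ecb conj T)) = lmul g (ecb conj T).
Proof.
move=> N0 sZ og Tg eg; have ZU : sepU Z by exists u.
have [[x [Zx [g' gE]]]|ng] := pselect (exists x : E, Z x /\ exists g', g = inl x :: g').
  exists x => //; rewrite gE [lmul _ _]/(lt (inl x) ** lmul g' _).
  exact: (lt_linvKA (inl x)).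
have src_u (x : E) : Z x -> src x = u.
  move=> Zx; have [cov _ _] := sepP u.
  by have : (@src G @^-1` [set u]) x by rewrite -cov; exists Z.
have om (x : E) : Z x -> cpath (inl v) (rcons (winv g) (inl x)).
  move=> Zx; rewrite cpath_rcons og /=; move: eg ng; case: (g) => [|z g'] eg ng.
    by rewrite /= (src_u _ Zx) -eg.
  rewrite endst_winv /= /cstep; apply/andP; split.
    by rewrite lrng_linv /= (src_u _ Zx) -eg winv_cons -cats1 wend_cat /= lrng_linv.
  rewrite /csep /nbt linvK; apply/andP; split.
    by apply/eqP => zx; apply: ng; exists x; split => //; exists g'; rewrite zx.
  apply/negP => /asboolP[Z' [e' [f [Z'U Z'e Z'f ze [xf]]]]].
  rewrite -xf in Z'f; rewrite (sepU_eq Z'U ZU Z'f Zx) in Z'e.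
  by apply: ng; exists e'; split => //; exists g'; rewrite -[z]linvK ze.
have hit (x : E) : Z x -> T (v, rcons (winv g) (inl x)) ->
    lt (inl x) ** (lt (inr x) ** lmul g (ecb conj T)) = lmul g (ecb conj T).
  move=> Zx Tx; have := ecb_pos (om _ Zx); rewrite strip_rconsl => /(_ Tx).
  rewrite (proj_comm ecb_proj (proj_rproj _ _ _)) rproj_rcons.
  rewrite /rmon starK winvK; set m := mon g v => H.
  have mE : lmul g (ecb conj T) = m ** ecb conj T by rewrite mon_mul // ecb_vt.
  have C := sgelt_comm (sgelt_lt conj (inl x)) (sgelt_mon conj g v).
  rewrite mE -[in RHS]H -/m !nmulA; rewrite star_lt -/m !nmulA in C; rewrite -C.
  by rewrite -!nmulA (nmulA m) (nmulA (m ** _)) mon_star_mon.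
have [_ _ nZ] := sepP u; have [x0 Zx0] := nZ _ sZ.
have [T0|nT0] := pselect (T (v, rcons (winv g) (inl x0))); first by exists x0 => //; exact: hit.
(* Without neighbours, a word outside T conflicts with T; the branching edge on the side of T is the
   member of Z sought. *)
have [t [Tt tc]] : exists t, T (v, t) /\ conflict t (rcons (winv g) (inl x0)).
  apply: contrapT => nc.
  have [t Tt|w' + _] := neighbor_prefix tT (om _ Zx0) (strip_rconsl _ _) nT0 _.
    by move=> tc; apply: nc; exists t.
  by rewrite N0.
move: tc => [k [Z' [a [b [[Z'U Z'a Z'b ab] [ka /prefixP[r]]]]]]].
case/lastP: r => [|r z].
  rewrite cats0 => /rcons_inj[kE bE]; subst b k.
  rewrite (sepU_eq Z'U ZU Z'b Zx0) in Z'a.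
  by exists a => //; apply: hit => //; exact: (tree_lower tT ka Tt).
rewrite -rcons_cat => /rcons_inj[gE _].
have tg : tclos v T (winv g) by [].
exfalso; apply: (tclos_nc tT (tclos_tree tT Tt) tg).
exists k, Z', a, b; split => //; split => //; rewrite gE prefix_prefix //.
Qed.

(** The annihilator of A e is a two-sided ideal, so only q_X acting on g e, with g a reduced word,
    matters. Some x in X satisfies x x^* g e = g e, and the other edges of X are orthogonal to
    it. *)
Lemma idealQ_ecb0 q a : NT T = set0 -> idealQ conj G q -> q ** (a ** ecb conj T) = 0.
Proof.
move=> N0 Qq; move: a.
pose I := [set q : A | forall a, q ** (a ** ecb conj T) = 0].
suff : I q by [].
apply: Qq; split; first split; first split; first split.
- by move=> a; rewrite nmul0r.
- by move=> q1 q2 I1 I2 a; rewrite nmulDl I1 I2 addr0.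
- by move=> k q1 I1 a; rewrite -nscalerAl I1 scaler0.
- by move=> b q1 I1 a; rewrite -nmulA I1 nmulr0.
- by move=> q1 b I1 a; rewrite -nmulA (nmulA b) I1.
- move=> _ [u [Z [sZ fZ ->]]] a.
  have [s ->] := mspan_all a; rewrite nmul_suml nmul_sumr big1 // => i _.
  rewrite -nscalerAl -nscalerAr; set e := ecb conj T.
  have [->|iv] := eqVneq i.2.2 v; last first.
    by rewrite /e -ecb_vt (nmulA (mon _ _)) mon_vt (negPf iv) nmul0r nmulr0 scaler0.
  rewrite mon_mul; last exact: ecb_vt.
  have [|->|[-> og pg]] := @lmul_reduce _ _ _ v e i.2.1 ecb_proj ecb_vt.
  + by move=> r _ u' ou; exact: ecb_decides.
  + by rewrite nmulr0 scaler0.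
  set g := reduce _ in og pg *; set X := lmul g e.
  suff -> : qX conj u Z ** X = 0 by rewrite scaler0.
  have [Tg|nTg] := pselect (T (v, strip (winv g))); last first.
    by rewrite /X -pg ecb_neg // lmul0 nmulr0.
  have lX (x : E) : Z x -> lt (inr x) ** X = lt (inr x) ** (vt u ** X).
    move=> Zx; rewrite nmulA ltvt.
    have [cov _ _] := sepP u.
    have -> : lrng (inr x : L) = u.
      by have : (@src G @^-1` [set u]) x by rewrite -cov; exists Z.
    by rewrite eqxx.
  have XE : X = star (rmon v (winv g)) ** e.
    by rewrite /rmon starK winvK mon_mul // ecb_vt.
  have [eg|eg] := eqVneq (wend v (winv g)) u; last first.
    have vX : vt u ** X = 0.
      rewrite XE -(rmon_wend conj (cpath_wpath og)) starM star_vt !nmulA vtM eq_sym (negPf eg).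
      by rewrite !nmul0r.
    rewrite /qX nmulBl vX nmul_suml big1_seq ?subr0 // => x /andP[_].
    rewrite in_fset_set // inE => Zx.
    by rewrite -nmulA [_ ** X](lX _ Zx) vX !nmulr0.
  have vX : vt u ** X = X.
    by rewrite XE -(rmon_wend conj (cpath_wpath og)) starM star_vt !nmulA -[wend _ _]/(wend v _) eg vtM eqxx.
  have [x Zx xX] := ecb_maximal_realises N0 sZ og Tg eg.
  rewrite -/e -/X in xX.
  have xs : x \in fset_set Z by rewrite in_fset_set // inE.
  rewrite /qX nmulBl vX nmul_suml (bigD1_seq x xs (fset_uniq _)) /=.
  rewrite big1_seq ?addr0.
    by rewrite -nmulA xX subrr.
  move=> x' /andP[x'x]; rewrite in_fset_set // inE => Zx'.
  rewrite -nmulA -xX (nmulA (star _)) (@edge_sep _ _ _ Z) //; last by exists u.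
  by rewrite (negPf x'x) nmul0r nmulr0.
Qed.

End FixedTree.
End Ecb.

(** * The socle and the ideal Q *)

Section SocleIdeal.
Variables (K : fieldType) (conj : {rmorphism K -> K}).
Hypothesis conjK : involutive conj.
Variable G : sepGraph.
Notation V := (vert G).
Notation E := (edge G).
Notation A := (cohn_ab conj G).
Implicit Types (w u : seq (letter G)) (v : V) (a b c p q y z : A) (T : set (gpath G)).
Notation rproj := (rproj conj).
Notation tproj := (tproj conj).

(* Otherwise the projection [p = b ** y ** c] would be split by [e = rproj v w]
   into two nonzero parts, although [p = a ** (p ** e)] for some a by minimality. *)
Lemma minimal_corner (M : set A) y b c v T F w : minimal_left_ideal M -> M y ->
  admissible v T F -> b ** y ** c = tproj v T F -> NT T (v, w) -> tproj v T F ** rproj v w = 0.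
Proof.
move=> [LM M0 mM] My aTF byc Nw; have tT := admissible_tree aTF; have [_ MM] := LM.
have P := tproj_proj conj F tT; have [ow sw nTw] := NT_strip tT Nw.
set p := tproj v T F in byc P *; set e := rproj v w; apply: contrapT => pe.
have ep : e ** p = p ** e by rewrite (proj_comm P (proj_rproj _ _ _)).
pose s := e ** (b ** y).
have sc : s ** c = e ** p by rewrite /s -!nmulA (nmulA b) byc.
have Ms : M s by apply: (MM); exact: MM.
have es : e ** s = s by rewrite /s nmulA rproj_idem.
have [|z [a ->]||] := mM [set z | exists a, z = a ** s].
- exact: left_ideal_principal.
- exact: MM.
- move=> S0; apply: pe; rewrite -ep -sc.
  have : [set z | exists a, z = a ** s] s by exists e; rewrite es.
  by rewrite S0 => ->; rewrite nmul0r.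
move=> SM; have : M (b ** y) by exact: MM.
rewrite -SM => -[a bya].
have pa : p = a ** (p ** e) by rewrite -ep -sc nmulA -bya byc.
have pE : p ** e = p.
  by have := congr1 (fun z => z ** e) pa; rewrite -!nmulA rproj_idem -pa.
have sTF' : admissible v T (rcons F w) by exact: admissible_rcons.
apply: (tproj_neq0 conjK tT sTF').
by rewrite tproj_rcons -/p -/e pE subrr.
Qed.

Lemma minimal_ecb (M : set A) y : minimal_left_ideal M -> M y -> y <> 0 ->
  exists v T, [/\ tree v T, finite_set (NT T) & ideal_gen [set ecb conj T] y].
Proof.
move=> mM My y0; have [LM M0 minM] := mM; have [_ MM] := LM.
have [v [T [F [b [c [aTF byc]]]]]] := ideal_tproj y0.
have tT := admissible_tree aTF; have P := tproj_proj conj F tT.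
have kill w : NT T (v, w) -> tproj v T F ** rproj v w = 0.
  exact: minimal_corner mM My aTF byc.
(* Otherwise adding the neighbour to T would leave F admissible, and the cut projection would be
   nonzero. So N(T) is bounded by the finite list F. *)
have NF (p : gpath G) : NT T p -> exists2 u, u \in F & p = (v, strip u).
  move=> Np; have [t [xs [x [[pE Tt op nTp] nc]]]] := NT_tree tT Np.
  set r := t ++ _ in pE; rewrite pE /= in Np op nTp nc *.
  have sw := strip_rconsl r x.
  apply: contrapT => nF.
  have tT' := tree_ext tT op sw nc.
  have sT' : admissible v (T `|` Defs.down [set (v, rcons r (inl x))]) F.
    split => // u uF; have [_ sF] := aTF; have [ou nu] := sF _ uF; split => // -[//|].
    move=> /down1E[_ /= /prefixP[d]]; case/lastP: d => [|d l].
      by rewrite cats0 => ru; apply: nF; exists u => //; rewrite ru.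
    rewrite -rcons_cat => /rcons_inj[rE _]; apply: nu; rewrite -stripK.
    have ur : prefix (strip u) r by rewrite rE prefix_prefix.
    apply: (tree_lower tT (strip_mono ur)).
    by rewrite strip_cat_inr; exact: (tree_lower tT (prefix_strip t) Tt).
  by apply: (tproj_neq0 conjK tT' sT'); rewrite -(tproj_ext _ _ tT) // kill.
have fN : finite_set (NT T).
  apply: (@sub_finite_set _ _ [set` [seq (v, strip u) | u <- F]]); last exact: finite_seq.
  by move=> p /NF[u uF ->]; apply/mapP; exists u.
have Pe := ecb_proj conj tT fN.
have pe : tproj v T F = ecb conj T.
  apply: proj_anti => //.
    rewrite (ecbE conj tT fN); apply: tproj_glb => // [w|u /(NTseqP tT fN)/kill//].
    exact: tproj_pos.
  apply: tproj_glb => // [w Tw|u uF].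
    by apply: ecb_pos => //; [exact: (tree_ok tT Tw)|exact: (tree_lower tT (prefix_strip w) Tw)].
  by have [_ sF] := aTF; have [ou nu] := sF _ uF; exact: ecb_neg.
exists v, T; split => //; rewrite pe in byc.
set e := ecb conj T in Pe byc *; have ee := Pe.2.
have e0 : e <> 0 by rewrite /e -pe; exact: (tproj_neq0 conjK tT aTF).
(* By minimality M = A s, so y is a multiple of s and lies in the ideal generated by e. *)
pose s := e ** (b ** y).
have sc : s ** c = e by rewrite /s -nmulA byc.
have Ms : M s by apply: (MM); exact: MM.
have es : e ** s = s by rewrite /s nmulA ee.
have [|z [a ->]||SM] := minM [set z | exists a, z = a ** s].
- exact: left_ideal_principal.
- exact: MM.
- move=> S0; exfalso; apply: e0; rewrite -sc.
  have : [set z | exists a, z = a ** s] s by exists e; rewrite es.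
  by rewrite S0 => ->; rewrite nmul0r.
move: My; rewrite -SM => -[a ->].
have [[_ IMl] IMr] := ideal_gen_ideal [set e].
by apply: (IMl); apply: IMr; exact: sub_ideal_gen.
Qed.

Lemma idealQ_ideal : two_sided_ideal (idealQ conj G).
Proof. exact: ideal_gen_ideal. Qed.

Lemma two_sided_idealI (I J : set A) :
  two_sided_ideal I -> two_sided_ideal J -> two_sided_ideal (I `&` J).
Proof.
move=> [[[I0 ID IZ] IMl] IMr] [[[J0 JD JZ] JMl] JMr]; split; first split; first split => //.
- by move=> a b [Ia Ja] [Ib Jb]; split; [exact: ID|exact: JD].
- by move=> k a [Ia Ja]; split; [exact: IZ|exact: JZ].
- by move=> a b [Ib Jb]; split; [exact: IMl|exact: JMl].
- by move=> a b [Ib Jb]; split; [exact: IMr|exact: JMr].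
Qed.

Definition ecb_max : set A := [set e | exists v T, [/\ tree v T, NT T = set0 & e = ecb conj T]].

Lemma finite_NT0 T : NT T = set0 -> finite_set (NT T).
Proof. by move=> ->; exact: finite_set0. Qed.

(** A nonzero a would put a nonzero projection p in both ideals; the first annihilates the second,
    so p = p p = 0. *)
Lemma idealQ_ecb_max a : idealQ conj G a -> ideal_gen ecb_max a -> a = 0.
Proof.
move=> Qa Ja; apply: contrapT => a0.
have [v [T [F [b [c [aTF bac]]]]]] := ideal_tproj a0.
have tT := admissible_tree aTF; have P := tproj_proj conj F tT.
apply: (tproj_neq0 conjK tT aTF); rewrite -P.2.
have [[_ QMl] QMr] := idealQ_ideal.
have [[_ JMl] JMr] := ideal_gen_ideal ecb_max.
have Qp : idealQ conj G (tproj v T F) by rewrite -bac; apply: (QMr); exact: QMl.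
have Jp : ideal_gen ecb_max (tproj v T F) by rewrite -bac; apply: (JMr); exact: JMl.
pose I := [set z : A | forall q, idealQ conj G q -> q ** z = 0].
suff : I (tproj v T F) by apply.
apply: Jp; split; first split; first split; first split.
- by move=> q _; rewrite nmulr0.
- by move=> z1 z2 I1 I2 q Qq; rewrite nmulDr I1 // I2 // addr0.
- by move=> k z I1 q Qq; rewrite -nscalerAr I1 // scaler0.
- by move=> d z I1 q Qq; rewrite nmulA I1 //; exact: QMr.
- by move=> z d I1 q Qq; rewrite nmulA I1 // nmul0r.
move=> _ [v' [T' [tT' N0 ->]]] q Qq.
have fN := finite_NT0 N0.
by rewrite -(ecb_proj conj tT' fN).2; exact: (idealQ_ecb0 tT' fN).
Qed.

Lemma Xcb_tree T : Xcb T -> exists v, [/\ tree v T, finite_set (NT T) & NT T !=set0].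
Proof. by move=> [[v _ /X0_tree tT] fN nN]; exists v. Qed.

Lemma soc_decomposition a : soc A a -> exists a1 a2,
  [/\ ideal_gen [set ecb conj T | T in @Xcb G] a1, ideal_gen ecb_max a2 & a = a1 + a2].
Proof.
set J := ideal_gen _.
have [[[J0 JD _] JMl] JMr] : two_sided_ideal J by exact: ideal_gen_ideal.
have [[[M0 MD _] MMl] MMr] : two_sided_ideal (ideal_gen ecb_max) by exact: ideal_gen_ideal.
case=> s sM ->; elim: s sM => [|y s IH] sM.
  by exists 0, 0; rewrite big_nil addr0.
have [|a1 [a2 [Ja1 Ma2 sE]]] := IH; first by move=> z zs; apply: sM; rewrite inE zs orbT.
have [M mM My] := sM _ (mem_head _ _); rewrite big_cons sE.
have [->|/eqP y0] := eqVneq y 0; first by exists a1, a2; rewrite add0r.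
have [v [T [tT fN ey]]] := minimal_ecb mM My y0.
have [N0|nN] := eqVneq (NT T) set0.
  exists a1, (y + a2); split => //; last by rewrite addrCA.
  apply: MD => //; apply: (ideal_gen_sub _ _ ey); first exact: ideal_gen_ideal.
  by move=> _ ->; apply: sub_ideal_gen; exists v, T.
exists (y + a1), a2; split => //; last by rewrite addrA.
apply: JD => //; apply: (ideal_gen_sub _ _ ey); first exact: ideal_gen_ideal.
move=> _ ->; apply: sub_ideal_gen; exists T => //; split => //; last exact/set0P.
exact: tree_X0 tT.
Qed.

Lemma ecb_idealQ_soc T : Xcb T -> (idealQ conj G `&` soc A) (ecb conj T).
Proof.
move=> /Xcb_tree[v [tT fN nN]]; split; first exact: (ecb_idealQ tT fN nN).
exact: (ecb_soc conj tT fN).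
Qed.

Lemma idealQ_socE : idealQ conj G `&` soc A = ideal_gen [set ecb conj T | T in @Xcb G].
Proof.
have sub : ideal_gen [set ecb conj T | T in @Xcb G] `<=` idealQ conj G `&` soc A.
  apply: ideal_gen_sub; first exact: two_sided_idealI idealQ_ideal (soc_ideal A).
  by move=> _ [T XT <-]; exact: ecb_idealQ_soc.
apply/seteqP; split => // a [Qa /soc_decomposition[a1 [a2 [Ja1 Ma2 aE]]]].
have [[[_ QD QZ] _] _] := idealQ_ideal.
(* The component without neighbours is a - a1, hence lies in Q and vanishes. *)
suff a20 : a2 = 0 by rewrite aE a20 addr0.
apply: idealQ_ecb_max => //.
have -> : a2 = a + (-1) *: a1 by rewrite scaleN1r aE addrAC subrr add0r.
by apply: (QD) => //; apply: QZ; have [] := sub _ Ja1.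
Qed.

End SocleIdeal.

Theorem theorem9p4 (K : fieldType) (conj : {rmorphism K -> K})
    (conjK : involutive conj) (G : sepGraph) :
  (forall T : set (gpath G), Xcb T ->
     (idealQ conj G `&` soc (cohn_ab conj G)) (ecb conj T)) /\
  idealQ conj G `&` soc (cohn_ab conj G) =
    ideal_gen [set ecb conj T | T in @Xcb G].
Proof.
split; first exact: ecb_idealQ_soc.
exact: idealQ_socE.
Qed.
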